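(* Let $f\colon I\to I$, $I=[0,1]$, be a surjective continuous map such that: (i) $f$ has exactly one infinite $\omega$-limit set $\tilde\omega$, and $f$ has zero topological entropy; (ii) $f$ is not Li–Yorke chaotic; (iii) the simple set $M(\tilde\omega)$ has non-empty interior; (iv) the non-degenerate connected components of $M(\tilde\omega)$ can be indexed as $\{G_n\}_{n\in\mathbb Z}$ with $f(G_n)=G_{n+1}$ for all $n\in\mathbb Z$. Then there is a sequence $f_{1,\infty}=(f_1,f_2,\dots)$ of surjective continuous maps $I\to I$ such that (1) $f_{1,\infty}$ converges uniformly to $f$; (2) there is a strictly increasing sequence $S$ of positive integers with $h_S(f_{1,\infty})\ge\log3$; (3) the nonautonomous system $(I,f_{1,\infty})$ is not Li–Yorke chaotic.
   Context: For $f\in C(I)$ and $x\in I$, the $\omega$-limit set of $x$ is the set of limit points of $(f^n(x))_{n\ge1}$. Associated system: if $h(f)=0$ and $\tilde\omega$ is an infinite $\omega$-limit set, there is a system $\{J(n,k):n\ge0,0\le k<2^n\}$ of compact intervals, where for each $n$ the intervals $J(n,0),\dots,J(n,2^n-1)$ form the orbit of a minimal $f$-periodic interval of period $2^n$ whose union contains $\tilde\omega$, with $J(n+1,0)\subset J(n,0)$; the simple set is $M(\tilde\omega)=\bigcap_{n\ge0}\bigcup_{0\le k<2^n}J(n,k)$. NDS $(X,f_{1,\infty})$: compact metric space $(X,\varrho)$ and continuous maps $f_n\colon X\to X$; iterates $f_1^0=\mathrm{id}$, $f_1^n=f_n\circ\dots\circ f_1$. Li–Yorke pair: distinct $x,y$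 with $\limsup_n\varrho(f_1^nx,f_1^ny)>0$ and $\liminf_n\varrho(f_1^nx,f_1^ny)=0$; Li–Yorke chaotic: there is an uncountable set any two distinct points of which form a Li–Yorke pair (for an autonomous map $f$ use $f_n=f$ for all $n$). Topological sequence entropy: for strictly increasing $A=(a_i)$ of positive integers, $\varrho_n^A(x,y)=\max_{1\le j\le n}\varrho(f_1^{a_j}x,f_1^{a_j}y)$; $E$ is $(n,\varepsilon,A)$-separated if $\varrho_n^A(x,y)>\varepsilon$ for distinct $x,y\in E$; $s_n^A(f_{1,\infty},\varepsilon)$ is the maximal cardinality of such $E$; $h_A(f_{1,\infty})=\lim_{\varepsilon\to0}\limsup_{n\to\infty}\frac1n\log s_n^A(f_{1,\infty},\varepsilon)$. Topological entropy is the case $a_i=i$. *)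

(* Defs.v *)
From Stdlib Require Import Reals List ZArith.
Open Scope R_scope.

(* Maps I -> I are represented as functions R -> R; only values on I matter. *)
Definition in_I (x : R) : Prop := 0 <= x <= 1.
Definition maps_I (f : R -> R) : Prop := forall x, in_I x -> in_I (f x).
Definition cont_I (f : R -> R) : Prop :=
  forall x, in_I x -> forall eps, 0 < eps -> exists delta, 0 < delta /\
    forall y, in_I y -> Rabs (y - x) < delta -> Rabs (f y - f x) < eps.
Definition surj_I (f : R -> R) : Prop :=
  forall y, in_I y -> exists x, in_I x /\ f x = y.

Definition set_eq (A B : R -> Prop) : Prop := forall y, A y <-> B y.
Definition image (f : R -> R) (A : R -> Prop) : R -> Prop :=
  fun y => exists x, A x /\ f x = y.
Definition image_iter (f : R -> R) (k : nat) (A : R -> Prop) : R -> Prop :=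
  fun y => exists x, A x /\ Nat.iter k f x = y.

(* fs n is f_n for n >= 1 (fs 0 is unused); nds_iter fs n = f_n o ... o f_1. *)
Fixpoint nds_iter (fs : nat -> R -> R) (n : nat) (x : R) : R :=
  match n with
  | O => x
  | S m => fs (S m) (nds_iter fs m x)
  end.
Definition auto (f : R -> R) : nat -> R -> R := fun _ => f.

Definition unif_conv (fs : nat -> R -> R) (f : R -> R) : Prop :=
  forall eps, 0 < eps -> exists N, forall n, (N <= n)%nat -> (1 <= n)%nat ->
    forall x, in_I x -> Rabs (fs n x - f x) < eps.

Definition omega_limit (f : R -> R) (x y : R) : Prop :=
  forall eps, 0 < eps -> forall N : nat, exists n, (N <= n)%nat /\ (1 <= n)%nat /\
    Rabs (Nat.iter n f x - y) < eps.
Definition is_omega_limit_set (f : R -> R) (W : R -> Prop) : Prop :=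
  exists x, in_I x /\ set_eq W (omega_limit f x).
Definition infinite_set (W : R -> Prop) : Prop :=
  forall l : list R, exists y, W y /\ ~ In y l.

Inductive ER := Fin (r : R) | PInf.
Definition ER_gt (h : ER) (c : R) : Prop :=
  match h with Fin r => c < r | PInf => True end.
Definition ER_ge (h : ER) (c : R) : Prop :=
  match h with Fin r => c <= r | PInf => True end.

Definition is_limsup (u : nat -> R) (l : ER) : Prop :=
  match l with
  | Fin r => (forall e, 0 < e -> exists N, forall n, (N <= n)%nat -> u n < r + e) /\
             (forall e, 0 < e -> forall N, exists n, (N <= n)%nat /\ r - e < u n)
  | PInf => forall M, forall N, exists n, (N <= n)%nat /\ M < u n
  end.
Definition is_liminf_fin (u : nat -> R) (r : R) : Prop :=
  (forall e, 0 < e -> exists N, forall n, (N <= n)%nat -> r - e < u n) /\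
  (forall e, 0 < e -> forall N, exists n, (N <= n)%nat /\ u n < r + e).

Definition is_lim_right0 (L : R -> ER) (h : ER) : Prop :=
  match h with
  | Fin l => forall e, 0 < e -> exists d, 0 < d /\
               forall t, 0 < t < d -> exists r, L t = Fin r /\ Rabs (r - l) < e
  | PInf => forall M, exists d, 0 < d /\ forall t, 0 < t < d -> ER_gt (L t) M
  end.

Definition strictly_incr_pos (a : nat -> nat) : Prop :=
  (1 <= a 1%nat)%nat /\ forall i, (1 <= i)%nat -> (a i < a (S i))%nat.

(* rho_n^A(x,y) = max_{1<=j<=n} |f_1^{a_j} x - f_1^{a_j} y| (distances are >= 0) *)
Fixpoint rho (fs : nat -> R -> R) (a : nat -> nat) (n : nat) (x y : R) : R :=
  match n with
  | O => 0
  | S m => Rmax (rho fs a m x y)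
                (Rabs (nds_iter fs (a (S m)) x - nds_iter fs (a (S m)) y))
  end.

Definition separated fs a (n : nat) (eps : R) (E : list R) : Prop :=
  NoDup E /\ (forall x, In x E -> in_I x) /\
  forall x y, In x E -> In y E -> x <> y -> rho fs a n x y > eps.

Definition max_sep_card fs a (n : nat) (eps : R) (k : nat) : Prop :=
  (exists E, separated fs a n eps E /\ length E = k) /\
  forall E, separated fs a n eps E -> (length E <= k)%nat.

Definition seq_entropy (fs : nat -> R -> R) (a : nat -> nat) (h : ER) : Prop :=
  exists (s : nat -> R -> nat) (L : R -> ER),
    (forall n eps, (1 <= n)%nat -> 0 < eps -> max_sep_card fs a n eps (s n eps)) /\
    (forall eps, 0 < eps -> is_limsup (fun n => ln (INR (s n eps)) / INR n) (L eps)) /\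
    is_lim_right0 L h.

Definition top_entropy (f : R -> R) (h : ER) : Prop :=
  seq_entropy (auto f) (fun i => i) h.

Definition LY_pair (fs : nat -> R -> R) (x y : R) : Prop :=
  x <> y /\
  (exists l, is_limsup (fun n => Rabs (nds_iter fs n x - nds_iter fs n y)) l /\ ER_gt l 0) /\
  is_liminf_fin (fun n => Rabs (nds_iter fs n x - nds_iter fs n y)) 0.
Definition countable_set (S : R -> Prop) : Prop :=
  exists g : nat -> R, forall x, S x -> exists n, g n = x.
Definition LY_chaotic (fs : nat -> R -> R) : Prop :=
  exists S : R -> Prop, (forall x, S x -> in_I x) /\ ~ countable_set S /\
    forall x y, S x -> S y -> x <> y -> LY_pair fs x y.

Definition interval (c : R * R) : R -> Prop := fun y => fst c <= y <= snd c.

Definition periodic_interval (f : R -> R) (m : nat) (c : R * R) : Prop :=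
  fst c <= snd c /\ in_I (fst c) /\ in_I (snd c) /\
  (forall i j, (i < j)%nat -> (j < m)%nat -> forall y,
      ~ (image_iter f i (interval c) y /\ image_iter f j (interval c) y)) /\
  set_eq (image_iter f m (interval c)) (interval c).

Definition orbit_union (f : R -> R) (m : nat) (c : R * R) : R -> Prop :=
  fun y => exists k, (k < m)%nat /\ image_iter f k (interval c) y.

Definition assoc_system (f : R -> R) (W : R -> Prop) (J : nat -> nat -> R * R) : Prop :=
  forall n : nat,
    periodic_interval f (Nat.pow 2 n) (J n 0%nat) /\
    (forall k, (k < Nat.pow 2 n)%nat ->
       fst (J n k) <= snd (J n k) /\
       set_eq (interval (J n k)) (image_iter f k (interval (J n 0%nat)))) /\
    (forall y, W y -> orbit_union f (Nat.pow 2 n) (J n 0%nat) y) /\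
    (forall c, periodic_interval f (Nat.pow 2 n) c ->
       (forall y, W y -> orbit_union f (Nat.pow 2 n) c y) ->
       (forall y, interval c y -> interval (J n 0%nat) y) ->
       set_eq (interval c) (interval (J n 0%nat))) /\
    (forall y, interval (J (S n) 0%nat) y -> interval (J n 0%nat) y).

Definition simple_set (J : nat -> nat -> R * R) : R -> Prop :=
  fun y => forall n, exists k, (k < Nat.pow 2 n)%nat /\ interval (J n k) y.

Definition nonempty_interior (A : R -> Prop) : Prop :=
  exists x r, 0 < r /\ forall y, Rabs (y - x) < r -> A y.

Definition connected_R (C : R -> Prop) : Prop :=
  forall x y z, C x -> C y -> x <= z <= y -> C z.
Definition is_component (A C : R -> Prop) : Prop :=
  (exists x, C x) /\ (forall y, C y -> A y) /\ connected_R C /\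
  forall D, connected_R D -> (forall y, D y -> A y) ->
    (exists y, D y /\ C y) -> forall y, D y -> C y.
Definition nondegenerate (C : R -> Prop) : Prop :=
  exists x y, C x /\ C y /\ x <> y.

Definition components_Z_indexed (f : R -> R) (M : R -> Prop) : Prop :=
  exists G : Z -> (R -> Prop),
    (forall n, is_component M (G n) /\ nondegenerate (G n)) /\
    (forall n m, n <> m -> ~ set_eq (G n) (G m)) /\
    (forall C, is_component M C -> nondegenerate C -> exists n, set_eq C (G n)) /\
    (forall n, set_eq (image f (G n)) (G (n + 1)%Z)).

(* Main.v *)
Require Import Defs.
From Stdlib Require Import Reals List ZArith Lra Lia Classical ClassicalEpsilon FunctionalExtensionality Cantor.
Open Scope R_scope.

(** Write [J n t] for [f^t (J n 0)], so that the right phase of level [n] at time [t] is [J n t].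
    The maps [f_t] differ from [f] only on an interval [J n t] of the right phase, which they still map onto
    [J n (t+1)], with the values of [f] at the end points.

    In block [j], points of [J (j+1) t] follow a map that stretches three separated parts of a nondegenerate
    component of the simple set over the whole [J (j+1) t]; the expansion takes place on the way into an interval
    [J (j+1) (k+1)] of length at most [2^-j], so it is a small perturbation of [f]. The number of loops in
    block [j] dwarfs all earlier ones, which gives sequence entropy at least [log 3] along the visits to the
    component. The block ends with a map that crushes [J j t] to two points, except for a tiny window which it
    stretches over [J j (t+1)].

    A point is then eventually autonomous, or crushed (countably many orbits), or it is moved infinitely often and
    only inside windows. The windows are chosen near points [z] forming one-point fibres of the simple set.
    Since [f] is not Li-Yorke chaotic, the iterated preimages of such points in [J n t] have diameter tending to 0
    with [n], uniformly in [t]: otherwise they accumulate at both ends of some nondegenerate component, and by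
    minimality of the periodic intervals every one-sided neighbourhood of either end expands over the component,
    which yields a scrambled set. Hence any two points of the third kind are asymptotic. *)

(** The two goals pull against each other: the entropy needs ever longer stretches of full
    expansion, and each stretch creates many orbits that part and meet again. A map onto a
    nondegenerate interval cannot crush everything, so something must survive a crush; the surviving
    window is put in the half of [J j t] that the loops of block [j] do not use. Hence every point
    that ran through the loops is crushed, and a surviving point was never touched by a loop. Short
    intervals exist at every level because one of two disjoint halves has at most half the length.
    The expansion is nevertheless visible at a fixed scale: a segment [[ga, gb]] of one component
    lies in a single interval of each level, and three of its five equal parts stay [(gb - ga) / 5]
    apart in every block. Hypothesis (iv) guarantees that images of a nondegenerate component are
    nondegenerate. So a point whose orbit hits a one-point fibre is in no nondegenerate component,
    which forces such points to lie outside a limit segment, on both sides of it. *)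

Definition cont_on (a b : R) (g : R -> R) : Prop :=
  forall x, a <= x <= b -> forall eps, 0 < eps -> exists delta, 0 < delta /\
    forall y, a <= y <= b -> Rabs (y - x) < delta -> Rabs (g y - g x) < eps.

Lemma cont_on_subset a b c d g : cont_on a b g -> a <= c -> d <= b -> cont_on c d g.
Proof.
  intros H Hc Hd x Hx eps He. destruct (H x ltac:(lra) eps He) as [dl [Hdl H']].
  exists dl; split; [exact Hdl|]. intros y Hy; apply H'; lra.
Qed.

Lemma cont_on_ext a b g h : (forall x, a <= x <= b -> g x = h x) -> cont_on a b g -> cont_on a b h.
Proof.
  intros E H x Hx eps He. destruct (H x Hx eps He) as [dl [Hdl H']].
  exists dl; split; [exact Hdl|]. intros y Hy Hyx. rewrite <- !E by assumption. apply H'; assumption.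
Qed.

Lemma cont_on_comp a b c d g h : cont_on a b g -> cont_on c d h ->
  (forall x, a <= x <= b -> c <= g x <= d) -> cont_on a b (fun x => h (g x)).
Proof.
  intros Hg Hh Hm x Hx eps He. destruct (Hh (g x) (Hm x Hx) eps He) as [e1 [He1 H1]].
  destruct (Hg x Hx e1 He1) as [dl [Hdl H2]]. exists dl; split; [exact Hdl|].
  intros y Hy Hyx. apply H1; [apply Hm; exact Hy|]. apply H2; assumption.
Qed.

Lemma Rabs_lt_iff x e : Rabs x < e <-> - e < x < e.
Proof. split; [intros H; apply Rabs_def2 in H; lra|intros; apply Rabs_def1; lra]. Qed.

Lemma clamp_dist a b x y : a <= b ->
  Rabs (Rmax a (Rmin b y) - Rmax a (Rmin b x)) <= Rabs (y - x).
Proof.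
  intros Hab. unfold Rmax, Rmin.
  repeat destruct Rle_dec; unfold Rabs; repeat destruct Rcase_abs; lra.
Qed.

Lemma clamp_in a b x : a <= b -> a <= Rmax a (Rmin b x) <= b.
Proof. intros; unfold Rmax, Rmin; repeat destruct Rle_dec; lra. Qed.

Lemma clamp_id a b x : a <= x <= b -> Rmax a (Rmin b x) = x.
Proof. intros; unfold Rmax, Rmin; repeat destruct Rle_dec; lra. Qed.

Lemma cont_on_clamp a b g : a <= b -> cont_on a b g ->
  continuity (fun x => g (Rmax a (Rmin b x))).
Proof.
  intros Hab Hg x eps He.
  destruct (Hg _ (clamp_in a b x Hab) eps He) as [dl [Hdl H]].
  exists dl; split; [exact Hdl|]. intros y [_ Hy]. simpl in *. unfold Rdist in *.
  apply H; [apply clamp_in; exact Hab|].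
  eapply Rle_lt_trans; [apply clamp_dist; exact Hab|exact Hy].
Qed.

Lemma IVT_on a b g y : cont_on a b g -> a <= b ->
  (g a <= y <= g b \/ g b <= y <= g a) -> exists x, a <= x <= b /\ g x = y.
Proof.
  intros Hg Hab Hy.
  assert (Hc := cont_on_clamp a b g Hab Hg).
  destruct (IVT_cor (fun x => g (Rmax a (Rmin b x)) - y) a b) as [z [Hz Ez]].
  - apply continuity_minus; [exact Hc|]. apply continuity_const. intros u v; reflexivity.
  - exact Hab.
  - rewrite !clamp_id by lra. destruct Hy; nra.
  - exists z; split; [exact Hz|]. rewrite clamp_id in Ez by exact Hz. lra.
Qed.

Definition image_on (g : R -> R) (a b : R) : R -> Prop :=
  fun y => exists x, a <= x <= b /\ g x = y.

Lemma image_on_connected a b g y1 y2 y : cont_on a b g ->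
  image_on g a b y1 -> image_on g a b y2 -> y1 <= y <= y2 -> image_on g a b y.
Proof.
  intros Hg [x1 [H1 E1]] [x2 [H2 E2]] Hy.
  destruct (Rle_dec x1 x2).
  - destruct (IVT_on x1 x2 g y) as [x [Hx E]]; [|lra|left; lra|].
    + eapply cont_on_subset; [exact Hg|lra|lra].
    + exists x; split; [lra|exact E].
  - destruct (IVT_on x2 x1 g y) as [x [Hx E]]; [|lra|right; lra|].
    + eapply cont_on_subset; [exact Hg|lra|lra].
    + exists x; split; [lra|exact E].
Qed.

Lemma cluster_point a b (u : nat -> R) : (forall n, a <= u n <= b) ->
  exists l, a <= l <= b /\ forall eps, 0 < eps -> forall N, exists n, (N <= n)%nat /\ Rabs (u n - l) < eps.
Proof.
  intros Hu. destruct (Bolzano_Weierstrass u _ (compact_P3 a b) Hu) as [l Hl].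
  assert (H : forall eps, 0 < eps -> forall N, exists n, (N <= n)%nat /\ Rabs (u n - l) < eps).
  { intros eps He N.
    destruct (Hl (fun y => Rabs (y - l) < eps) N) as [p [Hp1 Hp2]].
    - exists (mkposreal eps He). intros y Hy; exact Hy.
    - exists p; split; assumption. }
  exists l; split; [|exact H].
  split; apply Rnot_lt_le; intros Hlt.
  - destruct (H (a - l) ltac:(lra) 0%nat) as [n [_ Hn]]. apply Rabs_lt_iff in Hn. specialize (Hu n); lra.
  - destruct (H (l - b) ltac:(lra) 0%nat) as [n [_ Hn]]. apply Rabs_lt_iff in Hn. specialize (Hu n); lra.
Qed.

Lemma inv_INR_small eps : 0 < eps -> exists N, forall n, (N <= n)%nat -> / (INR n + 1) < eps.
Proof.
  intros He. destruct (archimed_cor1 eps He) as [N [HN HN0]]. exists N. intros n Hn.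
  apply Rlt_trans with (/ INR N); [|exact HN].
  apply le_INR in Hn. assert (0 < INR N) by (apply lt_0_INR; lia).
  apply Rinv_lt_contravar; [apply Rmult_lt_0_compat; lra|lra].
Qed.

Lemma inv_INR_pos n : 0 < / (INR n + 1).
Proof. apply Rinv_0_lt_compat. pose proof (pos_INR n); lra. Qed.

(* Points whose image is near [y] are near the fibre of [y]; vacuous when the fibre is empty,
   in which case it says that [y] is at positive distance from the image. *)
Lemma near_fibre a b g y eta : cont_on a b g -> 0 < eta ->
  exists rho, 0 < rho /\ forall x, a <= x <= b -> Rabs (g x - y) < rho ->
    exists x', a <= x' <= b /\ g x' = y /\ Rabs (x - x') < eta.
Proof.
  intros Hg Heta. apply NNPP; intros Hn.
  assert (H : forall n : nat, exists x, a <= x <= b /\ Rabs (g x - y) < / (INR n + 1) /\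
    ~ exists x', a <= x' <= b /\ g x' = y /\ Rabs (x - x') < eta).
  { intros n. apply NNPP; intros H. apply Hn. exists (/ (INR n + 1)); split; [apply inv_INR_pos|].
    intros x Hx Hxy. apply NNPP; intros H'. apply H. exists x; auto. }
  apply choice in H. destruct H as [u Hu].
  destruct (cluster_point a b u) as [l [Hl Hcl]]; [intros n; apply Hu|].
  assert (Ey : g l = y).
  { apply Rminus_diag_uniq. apply NNPP; intros Hne.
    assert (Hp : 0 < Rabs (g l - y)) by (apply Rabs_pos_lt; exact Hne).
    set (e := Rabs (g l - y) / 2) in *.
    assert (He0 : 0 < e) by (unfold e; lra). destruct (Hg l Hl e He0) as [dl [Hdl H1]].
    destruct (inv_INR_small e He0) as [N HN].
    destruct (Hcl dl Hdl N) as [n [Hn1 Hn2]].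
    destruct (Hu n) as [Hun [Hun2 _]].
    specialize (H1 _ Hun Hn2). specialize (HN n Hn1).
    pose proof (Rabs_triang (g l - g (u n)) (g (u n) - y)) as Ht.
    replace (g l - g (u n) + (g (u n) - y)) with (g l - y) in Ht by ring.
    rewrite (Rabs_minus_sym (g l) (g (u n))) in Ht. unfold e in *; lra. }
  destruct (Hcl eta Heta 0%nat) as [n [_ Hn2]].
  destruct (Hu n) as [_ [_ Hno]]. apply Hno. exists l; auto.
Qed.

Lemma image_pos_dist a b g y : cont_on a b g -> ~ image_on g a b y ->
  exists rho, 0 < rho /\ forall x, a <= x <= b -> rho <= Rabs (g x - y).
Proof.
  intros Hg Hn. destruct (near_fibre a b g y 1 Hg ltac:(lra)) as [rho [Hr H]].
  exists rho; split; [exact Hr|]. intros x Hx. apply Rnot_lt_le; intros Hlt.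
  destruct (H x Hx Hlt) as [x' [H1 [H2 _]]]. apply Hn. exists x'; auto.
Qed.

Lemma unif_cont_on a b g eps : cont_on a b g -> 0 < eps ->
  exists delta, 0 < delta /\ forall x y, a <= x <= b -> a <= y <= b ->
    Rabs (x - y) < delta -> Rabs (g x - g y) < eps.
Proof.
  intros Hg He. apply NNPP; intros Hn.
  assert (H : forall n : nat, exists p : R * R, a <= fst p <= b /\ a <= snd p <= b /\
     Rabs (fst p - snd p) < / (INR n + 1) /\ ~ Rabs (g (fst p) - g (snd p)) < eps).
  { intros n. apply NNPP; intros H. apply Hn. exists (/ (INR n + 1)); split; [apply inv_INR_pos|].
    intros x y Hx Hy Hxy. apply NNPP; intros H'. apply H. exists (x, y); auto. }
  apply choice in H. destruct H as [u Hu].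
  destruct (cluster_point a b (fun n => fst (u n))) as [l [Hl Hcl]]; [intros n; apply Hu|].
  destruct (Hg l Hl (eps / 2) ltac:(lra)) as [dl [Hdl H1]].
  destruct (inv_INR_small (dl / 2) ltac:(lra)) as [N HN].
  destruct (Hcl (dl / 2) ltac:(lra) N) as [n [Hn1 Hn2]].
  destruct (Hu n) as [A [B [C D]]]. specialize (HN n Hn1). apply D.
  assert (E1 := H1 _ A ltac:(lra)).
  assert (E2 : Rabs (g (snd (u n)) - g l) < eps / 2).
  { apply H1; [exact B|]. rewrite Rabs_minus_sym in C.
    pose proof (Rabs_triang (snd (u n) - fst (u n)) (fst (u n) - l)) as Ht.
    replace (snd (u n) - fst (u n) + (fst (u n) - l)) with (snd (u n) - l) in Ht by ring. lra. }
  rewrite Rabs_minus_sym in E2.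
  pose proof (Rabs_triang (g (fst (u n)) - g l) (g l - g (snd (u n)))) as Ht.
  replace (g (fst (u n)) - g l + (g l - g (snd (u n)))) with (g (fst (u n)) - g (snd (u n))) in Ht by ring.
  lra.
Qed.

Lemma finite_min_pos (P : nat -> R -> Prop) K :
  (forall k r r', P k r -> 0 < r' <= r -> P k r') ->
  (forall k, (k < K)%nat -> exists r, 0 < r /\ P k r) ->
  exists r, 0 < r /\ forall k, (k < K)%nat -> P k r.
Proof.
  intros Hm. induction K as [|K IH]; intros H.
  - exists 1; split; [lra|]. intros k Hk; lia.
  - destruct IH as [r [Hr H1]]; [intros k Hk; apply H; lia|].
    destruct (H K ltac:(lia)) as [r' [Hr' H2]].
    assert (Hmin : 0 < Rmin r r') by (apply Rmin_glb_lt; assumption).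
    exists (Rmin r r'); split; [exact Hmin|].
    intros k Hk. destruct (Nat.eq_dec k K) as [->|Hne].
    + eapply Hm; [exact H2|]. split; [exact Hmin|apply Rmin_r].
    + eapply Hm; [apply H1; lia|]. split; [exact Hmin|apply Rmin_l].
Qed.

(** * Interval surjections with prescribed behaviour *)

Lemma connecting_map c d lo hi y1 y2 : c < d -> lo <= y1 <= hi -> lo <= y2 <= hi ->
  exists u, (forall a b, cont_on a b u) /\ (forall x, x <= c -> u x = y1) /\
    (forall x, d <= x -> u x = y2) /\ (forall x, lo <= u x <= hi) /\
    (forall y, lo <= y <= hi -> exists x, c <= x <= d /\ u x = y).
Proof.
  intros Hcd H1 H2.
  set (h := (d - c) / 3).
  assert (Hh : 0 < h) by (unfold h; lra).
  set (r := fun s x => Rmax 0 (Rmin 1 ((x - s) / h))).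
  assert (Rin : forall s x, 0 <= r s x <= 1) by (intros; apply clamp_in; lra).
  assert (R0 : forall s x, x <= s -> r s x = 0).
  { intros s x Hx. unfold r. assert ((x - s) / h <= 0).
    { unfold Rdiv. assert (0 < / h) by (apply Rinv_0_lt_compat; exact Hh). nra. }
    unfold Rmax, Rmin; repeat destruct Rle_dec; lra. }
  assert (R1 : forall s x, s + h <= x -> r s x = 1).
  { intros s x Hx. unfold r. assert (1 <= (x - s) / h).
    { apply Rmult_le_reg_r with h; [exact Hh|]. unfold Rdiv.
      rewrite Rmult_assoc, Rinv_l, Rmult_1_r by lra. lra. }
    unfold Rmax, Rmin; repeat destruct Rle_dec; lra. }
  assert (RL : forall s x y, Rabs (r s y - r s x) <= Rabs (y - x) / h).
  { intros s x y. unfold r. eapply Rle_trans; [apply clamp_dist; lra|].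
    replace ((y - s) / h - (x - s) / h) with ((y - x) / h) by (field; lra).
    unfold Rdiv. rewrite Rabs_mult, (Rabs_right (/ h)); [lra|].
    apply Rle_ge. left; apply Rinv_0_lt_compat; exact Hh. }
  (* The graph runs from [y1] to [lo], from [lo] to [hi] and from [hi] to [y2] on the three thirds
     of [[c, d]]; [r s] is the ramp from 0 to 1 on [[s, s + h]]. The middle third alone covers
     [[lo, hi]]. *)
  set (u := fun x => y1 + (lo - y1) * r c x + (hi - lo) * r (c + h) x + (y2 - hi) * r (c + 2 * h) x).
  assert (Ec : forall x, x <= c -> u x = y1).
  { intros x Hx. unfold u. rewrite !R0 by lra. ring. }
  assert (Ed : forall x, d <= x -> u x = y2).
  { intros x Hx. unfold u. rewrite !R1 by (unfold h; lra). ring. }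
  assert (Cu : forall a b, cont_on a b u).
  { intros a b x Hx eps He.
    (* [L / h] is a Lipschitz constant; the [+ 1] keeps it positive when all three heights
       vanish. *)
    set (L := Rabs (lo - y1) + Rabs (hi - lo) + Rabs (y2 - hi) + 1).
    assert (HL : 0 < L) by (unfold L; pose proof (Rabs_pos (lo - y1)); pose proof (Rabs_pos (hi - lo));
      pose proof (Rabs_pos (y2 - hi)); lra).
    exists (eps * h / L). split; [apply Rdiv_lt_0_compat; [apply Rmult_lt_0_compat; lra|exact HL]|].
    intros y Hy Hyx. unfold u.
    replace (y1 + (lo - y1) * r c y + (hi - lo) * r (c + h) y + (y2 - hi) * r (c + 2 * h) y -
      (y1 + (lo - y1) * r c x + (hi - lo) * r (c + h) x + (y2 - hi) * r (c + 2 * h) x))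
      with ((lo - y1) * (r c y - r c x) + ((hi - lo) * (r (c + h) y - r (c + h) x) +
       (y2 - hi) * (r (c + 2 * h) y - r (c + 2 * h) x))) by ring.
    set (q := Rabs (y - x) / h).
    assert (Hq : 0 <= q) by (unfold q; apply Rmult_le_pos; [apply Rabs_pos|left; apply Rinv_0_lt_compat; exact Hh]).
    eapply Rle_lt_trans; [apply Rabs_triang|].
    eapply Rle_lt_trans; [apply Rplus_le_compat_l, Rabs_triang|].
    rewrite !Rabs_mult.
    assert (A1 := RL c x y). assert (A2 := RL (c + h) x y). assert (A3 := RL (c + 2 * h) x y).
    fold q in A1, A2, A3.
    assert (B1 := Rmult_le_compat_l _ _ _ (Rabs_pos (lo - y1)) A1).
    assert (B2 := Rmult_le_compat_l _ _ _ (Rabs_pos (hi - lo)) A2).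
    assert (B3 := Rmult_le_compat_l _ _ _ (Rabs_pos (y2 - hi)) A3).
    assert (Hq2 : q * L < eps).
    { unfold q. apply Rmult_lt_reg_r with h; [exact Hh|].
      replace (Rabs (y - x) / h * L * h) with (Rabs (y - x) * L) by (field; lra).
      apply Rmult_lt_compat_r with (r := L) in Hyx; [|exact HL].
      replace (eps * h / L * L) with (eps * h) in Hyx by (field; lra). exact Hyx. }
    unfold L in Hq2. nra. }
  exists u. split; [exact Cu|]. split; [exact Ec|]. split; [exact Ed|]. split.
  - intros x. unfold u.
    destruct (Rle_dec x (c + h)).
    + rewrite (R0 (c + h)), (R0 (c + 2 * h)) by lra. pose proof (Rin c x). nra.
    + destruct (Rle_dec x (c + 2 * h)).
      * rewrite (R0 (c + 2 * h)), (R1 c) by lra. pose proof (Rin (c + h) x). nra.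
      * rewrite (R1 c), (R1 (c + h)) by lra. pose proof (Rin (c + 2 * h) x). nra.
  - intros y Hy. destruct (IVT_on (c + h) (c + 2 * h) u y) as [x [Hx E]].
    + apply Cu.
    + lra.
    + left. unfold u. rewrite (R1 c), (R0 (c + h) (c + h)), !(R0 (c + 2 * h)), (R1 c), (R1 (c + h)) by lra. lra.
    + exists x; split; [unfold h in *; lra|exact E].
Qed.

Definition splice (f : R -> R) (a b : R) (g : R -> R) (x : R) : R :=
  if Rle_dec a x then if Rle_dec x b then g x else f x else f x.

Lemma splice_in f a b g x : a <= x <= b -> splice f a b g x = g x.
Proof. intros Hx; unfold splice. repeat destruct Rle_dec; try reflexivity; lra. Qed.

Lemma splice_out f a b g x : ~ (a <= x <= b) -> splice f a b g x = f x.
Proof. intros Hx; unfold splice. repeat destruct Rle_dec; try reflexivity; exfalso; apply Hx; lra. Qed.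

Lemma cont_on_splice p q f a b g : a <= b -> cont_on p q f -> cont_on a b g ->
  f a = g a -> f b = g b -> cont_on p q (splice f a b g).
Proof.
  intros Hab Hf Hg Ea Eb x Hx eps He.
  destruct (Hf x Hx (eps / 2) ltac:(lra)) as [d1 [Hd1 H1]].
  destruct (Rlt_dec x a) as [Hxa|Hxa]; [|destruct (Rlt_dec b x) as [Hxb|Hxb]].
  - exists (Rmin d1 (a - x)); split; [apply Rmin_glb_lt; lra|]. intros y Hy Hyx.
    assert (Rabs (y - x) < d1) by (eapply Rlt_le_trans; [exact Hyx|apply Rmin_l]).
    assert (Hy2 : Rabs (y - x) < a - x) by (eapply Rlt_le_trans; [exact Hyx|apply Rmin_r]).
    apply Rabs_lt_iff in Hy2. rewrite !splice_out by lra. specialize (H1 y Hy ltac:(assumption)); lra.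
  - exists (Rmin d1 (x - b)); split; [apply Rmin_glb_lt; lra|]. intros y Hy Hyx.
    assert (Rabs (y - x) < d1) by (eapply Rlt_le_trans; [exact Hyx|apply Rmin_l]).
    assert (Hy2 : Rabs (y - x) < x - b) by (eapply Rlt_le_trans; [exact Hyx|apply Rmin_r]).
    apply Rabs_lt_iff in Hy2. rewrite !splice_out by lra. specialize (H1 y Hy ltac:(assumption)); lra.
  - assert (Hxab : a <= x <= b) by lra. rewrite (splice_in f a b g x Hxab).
    destruct (Hg x Hxab eps He) as [d2 [Hd2 H2]].
    (* a neighbour [y] of [x] outside [[a, b]] is across an end point [e] that is also a neighbour of [x] *)
    destruct (Req_dec x a) as [Exa|Nxa]; destruct (Req_dec x b) as [Exb|Nxb].
    + exists (Rmin d1 d2); split; [apply Rmin_glb_lt; lra|]. intros y Hy Hyx.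
      assert (Rabs (y - x) < d1) by (eapply Rlt_le_trans; [exact Hyx|apply Rmin_l]).
      assert (Rabs (y - x) < d2) by (eapply Rlt_le_trans; [exact Hyx|apply Rmin_r]).
      destruct (classic (a <= y <= b)) as [Hyi|Hyo].
      * rewrite splice_in by exact Hyi. apply H2; assumption.
      * rewrite splice_out by exact Hyo. rewrite Exa, <- Ea, <- Exa. specialize (H1 y Hy ltac:(assumption)); lra.
    + exists (Rmin (Rmin d1 d2) (b - x)); split; [repeat apply Rmin_glb_lt; lra|]. intros y Hy Hyx.
      assert (Hm : Rabs (y - x) < Rmin d1 d2) by (eapply Rlt_le_trans; [exact Hyx|apply Rmin_l]).
      assert (Rabs (y - x) < d1) by (eapply Rlt_le_trans; [exact Hm|apply Rmin_l]).
      assert (Rabs (y - x) < d2) by (eapply Rlt_le_trans; [exact Hm|apply Rmin_r]).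
      destruct (classic (a <= y <= b)) as [Hyi|Hyo].
      * rewrite splice_in by exact Hyi. apply H2; assumption.
      * rewrite splice_out by exact Hyo. rewrite Exa, <- Ea, <- Exa. specialize (H1 y Hy ltac:(assumption)); lra.
    + exists (Rmin (Rmin d1 d2) (x - a)); split; [repeat apply Rmin_glb_lt; lra|]. intros y Hy Hyx.
      assert (Hm : Rabs (y - x) < Rmin d1 d2) by (eapply Rlt_le_trans; [exact Hyx|apply Rmin_l]).
      assert (Rabs (y - x) < d1) by (eapply Rlt_le_trans; [exact Hm|apply Rmin_l]).
      assert (Rabs (y - x) < d2) by (eapply Rlt_le_trans; [exact Hm|apply Rmin_r]).
      destruct (classic (a <= y <= b)) as [Hyi|Hyo].
      * rewrite splice_in by exact Hyi. apply H2; assumption.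
      * rewrite splice_out by exact Hyo. rewrite Exb, <- Eb, <- Exb. specialize (H1 y Hy ltac:(assumption)); lra.
    + exists (Rmin d2 (Rmin (x - a) (b - x))); split; [repeat apply Rmin_glb_lt; lra|]. intros y Hy Hyx.
      assert (Rabs (y - x) < d2) by (eapply Rlt_le_trans; [exact Hyx|apply Rmin_l]).
      assert (Hm : Rabs (y - x) < Rmin (x - a) (b - x)) by (eapply Rlt_le_trans; [exact Hyx|apply Rmin_r]).
      assert (M1 : Rabs (y - x) < x - a) by (eapply Rlt_le_trans; [exact Hm|apply Rmin_l]).
      assert (M2 : Rabs (y - x) < b - x) by (eapply Rlt_le_trans; [exact Hm|apply Rmin_r]).
      apply Rabs_lt_iff in M1. apply Rabs_lt_iff in M2.
      rewrite splice_in by lra. apply H2; [lra|assumption].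
Qed.

Definition onto_map (a b c d : R) (g : R -> R) : Prop :=
  cont_on a b g /\ (forall x, a <= x <= b -> c <= g x <= d) /\
  (forall y, c <= y <= d -> image_on g a b y).

(** The intervals given to [wild_map] and [nonconstant_map] may overlap. Rewriting a map only on a
    piece that is inside or off each of them spoils none: an interval containing the piece inherits
    what the piece does, and on the others the map is unchanged. *)
Lemma shrink_interval (l : list (R * R)) p q : p < q ->
  exists p' q', p <= p' /\ p' < q' /\ q' <= q /\
    forall F, In F l -> (fst F <= p' /\ q' <= snd F) \/ q' < fst F \/ snd F < p'.
Proof.
  intros Hpq. induction l as [|[u v] l [p1 [q1 [H1 [H2 [H3 H4]]]]]].
  - exists p, q. repeat split; try lra. intros F [].
  - assert (H : exists p' q', p1 <= p' /\ p' < q' /\ q' <= q1 /\ ((u <= p' /\ q' <= v) \/ q' < u \/ v < p')).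
    { destruct (Rlt_dec p1 u) as [Hu|Hu].
      - exists p1, (Rmin q1 ((p1 + u) / 2)). pose proof (Rmin_r q1 ((p1 + u) / 2)).
        repeat split; [lra|apply Rmin_glb_lt; lra|apply Rmin_l|right; left; lra].
      - destruct (Rlt_dec v q1) as [Hv|Hv].
        + exists (Rmax p1 ((v + q1) / 2)), q1. pose proof (Rmax_r p1 ((v + q1) / 2)).
          repeat split; [apply Rmax_l|apply Rmax_lub_lt; lra|lra|right; right; lra].
        + exists p1, q1. repeat split; try lra. }
    destruct H as [p' [q' [A1 [A2 [A3 A4]]]]]. exists p', q'. repeat split; try lra.
    intros F [<-|HF]; [exact A4|]. destruct (H4 F HF) as [[B1 B2]|[B|B]]; [left|right; left|right; right]; lra.
Qed.

(** No value is lost: the old values on [[p, q]] lie in [[lo, hi]], and the new ones fill it.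
    Keeping [g p] and [g q] at the ends keeps continuity. *)
Lemma onto_map_rewrite a b c d g p q lo hi : onto_map a b c d g -> a <= p -> p < q -> q <= b ->
  c <= lo -> hi <= d -> (forall x, p <= x <= q -> lo <= g x <= hi) ->
  exists g', onto_map a b c d g' /\ (forall x, x <= p -> g' x = g x) /\ (forall x, q <= x -> g' x = g x) /\
    (forall x, p <= x <= q -> lo <= g' x <= hi) /\ (forall y, lo <= y <= hi -> image_on g' p q y).
Proof.
  intros [Hc [Hr Ho]] Hap Hpq Hqb Hlo Hhi Hg.
  destruct (connecting_map p q lo hi (g p) (g q) Hpq) as [u [U1 [U2 [U3 [U4 U5]]]]]; [apply Hg; lra|apply Hg; lra|].
  assert (Hin : forall y, lo <= y <= hi -> image_on (splice g p q u) p q y).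
  { intros y Hy. destruct (U5 y Hy) as [x [Hx E]]. exists x. split; [exact Hx|]. rewrite splice_in by exact Hx. exact E. }
  exists (splice g p q u). split; [split; [|split]|].
  - apply cont_on_splice; [lra|exact Hc|apply U1|rewrite U2 by lra; reflexivity|rewrite U3 by lra; reflexivity].
  - intros x Hx. destruct (classic (p <= x <= q)) as [H|H].
    + rewrite splice_in by exact H. specialize (U4 x). lra.
    + rewrite splice_out by exact H. apply Hr; exact Hx.
  - intros y Hy. destruct (Ho y Hy) as [x [Hx E]]. destruct (classic (p <= x <= q)) as [H|H].
    + destruct (Hin y) as [x' [Hx' E']]; [rewrite <- E; apply Hg; exact H|]. exists x'; split; [lra|exact E'].
    + exists x. split; [exact Hx|]. rewrite splice_out by exact H. exact E.
  - split; [|split; [|split; [|exact Hin]]].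
    + intros x Hx. destruct (Req_dec x p) as [->|Hne].
      * rewrite splice_in by lra. apply U2; lra.
      * apply splice_out; lra.
    + intros x Hx. destruct (Req_dec x q) as [->|Hne].
      * rewrite splice_in by lra. apply U3; lra.
      * apply splice_out; lra.
    + intros x Hx. rewrite splice_in by exact Hx. apply U4.
Qed.

Definition subintervals (a b : R) (l : list (R * R)) : Prop :=
  forall F, In F l -> a <= fst F /\ fst F < snd F /\ snd F <= b.

(** Induction on the list, the head being treated last: a piece of it is stretched over all of
    [[c, d]]. An interval treated earlier either contains this piece, and covers [[c, d]] through
    it, or does not meet it. *)
Lemma wild_map a b c d g l : onto_map a b c d g -> subintervals a b l ->
  exists g', onto_map a b c d g' /\ g' a = g a /\ g' b = g b /\
    forall F, In F l -> forall y, c <= y <= d -> image_on g' (fst F) (snd F) y.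
Proof.
  intros Hg Hl. induction l as [|E l IH].
  - exists g. split; [exact Hg|]. split; [reflexivity|]. split; [reflexivity|]. intros F [].
  - destruct IH as [h [Hh [Ea [Eb HF]]]]; [intros F HF; apply Hl; right; exact HF|].
    destruct (Hl E (or_introl eq_refl)) as [E1 [E2 E3]].
    destruct (shrink_interval l _ _ E2) as [p [q [P1 [P2 [P3 P4]]]]].
    destruct (onto_map_rewrite a b c d h p q c d Hh) as [h' [H1 [H2 [H3 [H4 H5]]]]]; try lra.
    { intros x Hx. apply Hh. lra. }
    exists h'. split; [exact H1|]. split; [rewrite H2 by lra; exact Ea|]. split; [rewrite H3 by lra; exact Eb|].
    intros F [<-|HFl] y Hy.
    + destruct (H5 y Hy) as [x [Hx Ex]]. exists x; split; [lra|exact Ex].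
    + destruct (P4 F HFl) as [[B1 B2]|B].
      * destruct (H5 y Hy) as [x [Hx Ex]]. exists x; split; [lra|exact Ex].
      * destruct (HF F HFl y Hy) as [x [Hx Ex]]. exists x; split; [exact Hx|].
        destruct B as [B|B]; [rewrite H3 by lra; exact Ex|rewrite H2 by lra; exact Ex].
Qed.

(** A bump is added only where the map is constant. Half of the allowance [h] goes to the tail of
    the list and half to the bump on the head. *)
Lemma nonconstant_map a b c d g l h : onto_map a b c d g -> c < d -> subintervals a b l -> 0 < h ->
  exists g', onto_map a b c d g' /\ g' a = g a /\ g' b = g b /\
    (forall x, a <= x <= b -> Rabs (g' x - g x) <= h) /\
    forall F, In F l -> exists x y, fst F <= x <= snd F /\ fst F <= y <= snd F /\ g' x < g' y.
Proof.
  intros Hg Hcd Hl. revert h. induction l as [|E l IH]; intros h Hh.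
  - exists g. split; [exact Hg|]. split; [reflexivity|]. split; [reflexivity|]. split; [|intros F []].
    intros x Hx. rewrite Rminus_diag, Rabs_R0. lra.
  - destruct (IH) with (h := h / 2) as [k [Hk [Ea [Eb [Ed HF]]]]]; [intros F HF; apply Hl; right; exact HF|lra|].
    destruct (Hl E (or_introl eq_refl)) as [E1 [E2 E3]].
    destruct (classic (exists x y, fst E <= x <= snd E /\ fst E <= y <= snd E /\ k x < k y)) as [Hyes|Hno].
    { exists k. split; [exact Hk|]. split; [exact Ea|]. split; [exact Eb|]. split.
      - intros x Hx. specialize (Ed x Hx). lra.
      - intros F [<-|HFl]; [exact Hyes|apply HF; exact HFl]. }
    assert (Hconst : forall x, fst E <= x <= snd E -> k x = k (fst E)).
    { intros x Hx. apply NNPP; intros Hne. apply Hno.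
      destruct (Rlt_dec (k x) (k (fst E))); [exists x, (fst E)|exists (fst E), x]; lra. }
    destruct (shrink_interval l _ _ E2) as [p [q [P1 [P2 [P3 P4]]]]].
    set (y0 := k (fst E)) in *.
    assert (Hy0 : c <= y0 <= d) by (apply Hk; lra).
    (* The bump must stay inside the target interval: it goes up from the constant value [y0], or
       down when [y0 = d]. *)
    assert (Hlh : exists lo hi, c <= lo /\ lo < hi /\ hi <= d /\ lo <= y0 <= hi /\ hi - lo <= h / 2).
    { destruct (Rlt_dec y0 d) as [Hlt|Hge].
      - exists y0, (Rmin d (y0 + h / 2)). pose proof (Rmin_l d (y0 + h / 2)). pose proof (Rmin_r d (y0 + h / 2)).
        assert (y0 < Rmin d (y0 + h / 2)) by (apply Rmin_glb_lt; lra). repeat split; lra.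
      - exists (Rmax c (d - h / 2)), d. pose proof (Rmax_l c (d - h / 2)). pose proof (Rmax_r c (d - h / 2)).
        assert (Rmax c (d - h / 2) < d) by (apply Rmax_lub_lt; lra). repeat split; lra. }
    destruct Hlh as [lo [hi [L1 [L2 [L3 [L4 L5]]]]]].
    destruct (onto_map_rewrite a b c d k p q lo hi Hk) as [k' [H1 [H2 [H3 [H4 H5]]]]]; try lra.
    { intros x Hx. rewrite Hconst by lra. exact L4. }
    assert (Hpq : forall F, fst F <= p /\ q <= snd F ->
       exists x y, fst F <= x <= snd F /\ fst F <= y <= snd F /\ k' x < k' y).
    { intros F HF'. destruct (H5 lo ltac:(lra)) as [x [Hx Ex]]. destruct (H5 hi ltac:(lra)) as [y [Hy Ey]].
      exists x, y. rewrite Ex, Ey. repeat split; lra. }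
    exists k'. split; [exact H1|]. split; [rewrite H2 by lra; exact Ea|]. split; [rewrite H3 by lra; exact Eb|]. split.
    + intros x Hx. specialize (Ed x Hx).
      assert (Hd : Rabs (k' x - k x) <= h / 2).
      { destruct (Rle_dec x p); [rewrite H2 by lra; rewrite Rminus_diag, Rabs_R0; lra|].
        destruct (Rle_dec q x); [rewrite H3 by lra; rewrite Rminus_diag, Rabs_R0; lra|].
        rewrite (Hconst x) by lra. specialize (H4 x ltac:(lra)). unfold Rabs; destruct Rcase_abs; lra. }
      pose proof (Rabs_triang (k' x - k x) (k x - g x)) as Ht.
      replace (k' x - k x + (k x - g x)) with (k' x - g x) in Ht by ring. lra.
    + intros F [<-|HFl]; [apply Hpq; lra|].
      destruct (P4 F HFl) as [B|B]; [apply Hpq; lra|].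
      destruct (HF F HFl) as [x [y [Hx [Hy Hxy]]]]. exists x, y. split; [exact Hx|]. split; [exact Hy|].
      destruct B as [B|B]; [rewrite !H3 by lra; exact Hxy|rewrite !H2 by lra; exact Hxy].
Qed.

Lemma collapsing_map a b c d p q y1 y2 : a <= p -> p < q -> q <= b -> c <= y1 <= d -> c <= y2 <= d ->
  exists g, onto_map a b c d g /\ (forall x, x <= p -> g x = y1) /\ (forall x, q <= x -> g x = y2).
Proof.
  intros Hap Hpq Hqb H1 H2.
  destruct (connecting_map p q c d y1 y2 Hpq H1 H2) as [u [U1 [U2 [U3 [U4 U5]]]]].
  exists u. split; [split; [apply U1|split]|auto].
  - intros x _; apply U4.
  - intros y Hy. destruct (U5 y Hy) as [x [Hx E]]. exists x; split; [lra|exact E].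
Qed.

(** * Iterates, residues and upper limits *)

Lemma image_iter_add f a b A y :
  image_iter f (a + b) A y <-> image_iter f a (image_iter f b A) y.
Proof.
  split.
  - intros [x [Hx E]]. exists (Nat.iter b f x). split; [exists x; auto|].
    rewrite <- Nat.iter_add. exact E.
  - intros [x [[x' [Hx' E']] E]]. exists x'; split; [exact Hx'|]. rewrite Nat.iter_add, E'. exact E.
Qed.

Lemma image_iter_sub f k (A B : R -> Prop) : (forall y, A y -> B y) ->
  forall y, image_iter f k A y -> image_iter f k B y.
Proof. intros H y [x [Hx E]]. exists x; auto. Qed.

Lemma iter_maps_I f k x : maps_I f -> in_I x -> in_I (Nat.iter k f x).
Proof. intros Hf Hx. apply Nat.iter_invariant; [exact Hf|exact Hx]. Qed.

Lemma iter_cont_I f k : maps_I f -> cont_I f -> cont_on 0 1 (Nat.iter k f).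
Proof.
  intros Hm Hc. induction k as [|k IH].
  - intros x Hx eps He. exists eps; split; [exact He|]. simpl; auto.
  - apply (cont_on_comp 0 1 0 1 (Nat.iter k f) f); [exact IH|exact Hc|].
    intros x Hx. apply (iter_maps_I f k x Hm Hx).
Qed.

Lemma pow2_pos n : (0 < 2 ^ n)%nat.
Proof. apply Nat.neq_0_lt_0, Nat.pow_nonzero. lia. Qed.

Lemma mod_add_cancel p k s t : ((k + s) mod p = (k + t) mod p -> s mod p = t mod p)%nat.
Proof.
  intros E. destruct (Nat.eq_dec p 0) as [->|Hp]; [simpl in *; lia|].
  assert (E' : (((p - k mod p) + (k + s)) mod p = ((p - k mod p) + (k + t)) mod p)%nat).
  { rewrite (Nat.Div0.add_mod _ (k + s)), (Nat.Div0.add_mod _ (k + t)), E. reflexivity. }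
  assert (Hk : (k mod p < p)%nat) by (apply Nat.mod_upper_bound; exact Hp).
  assert (Ek := Nat.div_mod_eq k p).
  assert (A : forall u, ((p - k mod p) + (k + u) = u + (k / p + 1) * p)%nat) by (intros; nia).
  rewrite !A, !Nat.Div0.mod_add in E'. exact E'.
Qed.

Lemma limsup_exists (u : nat -> R) m : (forall n, m <= u n) -> exists l, is_limsup u l.
Proof.
  intros Hm.
  destruct (classic (forall M N, exists n, (N <= n)%nat /\ M < u n)) as [H|H]; [exists PInf; exact H|].
  apply not_all_ex_not in H. destruct H as [M H]. apply not_all_ex_not in H. destruct H as [N0 H].
  assert (HM : forall n, (N0 <= n)%nat -> u n <= M).
  { intros n Hn. apply Rnot_lt_le; intros Hlt. apply H. exists n; auto. }
  (* The levels exceeded infinitely often; their supremum is the upper limit. *)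
  set (E := fun c => forall N, exists n, (N <= n)%nat /\ c < u n).
  destruct (completeness E) as [r [Hub Hlub]].
  - exists M. intros c Hc. destruct (Hc N0) as [n [Hn Hcn]]. specialize (HM n Hn). lra.
  - exists (m - 1). intros N. exists N; split; [lia|]. specialize (Hm N). lra.
  - exists (Fin r). split.
    + intros e He. apply NNPP; intros Hno.
      assert (HE : E (r + e / 2)).
      { intros N. apply NNPP; intros H1. apply Hno. exists N. intros n Hn.
        apply Rnot_le_lt; intros H2. apply H1. exists n; split; [exact Hn|lra]. }
      specialize (Hub _ HE). lra.
    + intros e He N. apply NNPP; intros Hno.
      assert (Hb : is_upper_bound E (r - e)).
      { intros c Hc. apply Rnot_lt_le; intros Hlt. destruct (Hc N) as [n [Hn Hcn]].
        apply Hno. exists n; split; [exact Hn|lra]. }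
      specialize (Hlub _ Hb). lra.
Qed.

Lemma limsup_pos (u : nat -> R) l c : is_limsup u l -> 0 < c ->
  (forall N, exists n, (N <= n)%nat /\ c <= u n) -> ER_gt l 0.
Proof.
  intros Hl Hc Hu. destruct l as [r|]; [|exact I]. simpl. apply Rnot_le_lt; intros Hr.
  destruct Hl as [Hl _]. destruct (Hl (c / 2) ltac:(lra)) as [N HN].
  destruct (Hu N) as [n [Hn Hcn]]. specialize (HN n Hn). lra.
Qed.

Lemma nds_iter_auto f n x : nds_iter (auto f) n x = Nat.iter n f x.
Proof. induction n; [reflexivity|]. simpl. rewrite IHn. reflexivity. Qed.

Lemma half_pow_bound m : 0 < (1 / 2) ^ m <= 1.
Proof. induction m as [|m IH]; [simpl; lra|]. rewrite <- tech_pow_Rmult. lra. Qed.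

Lemma nested_point (a b : nat -> R) : (forall i j, a i <= b j) -> exists z, forall i, a i <= z <= b i.
Proof.
  intros H. destruct (completeness (fun x => exists i, x = a i)) as [z [Hub Hlub]].
  - exists (b 0%nat). intros x [i ->]. apply H.
  - exists (a 0%nat), 0%nat. reflexivity.
  - exists z. intros i. split; [apply Hub; exists i; reflexivity|].
    apply Hlub. intros x [j ->]. apply H.
Qed.

(** * Chaos from an interval whose one-sided neighbourhoods both expand over it *)

Section TwoSidedExpansion.

Variables (f : R -> R) (a b d0 : R).
Hypothesis Hmap : maps_I f.
Hypothesis Hcont : cont_I f.
Hypothesis Hab : a < b.
Hypothesis Hd0 : 0 < d0.
Hypothesis Ha0 : 0 <= a - d0.
Hypothesis Hb0 : b + d0 <= 1.
Hypothesis Hexp : forall d, 0 < d <= d0 -> exists d' L, 0 < d' <= d / 2 /\ (1 <= L)%nat /\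
  forall y, a - d' <= y <= b + d' ->
    image_on (Nat.iter L f) (a - d) a y /\ image_on (Nat.iter L f) b (b + d) y.

Definition in_side (s : bool) (d x : R) : Prop := if s then a - d <= x <= a else b <= x <= b + d.

(** Iterates [Hexp], each radius being at most half the previous one. Both sides share the time
    [L m], so orbits with different itineraries are on their sides simultaneously. *)
Lemma stages : exists (d : nat -> R) (L : nat -> nat), (forall m, 0 < d m <= d0 * (1 / 2) ^ m) /\
  (forall m, (1 <= L m)%nat) /\
  forall m s s' y, in_side s' (d (S m)) y -> exists x, in_side s (d m) x /\ Nat.iter (L m) f x = y.
Proof.
  destruct (choice (fun d (p : R * nat) => 0 < d <= d0 -> 0 < fst p <= d / 2 /\ (1 <= snd p)%nat /\
    forall y, a - fst p <= y <= b + fst p ->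
    image_on (Nat.iter (snd p) f) (a - d) a y /\ image_on (Nat.iter (snd p) f) b (b + d) y)) as [F HF].
  { intros d. destruct (classic (0 < d <= d0)) as [Hd|Hd].
    - destruct (Hexp d Hd) as [d' [L H]]. exists (d', L). intros _. exact H.
    - exists (0, 0%nat). intros H; contradiction. }
  set (d := fix d m := match m with O => d0 | S m => fst (F (d m)) end).
  assert (Hd : forall m, 0 < d m <= d0 * (1 / 2) ^ m /\ d m <= d0).
  { induction m as [|m [IH IH2]]; [simpl; lra|].
    destruct (HF (d m) ltac:(lra)) as [H1 _]. change (d (S m)) with (fst (F (d m))).
    rewrite <- tech_pow_Rmult. lra. }
  exists d, (fun m => snd (F (d m))). split; [intros m; apply Hd|]. split.
  - intros m. apply (HF (d m)). destruct (Hd m); lra.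
  - intros m s s' y Hy. destruct (Hd m) as [H1 H2]. destruct (HF (d m) ltac:(lra)) as [H3 [_ H4]].
    change (fst (F (d m))) with (d (S m)) in *.
    destruct (H4 y) as [H5 H6]; [destruct s'; unfold in_side in Hy; lra|].
    destruct s; [destruct H5 as [x [Hx E]]|destruct H6 as [x [Hx E]]]; exists x; auto.
Qed.

(** Every sequence of left and right is the itinerary of a point. Two orbits that are both on the
    left at a late stage are close, because that side has shrunk to [a]; on opposite sides they are
    at least [b - a] apart. The coding makes both happen infinitely often for any two different
    sequences. *)
Lemma two_sided_expansion_chaos : LY_chaotic (auto f).
Proof.
  destruct stages as [d [L [Hd [HL Hst]]]].
  (* [T k i] is the duration of the stages [k] to [k + i - 1]. Peeling off the first stage matches
     [Hfin], which prepends a stage to an itinerary. *)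
  set (T := fix T k i := match i with O => O | S i => (T (S k) i + L k)%nat end).
  assert (HT : forall i k, (i <= T k i)%nat).
  { induction i as [|i IH]; intros k; simpl; [lia|]. specialize (IH (S k)). specialize (HL k). lia. }
  assert (Hdd : forall m, d m <= d0).
  { intros m. destruct (Hd m) as [_ H]. pose proof (half_pow_bound m). nra. }
  assert (Hside : forall s m x, in_side s (d m) x -> in_I x).
  { intros s m x Hx. specialize (Hdd m). unfold in_I. destruct s; simpl in Hx; lra. }
  assert (Hfin : forall (c : nat -> bool) m k, exists x, forall i, (i <= m)%nat ->
     in_side (c (k + i)%nat) (d (k + i)%nat) (Nat.iter (T k i) f x)).
  { intros c. induction m as [|m IH]; intros k.
    - exists (if c k then a else b). intros i Hi. replace i with 0%nat by lia. rewrite Nat.add_0_r. simpl.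
      destruct (Hd k). destruct (c k); simpl; lra.
    - destruct (IH (S k)) as [x' Hx'].
      destruct (Hst k (c k) (c (S k)) x') as [x [Hx E]].
      { specialize (Hx' 0%nat ltac:(lia)). rewrite Nat.add_0_r in Hx'. exact Hx'. }
      exists x. intros [|i] Hi.
      + rewrite Nat.add_0_r. exact Hx.
      + simpl. rewrite Nat.iter_add, E. rewrite Nat.add_succ_r. apply Hx'. lia. }
  assert (Hcode : forall c : nat -> bool, exists x, in_I x /\
     forall i, in_side (c i) (d i) (Nat.iter (T O i) f x)).
  { intros c. destruct (choice _ (fun m => Hfin c m 0%nat)) as [u Hu]. simpl in Hu.
    assert (HuI : forall m, 0 <= u m <= 1).
    { intros m. apply (Hside (c 0%nat) 0%nat). apply (Hu m 0%nat). lia. }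
    (* A limit of points with longer and longer correct itineraries has the full itinerary, because
       the sides are closed. *)
    destruct (cluster_point 0 1 u HuI) as [x [Hx Hcl]].
    exists x. split; [exact Hx|]. intros i.
    assert (Happ : forall e, 0 < e -> exists y, in_side (c i) (d i) y /\ Rabs (y - Nat.iter (T O i) f x) < e).
    { intros e He. destruct (iter_cont_I f (T O i) Hmap Hcont x Hx e He) as [dl [Hdl H]].
      destruct (Hcl dl Hdl i) as [m [Hm1 Hm2]]. exists (Nat.iter (T O i) f (u m)). split.
      - apply Hu; exact Hm1.
      - apply H; [apply HuI|exact Hm2]. }
    assert (Hcl' : forall p q z, (forall e, 0 < e -> exists y, p <= y <= q /\ Rabs (y - z) < e) -> p <= z <= q).
    { intros p q z H. split; apply Rnot_lt_le; intros Hlt.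
      - destruct (H (p - z) ltac:(lra)) as [y [Hy1 Hy2]]. apply Rabs_lt_iff in Hy2. lra.
      - destruct (H (z - q) ltac:(lra)) as [y [Hy1 Hy2]]. apply Rabs_lt_iff in Hy2. lra. }
    destruct (c i); apply Hcl'; exact Happ. }
  (* All even stages are on the left, for the lower limit 0. The odd stages repeat every bit
     infinitely often: [s i] is read at [2 * Cantor.to_nat (i, j) + 1] for each [j]. *)
  set (code := fun (s : nat -> bool) n => if Nat.even n then true else s (fst (Cantor.of_nat (n / 2)))).
  destruct (choice _ (fun s => Hcode (code s))) as [X HX].
  assert (Hodd : forall (s : nat -> bool) i j, code s (2 * Cantor.to_nat (i, j) + 1)%nat = s i).
  { intros s i j. unfold code. rewrite Nat.add_1_r, Nat.even_succ, Nat.odd_mul. simpl Nat.odd. simpl andb.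
    cbv iota. replace (S (2 * Cantor.to_nat (i, j)) / 2)%nat with (Cantor.to_nat (i, j)).
    - rewrite Cantor.cancel_of_to. reflexivity.
    - symmetry. rewrite <- Nat.add_1_l, Nat.mul_comm, Nat.div_add by lia. reflexivity. }
  assert (Hdiff : forall s s' i, s i <> s' i -> forall N, exists n, (N <= n)%nat /\
     b - a <= Rabs (Nat.iter n f (X s) - Nat.iter n f (X s'))).
  { intros s s' i Hne N. set (k := (2 * Cantor.to_nat (i, N) + 1)%nat).
    exists (T O k). split.
    - pose proof (HT k 0%nat). pose proof (Cantor.to_nat_non_decreasing i N). unfold k in *. lia.
    - destruct (HX s) as [_ H1]. destruct (HX s') as [_ H2]. specialize (H1 k). specialize (H2 k).
      unfold k in H1, H2. rewrite Hodd in H1, H2. fold k in H1, H2.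
      unfold in_side in *.
      destruct (s i), (s' i); try congruence; unfold Rabs; destruct Rcase_abs; lra. }
  exists (fun x => exists s, x = X s). split; [intros x [s ->]; apply HX|]. split.
  - intros [g Hg].
    (* Diagonal argument: [X] is injective by [Hdiff], so [g n] comes from at most one sequence, and
       [s0] differs from that one at [n]. *)
    set (s0 := fun n => if excluded_middle_informative (exists s, g n = X s /\ s n = true) then false else true).
    destruct (Hg (X s0)) as [n Hn]; [exists s0; reflexivity|].
    destruct (excluded_middle_informative (exists s, g n = X s /\ s n = true)) as [H|H].
    + assert (Es : s0 n = false) by (unfold s0; destruct excluded_middle_informative; [reflexivity|contradiction]).
      destruct H as [s [H1 H2]]. destruct (Hdiff s s0 n) with (N := 0%nat) as [k [_ Hk]]; [congruence|].
      replace (X s) with (X s0) in Hk by congruence.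
      rewrite Rminus_diag, Rabs_R0 in Hk. lra.
    + apply H. exists s0. split; [exact Hn|].
      unfold s0; destruct excluded_middle_informative; [contradiction|reflexivity].
  - intros x y [s ->] [s' ->] Hne. split; [exact Hne|].
    assert (Hex : exists i, s i <> s' i).
    { apply NNPP; intros H. apply Hne. f_equal. apply functional_extensionality.
      intros i. apply NNPP; intros H'. apply H. exists i; exact H'. }
    destruct Hex as [i Hi]. split.
    + destruct (limsup_exists (fun n => Rabs (nds_iter (auto f) n (X s) - nds_iter (auto f) n (X s'))) 0)
        as [l Hl]; [intros n; apply Rabs_pos|].
      exists l. split; [exact Hl|]. apply (limsup_pos _ _ (b - a) Hl); [lra|].
      intros N. destruct (Hdiff s s' i Hi N) as [n [Hn1 Hn2]]. exists n. split; [exact Hn1|].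
      rewrite !nds_iter_auto. exact Hn2.
    + split.
      * intros e He. exists 0%nat. intros n _.
        pose proof (Rabs_pos (nds_iter (auto f) n (X s) - nds_iter (auto f) n (X s'))). lra.
      * intros e He N.
        destruct (pow_lt_1_zero (1 / 2)) with (y := e / d0) as [k Hk].
        { rewrite Rabs_right; lra. } { apply Rdiv_lt_0_compat; lra. }
        set (m := (2 * (k + N))%nat). exists (T O m). split; [pose proof (HT m 0%nat); unfold m in *; lia|].
        rewrite !nds_iter_auto.
        destruct (HX s) as [_ H1]. destruct (HX s') as [_ H2]. specialize (H1 m). specialize (H2 m).
        assert (Ec : forall r, code r m = true).
        { intros r. unfold code, m. rewrite Nat.even_mul. reflexivity. }
        rewrite Ec in H1, H2. simpl in H1, H2. specialize (Hk m ltac:(unfold m; lia)).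
        rewrite Rabs_right in Hk by (apply Rle_ge, pow_le; lra).
        assert (Hdm : d m < e).
        { destruct (Hd m) as [_ H]. eapply Rle_lt_trans; [exact H|].
          apply Rmult_lt_compat_l with (r := d0) in Hk; [|lra].
          replace (d0 * (e / d0)) with e in Hk by (field; lra). exact Hk. }
        unfold Rabs; destruct Rcase_abs; lra.
Qed.

End TwoSidedExpansion.

(** * Existence of the sequence entropy *)

Lemma rho_cont fs A n eps : (forall m, cont_on 0 1 (nds_iter fs m)) -> 0 < eps ->
  exists d, 0 < d /\ forall x y, in_I x -> in_I y -> Rabs (x - y) < d -> rho fs A n x y < eps.
Proof.
  intros Hc He. induction n as [|n [d [Hd H]]].
  - exists 1. split; [lra|]. simpl. auto.
  - destruct (unif_cont_on 0 1 _ eps (Hc (A (S n))) He) as [d' [Hd' H']].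
    exists (Rmin d d'). split; [apply Rmin_glb_lt; assumption|]. intros x y Hx Hy Hxy. simpl.
    pose proof (Rmin_l d d'). pose proof (Rmin_r d d').
    apply Rmax_lub_lt; [apply H; try assumption; lra|apply H'; try assumption; lra].
Qed.

Lemma rho_ge fs A n i x y : (1 <= i <= n)%nat ->
  Rabs (nds_iter fs (A i) x - nds_iter fs (A i) y) <= rho fs A n x y.
Proof.
  induction n as [|n IH]; intros Hi; [lia|]. simpl. destruct (Nat.eq_dec i (S n)) as [->|Hne].
  - apply Rmax_r.
  - eapply Rle_trans; [apply IH; lia|apply Rmax_l].
Qed.

(** Pigeonhole on cells of length [d], a modulus of continuity of [rho] for [eps]: two points of a
    separated set never share a cell. *)
Lemma separated_bounded fs A n eps : (forall m, cont_on 0 1 (nds_iter fs m)) -> 0 < eps ->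
  exists k, forall E, separated fs A n eps E -> (length E <= k)%nat.
Proof.
  intros Hc He. destruct (rho_cont fs A n eps Hc He) as [d [Hd H]].
  set (cell := fun x => Z.to_nat (up (x / d))).
  exists (S (cell 1)). intros E [Hnd [HI Hsep]].
  assert (Hup : forall x, in_I x -> x / d < INR (cell x) <= x / d + 1).
  { intros x [Hx _]. unfold cell. destruct (archimed (x / d)) as [U1 U2].
    assert (0 <= x / d) by (apply Rmult_le_pos; [lra|left; apply Rinv_0_lt_compat; exact Hd]).
    assert (0 <= up (x / d))%Z by (apply le_IZR; lra).
    rewrite INR_IZR_INZ, Z2Nat.id by assumption. lra. }
  assert (Hinj : NoDup (map cell E)).
  { apply NoDup_map_NoDup_ForallPairs; [|exact Hnd].
    intros x y Hx Hy Exy. apply NNPP; intros Hne. specialize (Hsep x y Hx Hy Hne).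
    pose proof (Hup x (HI x Hx)) as Ux. pose proof (Hup y (HI y Hy)) as Uy. rewrite Exy in Ux.
    assert (rho fs A n x y < eps); [|lra]. apply H; [apply HI; exact Hx|apply HI; exact Hy|].
    assert (Hq : - 1 < x / d - y / d < 1) by lra.
    replace (x - y) with ((x / d - y / d) * d) by (field; lra).
    apply Rabs_lt_iff. nra. }
  assert (Hincl : incl (map cell E) (seq 0 (S (cell 1)))).
  { intros k Hk. apply in_map_iff in Hk. destruct Hk as [x [<- Hx]]. apply in_seq. simpl. split; [lia|].
    assert (cell x <= cell 1%R)%nat; [|lia]. unfold cell.
    assert (Hle : x / d <= 1 / d).
    { apply Rmult_le_compat_r; [left; apply Rinv_0_lt_compat; exact Hd|]. apply (HI x Hx). }
    destruct (archimed (x / d)) as [U1 U2]. destruct (archimed (1 / d)) as [V1 V2].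
    assert (Hz : IZR (up (x / d)) < IZR (up (1 / d)) + 1) by lra.
    rewrite <- plus_IZR in Hz. apply lt_IZR in Hz. lia. }
  pose proof (NoDup_incl_length Hinj Hincl) as Hlen. rewrite length_map, length_seq in Hlen. exact Hlen.
Qed.

(** The singleton of [0] is separated; the resulting bound [1 <= k] keeps the logarithms nonnegative
    later. *)
Lemma max_sep_card_exists fs A n eps : (forall m, cont_on 0 1 (nds_iter fs m)) -> 0 < eps ->
  exists k, max_sep_card fs A n eps k /\ (1 <= k)%nat.
Proof.
  intros Hc He. destruct (separated_bounded fs A n eps Hc He) as [B HB].
  assert (H1 : separated fs A n eps (0 :: nil)).
  { split; [repeat constructor; auto|]. split.
    - intros x [<-|[]]. unfold in_I; lra.
    - intros x y [<-|[]] [<-|[]] Hne. congruence. }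
  assert (H : forall m k, (B <= k + m)%nat -> (exists E, separated fs A n eps E /\ length E = k) ->
     exists k', (k <= k')%nat /\ max_sep_card fs A n eps k').
  { induction m as [|m IH]; intros k Hk HE.
    - exists k. split; [lia|]. split; [exact HE|]. intros E HE'. specialize (HB E HE'). lia.
    - destruct (classic (exists E, separated fs A n eps E /\ (k < length E)%nat)) as [[E [E1 E2]]|Hno].
      + destruct (IH (length E)) as [k' [K1 K2]]; [lia|exists E; auto|]. exists k'. split; [lia|exact K2].
      + exists k. split; [lia|]. split; [exact HE|]. intros E HE'.
        destruct (Nat.le_gt_cases (length E) k) as [Hl|Hl]; [exact Hl|]. exfalso; apply Hno; exists E; auto. }
  destruct (H B 1%nat) as [k [K1 K2]]; [lia|exists (0 :: nil); auto|]. exists k; auto.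
Qed.

Definition ER_le (h h' : ER) : Prop := match h' with PInf => True | Fin r' => exists r, h = Fin r /\ r <= r' end.

Lemma limsup_mono u u' l l' N0 : (forall n, (N0 <= n)%nat -> u n <= u' n) ->
  is_limsup u l -> is_limsup u' l' -> ER_le l l'.
Proof.
  intros Hle Hl Hl'. destruct l' as [r'|]; [|exact I]. simpl. destruct Hl' as [Hl' _].
  destruct l as [r|].
  - exists r. split; [reflexivity|]. apply Rnot_lt_le; intros Hlt.
    destruct (Hl' ((r - r') / 2) ltac:(lra)) as [N HN].
    destruct Hl as [_ Hl]. destruct (Hl ((r - r') / 2) ltac:(lra) (Nat.max N N0)) as [n [Hn Hu]].
    specialize (HN n ltac:(lia)). specialize (Hle n ltac:(lia)). lra.
  - exfalso. destruct (Hl' 1 ltac:(lra)) as [N HN]. destruct (Hl (r' + 1) (Nat.max N N0)) as [n [Hn Hu]].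
    specialize (HN n ltac:(lia)). specialize (Hle n ltac:(lia)). lra.
Qed.

(** [L] grows as the scale shrinks, so its limit at 0 is its supremum, finite or not. *)
Lemma monotone_lim_right0 (L : R -> ER) : (forall e e', 0 < e' <= e -> ER_le (L e) (L e')) ->
  exists h, is_lim_right0 L h /\ forall e, 0 < e -> ER_le (L e) h.
Proof.
  intros Hm.
  destruct (classic (exists M, forall e, 0 < e -> exists r, L e = Fin r /\ r <= M)) as [[M HM]|Hno].
  - destruct (completeness (fun r => exists e, 0 < e /\ L e = Fin r)) as [l [Hub Hlub]].
    + exists M. intros r [e [He E]]. destruct (HM e He) as [r' [E' H]]. congruence.
    + destruct (HM 1 ltac:(lra)) as [r [E _]]. exists r, 1. split; [lra|exact E].
    + exists (Fin l). split.
      * intros d Hd.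
        assert (H : exists e r, 0 < e /\ L e = Fin r /\ l - d < r).
        { apply NNPP; intros H. assert (l <= l - d); [|lra]. apply Hlub. intros r [e [He E]].
          apply Rnot_lt_le; intros Hlt. apply H. exists e, r. auto. }
        destruct H as [e [r [He [E Hr]]]]. exists e. split; [exact He|]. intros t Ht.
        destruct (HM t ltac:(lra)) as [r' [E' _]]. exists r'. split; [exact E'|].
        specialize (Hm e t ltac:(lra)). rewrite E, E' in Hm. destruct Hm as [r'' [E'' H]].
        assert (r' <= l) by (apply Hub; exists t; split; [lra|exact E']).
        injection E'' as <-. apply Rabs_lt_iff. lra.
      * intros e He. destruct (HM e He) as [r [E _]]. exists r. split; [exact E|]. apply Hub. exists e; auto.
  - exists PInf. split; [|intros; exact I]. intros M.
    assert (H : exists e, 0 < e /\ ER_gt (L e) M).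
    { apply NNPP; intros H. apply Hno. exists M. intros e He. destruct (L e) as [r|] eqn:E.
      - exists r. split; [reflexivity|]. apply Rnot_lt_le; intros Hlt. apply H. exists e. rewrite E. auto.
      - exfalso; apply H. exists e. rewrite E. simpl; auto. }
    destruct H as [e [He H]]. exists e. split; [exact He|]. intros t Ht.
    specialize (Hm e t ltac:(lra)). destruct (L t) as [r|]; [|exact I].
    destruct Hm as [r' [E Hr]]. rewrite E in H. simpl in *. lra.
Qed.

(** [seq_entropy] asserts that the maxima, the upper limits and the final limit exist, so these are
    produced first. Separated sets at arbitrarily large lengths [n] suffice for the bound because
    the growth rate is an upper limit. *)
Lemma seq_entropy_ge fs A lam e0 : (forall m, cont_on 0 1 (nds_iter fs m)) -> 0 < e0 ->
  (forall eps, 0 < eps < e0 -> forall d, 0 < d -> forall N, exists n E, (N <= n)%nat /\ (1 <= n)%nat /\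
     separated fs A n eps E /\ lam - d <= ln (INR (length E)) / INR n) ->
  exists h, seq_entropy fs A h /\ ER_ge h lam.
Proof.
  intros Hc He0 Hlow.
  destruct (choice (fun (p : nat * R) k => 0 < snd p -> max_sep_card fs A (fst p) (snd p) k /\ (1 <= k)%nat))
    as [s Hs].
  { intros [n e]. destruct (Rlt_dec 0 e) as [He|He].
    - destruct (max_sep_card_exists fs A n e Hc He) as [k Hk]. exists k; auto.
    - exists 0%nat. intros H; contradiction. }
  set (u := fun eps n => ln (INR (s (n, eps))) / INR n).
  assert (Hinv : forall n, 0 <= / INR n).
  { intros [|n]; [simpl; rewrite Rinv_0; lra|]. left. apply Rinv_0_lt_compat. apply lt_0_INR; lia. }
  assert (Hu0 : forall eps, 0 < eps -> forall n, 0 <= u eps n).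
  { intros eps He n. unfold u. apply Rmult_le_pos; [|apply Hinv].
    destruct (Hs (n, eps) He) as [_ H1]. apply le_INR in H1. simpl in H1.
    rewrite <- ln_1. destruct H1 as [H1|H1]; [left; apply ln_increasing; lra|rewrite <- H1; lra]. }
  assert (Hln : forall a b, (1 <= a <= b)%nat -> ln (INR a) <= ln (INR b)).
  { intros a b [Ha Hb]. apply le_INR in Ha. apply le_INR in Hb. simpl in Ha.
    destruct Hb as [Hb|Hb]; [left; apply ln_increasing; lra|rewrite Hb; lra]. }
  destruct (choice (fun eps l => 0 < eps -> is_limsup (u eps) l)) as [L HL].
  { intros eps. destruct (Rlt_dec 0 eps) as [He|He].
    - destruct (limsup_exists (u eps) 0 (Hu0 eps He)) as [l Hl]. exists l; auto.
    - exists PInf. intros H; contradiction. }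
  assert (Hmono : forall e e', 0 < e' <= e -> ER_le (L e) (L e')).
  { intros e e' He. apply (limsup_mono (u e) (u e') _ _ 0%nat); [|apply HL; lra|apply HL; lra].
    intros n _. unfold u. apply Rmult_le_compat_r; [apply Hinv|].
    destruct (Hs (n, e) ltac:(simpl; lra)) as [[[E [HE Elen]] _] H1].
    destruct (Hs (n, e') ltac:(simpl; lra)) as [[_ Hmax] _].
    apply Hln. split; [exact H1|]. simpl in *. rewrite <- Elen. apply Hmax.
    destruct HE as [N1 [N2 N3]]. split; [exact N1|]. split; [exact N2|].
    intros x y Hx Hy Hne. specialize (N3 x y Hx Hy Hne). lra. }
  destruct (monotone_lim_right0 L Hmono) as [h [Hh Hle]].
  exists h. split.
  - exists (fun n eps => s (n, eps)), L. split; [|split].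
    + intros n eps _ He. apply (Hs (n, eps) He).
    + intros eps He. exact (HL eps He).
    + exact Hh.
  - destruct h as [l|]; [|exact I]. simpl.
    destruct (Hle (e0 / 2) ltac:(lra)) as [r [Er Hr]].
    assert (Hlr : lam <= r); [|lra].
    apply Rnot_lt_le; intros Hlt.
    pose proof (HL (e0 / 2) ltac:(lra)) as Hls. rewrite Er in Hls. destruct Hls as [Hls _].
    destruct (Hls ((lam - r) / 2) ltac:(lra)) as [N HN].
    destruct (Hlow (e0 / 2) ltac:(lra) ((lam - r) / 2) ltac:(lra) N) as [n [E [Hn [Hn1 [HE Hlen]]]]].
    specialize (HN n Hn). unfold u in HN.
    destruct (Hs (n, e0 / 2) ltac:(simpl; lra)) as [[_ Hmax] Hge]. simpl in Hmax.
    assert (Hl1 : ln (INR (length E)) <= ln (INR (s (n, e0 / 2)))).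
    (* For an empty list the inequality still holds, because [ln 0] evaluates to [0]. *)
    { destruct (length E) as [|k] eqn:EL; [|apply Hln; rewrite <- EL; split; [lia|apply Hmax; exact HE]].
      simpl INR. replace (ln 0) with 0.
      - rewrite <- ln_1. apply (Hln 1%nat _). lia.
      - unfold ln. destruct (Rlt_dec 0 0) as [H0|H0]; [destruct (Rlt_irrefl 0 H0)|reflexivity]. }
    apply Rmult_le_compat_r with (r := / INR n) in Hl1; [|apply Hinv].
    unfold Rdiv in *. lra.
Qed.

(** * Countable sets *)

Lemma countable_union (A : nat -> R -> Prop) :
  (forall n, countable_set (A n)) -> countable_set (fun x => exists n, A n x).
Proof.
  intros H. apply choice in H. destruct H as [g Hg].
  exists (fun k => let (n, i) := Cantor.of_nat k in g n i).
  intros x [n Hx]. destruct (Hg n x Hx) as [i Hi]. exists (Cantor.to_nat (n, i)).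
  rewrite Cantor.cancel_of_to. exact Hi.
Qed.

Lemma subsingleton_countable (A : R -> Prop) : (forall x y, A x -> A y -> x = y) -> countable_set A.
Proof.
  intros H. destruct (classic (exists x, A x)) as [[x Hx]|Hno].
  - exists (fun _ => x). intros y Hy. exists 0%nat. apply H; assumption.
  - exists (fun _ => 0). intros x Hx. exfalso; apply Hno; exists x; exact Hx.
Qed.

Lemma countable_sub (A B : R -> Prop) : (forall x, A x -> B x) -> countable_set B -> countable_set A.
Proof. intros H [g Hg]. exists g. auto. Qed.

(** * The time schedule *)

(* [reps j] loops are made in block [j]; it is at least [j] times the number [cnt j] of all earlier loops. *)
Fixpoint cnt (j : nat) : nat := match j with O => O | S j => (cnt j + (j * cnt j + 1))%nat end.
Definition reps (j : nat) : nat := (j * cnt j + 1)%nat.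
(** The unit of [start j] is [2 ^ S j], so block [j] begins in phase 0 of level [j + 1]. The unit
    doubles with each block, so adding [reps j + 2] leaves room for block [j] to end before the next
    one starts. *)
Fixpoint mult (j : nat) : nat := match j with O => 1%nat | S j => (mult j + reps j + 2)%nat end.
Definition start (j : nat) : nat := (mult j * 2 ^ S j)%nat.
(** The loops begin at some phase after [start j], whence one period more than [reps j]. The final
    [kp j] makes the block end in phase [kp j] of level [j], one step before a short interval. *)
Definition stop (kp : nat -> nat) (j : nat) : nat := (start j + (reps j + 1) * 2 ^ S j + kp j)%nat.

Lemma stop_mod kp j : (stop kp j mod 2 ^ j = kp j mod 2 ^ j)%nat.
Proof.
  unfold stop, start. replace (mult j * 2 ^ S j + (reps j + 1) * 2 ^ S j + kp j)%nat
    with (kp j + 2 * (mult j + reps j + 1) * 2 ^ j)%nat by (simpl; nia).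
  apply Nat.Div0.mod_add.
Qed.

Lemma stop_lt_start kp j : (kp j < 2 ^ j)%nat -> (stop kp j < start (S j))%nat.
Proof.
  intros H. unfold stop, start. change (mult (S j)) with (mult j + reps j + 2)%nat.
  replace (2 ^ S (S j))%nat with (2 * 2 ^ S j)%nat by reflexivity.
  pose proof (Nat.pow_le_mono_r 2 j (S j)). nia.
Qed.

Lemma start_le_stop kp j : (start j < stop kp j)%nat.
Proof. unfold stop. pose proof (pow2_pos (S j)). nia. Qed.

Lemma start_mono i j : (i <= j)%nat -> (start i <= start j)%nat.
Proof.
  intros Hij. induction Hij as [|j Hij IH]; [lia|]. etransitivity; [exact IH|].
  unfold start. change (mult (S j)) with (mult j + reps j + 2)%nat.
  replace (2 ^ S (S j))%nat with (2 * 2 ^ S j)%nat by reflexivity. nia.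
Qed.

Lemma start_ge j : (S j <= start j)%nat.
Proof.
  unfold start. pose proof (Nat.pow_gt_lin_r 2 (S j)).
  assert (1 <= mult j)%nat by (destruct j; simpl; lia). nia.
Qed.

(** Lists the pairs of a block and a loop in it in order of time; loop [u] of block [j] gets the
    index [cnt j + u]. *)
Fixpoint slot (i : nat) : nat * nat :=
  match i with
  | O => (O, O)
  | S i => let (j, u) := slot i in if Nat.ltb (u + 1) (reps j) then (j, u + 1)%nat else (S j, O)
  end.

Lemma slot_lt i : (snd (slot i) < reps (fst (slot i)))%nat.
Proof.
  induction i as [|i IH]; [simpl; unfold reps; lia|]. simpl. destruct (slot i) as [j u].
  destruct (Nat.ltb_spec (u + 1) (reps j)); simpl; [exact H|unfold reps; lia].
Qed.

Lemma slot_cnt j u : (u < reps j)%nat -> slot (cnt j + u) = (j, u).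
Proof.
  assert (Hin : forall j, slot (cnt j) = (j, O) -> forall u, (u < reps j)%nat -> slot (cnt j + u) = (j, u)).
  { clear. intros j Hj. induction u as [|u IH]; intros Hu; [rewrite Nat.add_0_r; exact Hj|].
    rewrite Nat.add_succ_r. simpl. rewrite IH by lia.
    destruct (Nat.ltb_spec (u + 1) (reps j)); [f_equal; lia|lia]. }
  assert (H0 : forall j, slot (cnt j) = (j, O)).
  { induction j0 as [|j0 IH]; [reflexivity|].
    change (cnt (S j0)) with (cnt j0 + (j0 * cnt j0 + 1))%nat.
    replace (cnt j0 + (j0 * cnt j0 + 1))%nat with (S (cnt j0 + (j0 * cnt j0))) by lia.
    simpl. rewrite (Hin j0 IH) by (unfold reps; lia).
    destruct (Nat.ltb_spec (j0 * cnt j0 + 1) (reps j0)); [unfold reps in *; lia|reflexivity]. }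
  apply Hin, H0.
Qed.

Lemma countable_or (A B : R -> Prop) : countable_set A -> countable_set B -> countable_set (fun x => A x \/ B x).
Proof.
  intros HA HB. apply countable_sub with (fun x => exists n : nat, match n with O => A x | _ => B x end).
  - intros x [H|H]; [exists 0%nat|exists 1%nat]; exact H.
  - apply (countable_union (fun n x => match n with O => A x | _ => B x end)). intros [|n]; assumption.
Qed.

(** * Pairs that are not Li-Yorke, and eventually autonomous orbits *)

Lemma asymptotic_not_LY fs x y :
  (forall e, 0 < e -> exists N, forall n, (N <= n)%nat -> Rabs (nds_iter fs n x - nds_iter fs n y) < e) ->
  ~ LY_pair fs x y.
Proof.
  intros H [_ [[l [Hl Hpos]] _]]. destruct l as [r|].
  - simpl in Hpos. destruct Hl as [_ Hl]. destruct (H (r / 2) ltac:(lra)) as [N HN].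
    destruct (Hl (r / 2) ltac:(lra) N) as [n [Hn Hr]]. specialize (HN n Hn). lra.
  - destruct (H 1 ltac:(lra)) as [N HN]. destruct (Hl 1 N) as [n [Hn Hr]]. specialize (HN n Hn). lra.
Qed.

Lemma merged_not_LY fs N x y : nds_iter fs N x = nds_iter fs N y -> ~ LY_pair fs x y.
Proof.
  intros E. apply asymptotic_not_LY. intros e He. exists N. intros n Hn.
  assert (En : nds_iter fs n x = nds_iter fs n y).
  { induction Hn as [|n Hn IH]; [exact E|]. simpl. rewrite IH. reflexivity. }
  rewrite En, Rminus_diag, Rabs_R0. exact He.
Qed.

Lemma limsup_shift u v l T : (forall n, v n = u (n + T)%nat) -> is_limsup u l -> is_limsup v l.
Proof.
  intros E Hl. destruct l as [r|]; [destruct Hl as [H1 H2]; split|].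
  - intros e He. destruct (H1 e He) as [N HN]. exists N. intros n Hn. rewrite E. apply HN; lia.
  - intros e He N. destruct (H2 e He (N + T)%nat) as [n [Hn Hu]]. exists (n - T)%nat. split; [lia|].
    rewrite E. replace (n - T + T)%nat with n by lia. exact Hu.
  - intros M N. destruct (Hl M (N + T)%nat) as [n [Hn Hu]]. exists (n - T)%nat. split; [lia|].
    rewrite E. replace (n - T + T)%nat with n by lia. exact Hu.
Qed.

Lemma liminf_shift u v r T : (forall n, v n = u (n + T)%nat) -> is_liminf_fin u r -> is_liminf_fin v r.
Proof.
  intros E [H1 H2]. split.
  - intros e He. destruct (H1 e He) as [N HN]. exists N. intros n Hn. rewrite E. apply HN; lia.
  - intros e He N. destruct (H2 e He (N + T)%nat) as [n [Hn Hu]]. exists (n - T)%nat. split; [lia|].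
    rewrite E. replace (n - T + T)%nat with n by lia. exact Hu.
Qed.

(* A scrambled set whose orbits follow [f] from time [T] on is carried injectively to a scrambled set of [f]. *)
Lemma eventually_autonomous_countable f fs T (A : R -> Prop) : ~ LY_chaotic (auto f) ->
  (forall x, A x -> in_I (nds_iter fs T x)) ->
  (forall x, A x -> forall t, (T <= t)%nat -> nds_iter fs (S t) x = f (nds_iter fs t x)) ->
  (forall x y, A x -> A y -> x <> y -> LY_pair fs x y) -> countable_set A.
Proof.
  intros Hno HI Hf HLY. apply NNPP; intros Hunc. apply Hno.
  assert (Hshift : forall x, A x -> forall n, nds_iter (auto f) n (nds_iter fs T x) = nds_iter fs (n + T) x).
  { intros x Hx. induction n as [|n IH]; [reflexivity|]. simpl nds_iter at 1. rewrite IH.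
    symmetry. exact (Hf x Hx (n + T)%nat ltac:(lia)). }
  exists (fun z => exists x, A x /\ z = nds_iter fs T x). split; [|split].
  - intros z [x [Hx ->]]. apply HI; exact Hx.
  - intros [g Hg]. apply Hunc.
    (* An inverse of [nds_iter fs T] on the points of [A]: it is single-valued because two points
       that merge do not form a Li-Yorke pair. *)
    destruct (choice (fun n x => forall y, A y -> nds_iter fs T y = g n -> x = y)) as [g' Hg'].
    { intros n. destruct (classic (exists x, A x /\ nds_iter fs T x = g n)) as [[x [Hx Ex]]|Hn].
      - exists x. intros y Hy Ey. apply NNPP; intros Hne.
        apply (merged_not_LY fs T x y); [congruence|]. apply HLY; assumption.
      - exists 0. intros y Hy Ey. exfalso; apply Hn; exists y; auto. }
    exists g'. intros x Hx. destruct (Hg (nds_iter fs T x)) as [n Hn]; [exists x; auto|].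
    exists n. apply Hg'; auto.
  - intros z z' [x [Hx ->]] [y [Hy ->]] Hne.
    destruct (HLY x y Hx Hy ltac:(congruence)) as [_ [[l [Hl Hpos]] Hinf]].
    assert (E : forall n, Rabs (nds_iter (auto f) n (nds_iter fs T x) - nds_iter (auto f) n (nds_iter fs T y)) =
       Rabs (nds_iter fs (n + T) x - nds_iter fs (n + T) y)).
    { intros n. rewrite !Hshift by assumption. reflexivity. }
    split; [exact Hne|]. split; [exists l; split; [|exact Hpos]|].
    + exact (limsup_shift _ _ l T E Hl).
    + exact (liminf_shift _ _ 0 T E Hinf).
Qed.

(** * The associated system indexed by time *)

Section AssociatedSystem.

Variables (f : R -> R) (W : R -> Prop) (J : nat -> nat -> R * R).
Hypothesis Hmap : maps_I f.
Hypothesis Hcont : cont_I f.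
Hypothesis HJ : assoc_system f W J.

(* Indexing by time: [lo n t, hi n t] is [J n (t mod 2^n)] = f^t (J n 0). *)
Definition lo n t := fst (J n (t mod 2 ^ n)%nat).
Definition hi n t := snd (J n (t mod 2 ^ n)%nat).
Definition JJ n t : R -> Prop := fun y => lo n t <= y <= hi n t.

Lemma JJ_lohi n t : lo n t <= hi n t.
Proof.
  destruct (HJ n) as [_ [H _]].
  destruct (H (t mod 2 ^ n)%nat) as [H1 _]; [|exact H1].
  apply Nat.mod_upper_bound. pose proof (pow2_pos n); lia.
Qed.

Lemma JJ_mod n s t : (s mod 2 ^ n = t mod 2 ^ n)%nat -> JJ n s = JJ n t.
Proof. intros E. unfold JJ, lo, hi. rewrite E. reflexivity. Qed.

Lemma lo_mod n s t : (s mod 2 ^ n = t mod 2 ^ n)%nat -> lo n s = lo n t.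
Proof. intros E. unfold lo. rewrite E. reflexivity. Qed.

Lemma hi_mod n s t : (s mod 2 ^ n = t mod 2 ^ n)%nat -> hi n s = hi n t.
Proof. intros E. unfold hi. rewrite E. reflexivity. Qed.

Lemma JJ_0 n : JJ n 0 = interval (J n 0%nat).
Proof. unfold JJ, lo, hi. rewrite Nat.Div0.mod_0_l. reflexivity. Qed.

Lemma JJ_period n q y : JJ n 0 y <-> image_iter f (q * 2 ^ n) (JJ n 0) y.
Proof.
  assert (Hper : set_eq (image_iter f (2 ^ n) (JJ n 0)) (JJ n 0)).
  { rewrite JJ_0. destruct (HJ n) as [H _]. apply H. }
  revert y. induction q as [|q IH]; intros y.
  - simpl. split; [intros Hy; exists y; auto|intros [x [Hx <-]]; exact Hx].
  - replace (S q * 2 ^ n)%nat with (2 ^ n + q * 2 ^ n)%nat by lia.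
    rewrite image_iter_add. rewrite <- (Hper y). split; apply image_iter_sub; intros z; apply IH.
Qed.

Lemma JJ_image n t y : JJ n t y <-> image_iter f t (JJ n 0) y.
Proof.
  assert (Hk : (t mod 2 ^ n < 2 ^ n)%nat) by (apply Nat.mod_upper_bound; pose proof (pow2_pos n); lia).
  assert (E : set_eq (JJ n t) (image_iter f (t mod 2 ^ n) (JJ n 0))).
  { rewrite JJ_0. destruct (HJ n) as [_ [H _]]. apply (H _ Hk). }
  rewrite (E y).
  assert (Et : (t = t mod 2 ^ n + t / 2 ^ n * 2 ^ n)%nat).
  { pose proof (Nat.div_mod_eq t (2 ^ n)). lia. }
  rewrite Et at 2. rewrite image_iter_add. split; apply image_iter_sub; intros z; apply JJ_period.
Qed.

Lemma JJ_iter n t k y : JJ n (k + t) y <-> exists x, JJ n t x /\ Nat.iter k f x = y.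
Proof.
  rewrite JJ_image, image_iter_add. split; intros [x [Hx E]]; exists x; (split; [|exact E]); apply JJ_image; exact Hx.
Qed.

Lemma JJ_step n t y : JJ n (S t) y <-> exists x, JJ n t x /\ f x = y.
Proof. exact (JJ_iter n t 1 y). Qed.

Lemma JJ_fwd n t k x : JJ n t x -> JJ n (k + t) (Nat.iter k f x).
Proof. intros Hx. apply JJ_iter. exists x; auto. Qed.

Lemma JJ_nest1 n t y : JJ (S n) t y -> JJ n t y.
Proof.
  rewrite !JJ_image. apply image_iter_sub. intros z. rewrite !JJ_0. destruct (HJ n) as [_ [_ [_ [_ H]]]]. apply H.
Qed.

Lemma JJ_nest m n t y : (m <= n)%nat -> JJ n t y -> JJ m t y.
Proof. intros Hmn. induction Hmn; auto. intros H. apply IHHmn, JJ_nest1, H. Qed.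

Lemma JJ_disj n s t y : JJ n s y -> JJ n t y -> (s mod 2 ^ n = t mod 2 ^ n)%nat.
Proof.
  assert (Hs : (s mod 2 ^ n < 2 ^ n)%nat) by (apply Nat.mod_upper_bound; pose proof (pow2_pos n); lia).
  assert (Ht : (t mod 2 ^ n < 2 ^ n)%nat) by (apply Nat.mod_upper_bound; pose proof (pow2_pos n); lia).
  rewrite <- (JJ_mod n (s mod 2 ^ n) s), <- (JJ_mod n (t mod 2 ^ n) t) by apply Nat.Div0.mod_mod.
  rewrite !JJ_image, JJ_0. intros H1 H2.
  destruct (HJ n) as [[_ [_ [_ [Hd _]]]] _].
  destruct (Nat.lt_total (s mod 2 ^ n) (t mod 2 ^ n)) as [Hl|[E|Hl]]; [|exact E|].
  - exfalso. apply (Hd _ _ Hl Ht y). auto.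
  - exfalso. apply (Hd _ _ Hl Hs y). auto.
Qed.

Lemma JJ_in_I n t y : JJ n t y -> in_I y.
Proof.
  rewrite JJ_image. intros [x [Hx <-]]. apply iter_maps_I; [exact Hmap|].
  rewrite JJ_0 in Hx. destruct (HJ n) as [[_ [H1 [H2 _]]] _].
  unfold interval in Hx. unfold in_I in *. lra.
Qed.

Lemma lo_in n t : JJ n t (lo n t).
Proof. pose proof (JJ_lohi n t). unfold JJ; lra. Qed.

Lemma hi_in n t : JJ n t (hi n t).
Proof. pose proof (JJ_lohi n t). unfold JJ; lra. Qed.

Lemma JJ_bounds n t : 0 <= lo n t /\ hi n t <= 1.
Proof. split; [apply (JJ_in_I n t), lo_in|apply (JJ_in_I n t), hi_in]. Qed.

Lemma iter_cont_JJ n t k : cont_on (lo n t) (hi n t) (Nat.iter k f).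
Proof.
  apply cont_on_subset with 0 1; [apply iter_cont_I; assumption|apply JJ_bounds|apply JJ_bounds].
Qed.

(** [t] and [t + 2 ^ n] stand for the two intervals of level [n + 1] inside [JJ n t]. *)
Lemma half_mod n t : ((t + 2 ^ n) mod 2 ^ n = t mod 2 ^ n)%nat.
Proof. replace (t + 2 ^ n)%nat with (t + 1 * 2 ^ n)%nat by lia. apply Nat.Div0.mod_add. Qed.

Lemma half_mod_S n t : ((t + 2 ^ n) mod 2 ^ (S n) <> t mod 2 ^ (S n))%nat.
Proof.
  intros E. replace t with (t + 0)%nat in E at 2 by lia. apply mod_add_cancel in E.
  pose proof (pow2_pos n). simpl in E. rewrite !Nat.mod_small in E; lia.
Qed.

Lemma JJ_other_half n t y : JJ (S n) (t + 2 ^ n) y -> JJ n t y.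
Proof. intros H. apply JJ_nest1 in H. rewrite (JJ_mod n t (t + 2 ^ n)); [exact H|]. symmetry; apply half_mod. Qed.

Lemma halves_disjoint n t : hi (S n) t < lo (S n) (t + 2 ^ n) \/ hi (S n) (t + 2 ^ n) < lo (S n) t.
Proof.
  apply NNPP; intros H. pose proof (JJ_lohi (S n) t). pose proof (JJ_lohi (S n) (t + 2 ^ n)).
  apply (half_mod_S n t). destruct (Rle_dec (lo (S n) t) (lo (S n) (t + 2 ^ n))).
  - apply JJ_disj with (lo (S n) (t + 2 ^ n)); unfold JJ; lra.
  - apply JJ_disj with (lo (S n) t); unfold JJ; lra.
Qed.

(** It contains two disjoint nonempty intervals of the next level. *)
Lemma JJ_nondeg n t : lo n t < hi n t.
Proof.
  pose proof (JJ_nest1 n t _ (lo_in (S n) t)) as A1. pose proof (JJ_nest1 n t _ (hi_in (S n) t)) as A2.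
  pose proof (JJ_other_half n t _ (lo_in (S n) (t + 2 ^ n))) as B1.
  pose proof (JJ_other_half n t _ (hi_in (S n) (t + 2 ^ n))) as B2.
  unfold JJ in *. destruct (halves_disjoint n t); lra.
Qed.

Definition simple y := forall n, exists t, JJ n t y.

Lemma simple_iff y : simple y <-> simple_set J y.
Proof.
  split; intros H n; destruct (H n) as [t Ht].
  - exists (t mod 2 ^ n)%nat. split; [apply Nat.mod_upper_bound; pose proof (pow2_pos n); lia|exact Ht].
  - exists t. destruct Ht as [Hlt Ht]. unfold JJ, lo, hi. rewrite Nat.mod_small by exact Hlt. exact Ht.
Qed.

Lemma simple_iter k y : simple y -> simple (Nat.iter k f y).
Proof. intros H n. destruct (H n) as [t Ht]. exists (k + t)%nat. apply JJ_fwd; exact Ht. Qed.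

Lemma simple_in_I y : simple y -> in_I y.
Proof. intros H. destruct (H 0%nat) as [t Ht]. eapply JJ_in_I; exact Ht. Qed.

(* Same component of the simple set. *)
Definition same_fibre x y := forall n, exists t, JJ n t x /\ JJ n t y.

Lemma same_fibre_JJ n t x y : same_fibre x y -> JJ n t x -> JJ n t y.
Proof.
  intros H Hx. destruct (H n) as [s [H1 H2]]. rewrite (JJ_mod n t s); [exact H2|].
  eapply JJ_disj; eassumption.
Qed.

(** Level 0 has a single phase, so there is a first level at which the two points part. One level
    earlier, at [v], they still share an interval, so they lie in its two halves. *)
Lemma separation_level x y : simple x -> simple y -> ~ same_fibre x y ->
  exists v s t, JJ (S v) s x /\ JJ (S v) t y /\ (s mod 2 ^ S v <> t mod 2 ^ S v)%nat /\
    (s mod 2 ^ v = t mod 2 ^ v)%nat.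
Proof.
  intros Hx Hy Hn.
  assert (H : exists n, (~ exists t, JJ n t x /\ JJ n t y)) by (apply not_all_ex_not; exact Hn).
  destruct H as [n H]. induction n as [|v IH].
  - exfalso; apply H. destruct (Hx 0%nat) as [s Hs]. destruct (Hy 0%nat) as [t Ht].
    exists s; split; [exact Hs|]. rewrite (JJ_mod 0 s t); [exact Ht|]. simpl. reflexivity.
  - destruct (classic (exists t, JJ v t x /\ JJ v t y)) as [[r [Hr1 Hr2]]|Hno]; [|exact (IH Hno)].
    destruct (Hx (S v)) as [s Hs]. destruct (Hy (S v)) as [t Ht]. exists v, s, t.
    repeat split; try apply Hs; try apply Ht.
    + intros E. apply H. exists s; split; [exact Hs|]. rewrite (JJ_mod _ s t E). exact Ht.
    + transitivity (r mod 2 ^ v)%nat.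
      * eapply JJ_disj; [apply JJ_nest1; exact Hs|exact Hr1].
      * eapply JJ_disj; [exact Hr2|apply JJ_nest1; exact Ht].
Qed.

Lemma pos_dist_JJ n p : exists r, 0 < r /\ forall t, ~ JJ n t p -> forall y, JJ n t y -> r <= Rabs (y - p).
Proof.
  destruct (finite_min_pos (fun k r => ~ JJ n k p -> forall y, JJ n k y -> r <= Rabs (y - p)) (2 ^ n))
    as [r [Hr H]].
  - intros k r r' H Hr Hk y Hy. specialize (H Hk y Hy). lra.
  - intros k Hk. destruct (classic (JJ n k p)) as [Hp|Hp].
    + exists 1; split; [lra|]. intros H; contradiction.
    + unfold JJ in Hp. destruct (Rlt_dec p (lo n k)).
      * exists (lo n k - p); split; [lra|]. intros _ y Hy. unfold JJ in Hy.
        rewrite Rabs_right by lra. lra.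
      * exists (p - hi n k); split; [lra|]. intros _ y Hy. unfold JJ in Hy.
        rewrite Rabs_left1 by lra. lra.
  - exists r; split; [exact Hr|]. intros t Ht y Hy.
    assert (E : (t mod 2 ^ n mod 2 ^ n = t mod 2 ^ n)%nat) by apply Nat.Div0.mod_mod.
    rewrite <- (JJ_mod _ _ _ E) in Ht, Hy. revert Ht y Hy. apply H.
    apply Nat.mod_upper_bound. pose proof (pow2_pos n); lia.
Qed.

Lemma simple_closed p : (forall eps, 0 < eps -> exists y, simple y /\ Rabs (y - p) < eps) -> simple p.
Proof.
  intros H n. destruct (pos_dist_JJ n p) as [r [Hr Hd]]. destruct (H r Hr) as [y [Hy Hyp]].
  destruct (Hy n) as [t Ht]. exists t. apply NNPP; intros Hnp. specialize (Hd t Hnp y Ht). lra.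
Qed.

(** If [y] were beyond the right end of [JJ n t], points just after that end would lie in other
    intervals of level [n]. These are finitely many closed sets off the end point, hence at positive
    distance from it. *)
Lemma interval_in_simple x y : x <= y -> (forall z, x <= z <= y -> simple z) -> same_fibre x y.
Proof.
  intros Hxy H n. destruct (H x ltac:(lra) n) as [t Ht]. exists t; split; [exact Ht|].
  apply NNPP; intros Hny.
  assert (Hh : hi n t < y) by (unfold JJ in *; lra).
  destruct (pos_dist_JJ n (hi n t)) as [r [Hr Hd]].
  set (z := hi n t + Rmin (r / 2) (y - hi n t)).
  assert (Hz : hi n t < z <= y /\ z < hi n t + r).
  { unfold z, Rmin; destruct Rle_dec; lra. }
  destruct (H z) with (n := n) as [s Hs]; [unfold JJ in Ht; lra|].
  assert (Hns : ~ JJ n s (hi n t)).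
  { intros Hs2. pose proof (JJ_disj n s t _ Hs2 (hi_in n t)) as E. rewrite (JJ_mod n s t E) in Hs.
    unfold JJ in Hs. lra. }
  specialize (Hd s Hns z Hs). rewrite Rabs_right in Hd by lra. lra.
Qed.

Lemma connected_same_fibre C x y : connected_R C -> (forall z, C z -> simple z) ->
  C x -> C y -> same_fibre x y.
Proof.
  intros HC HM Hx Hy. destruct (Rle_dec x y).
  - apply interval_in_simple; [assumption|]. intros z Hz. apply HM. apply (HC x y); assumption.
  - assert (H : same_fibre y x).
    { apply interval_in_simple; [lra|]. intros z Hz. apply HM. apply (HC y x); assumption. }
    intros m. destruct (H m) as [t [H1 H2]]. exists t; auto.
Qed.

Definition nontrivial_fibre x := exists y, same_fibre x y /\ y <> x.

(** The fibre of [x] is a nondegenerate component, hence some [G m], and its image is [G (m + 1)],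
    again nondegenerate. *)
Lemma nontrivial_fibre_step x : components_Z_indexed f (simple_set J) ->
  nontrivial_fibre x -> nontrivial_fibre (f x).
Proof.
  intros [G [HG [_ [Hall Hf]]]] [y [Hxy Hne]].
  set (C := fun u => same_fibre x u).
  assert (HC : is_component (simple_set J) C).
  { split; [exists y; exact Hxy|]. split; [|split].
    - intros u Hu. apply simple_iff. intros n. destruct (Hu n) as [t [_ H]]. exists t; exact H.
    - intros u v z Hu Hv Hz n. destruct (Hu n) as [t [H1 H2]]. exists t. split; [exact H1|].
      pose proof (same_fibre_JJ n t _ _ Hv H1). unfold JJ in *. lra.
    - intros D HD HDM [u [HDu Hxu]] z Hz n.
      destruct (Hxu n) as [t [H1 H2]]. exists t. split; [exact H1|].
      apply (same_fibre_JJ n t u z); [|exact H2].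
      apply (connected_same_fibre D); try assumption. intros w Hw. apply simple_iff, HDM, Hw. }
  assert (Hxx : C x).
  { intros n. destruct (Hxy n) as [t [H _]]. exists t; auto. }
  destruct (Hall C HC) as [m Hm].
  { exists x, y. repeat split; auto. }
  assert (Hfx : G (m + 1)%Z (f x)).
  { apply Hf. exists x. split; [apply Hm; exact Hxx|reflexivity]. }
  destruct (HG (m + 1)%Z) as [[_ [HM [Hco _]]] [u [v [Hu [Hv Huv]]]]].
  assert (Hs : forall w, G (m + 1)%Z w -> same_fibre (f x) w).
  { intros w Hw. apply (connected_same_fibre (G (m + 1)%Z)); try assumption.
    intros z Hz. apply simple_iff, HM, Hz. }
  destruct (Req_dec u (f x)) as [E|E].
  - exists v. split; [apply Hs; exact Hv|]. congruence.
  - exists u. split; [apply Hs; exact Hu|exact E].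
Qed.

(** * Limit sets of points of the simple set *)

Hypothesis Huniq : forall W', is_omega_limit_set f W' -> infinite_set W' -> set_eq W' W.

(** The orbit is in [JJ n k] once in every [2 ^ n] steps; a cluster point of these visits serves. *)
Lemma omega_meets n k x : simple x -> exists y, omega_limit f x y /\ JJ n k y.
Proof.
  intros Hx. destruct (Hx n) as [t Ht].
  assert (Hp := pow2_pos n).
  assert (Hr : (t mod 2 ^ n < 2 ^ n)%nat) by (apply Nat.mod_upper_bound; lia).
  set (i0 := (k + (2 ^ n - t mod 2 ^ n))%nat).
  assert (Hu : forall i, JJ n k (Nat.iter (i0 + i * 2 ^ n) f x)).
  { intros i. rewrite (JJ_mod n k (i0 + i * 2 ^ n + t)); [apply JJ_fwd; exact Ht|].
    pose proof (Nat.div_mod_eq t (2 ^ n)).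
    replace (i0 + i * 2 ^ n + t)%nat with (k + (i + 1 + t / 2 ^ n) * 2 ^ n)%nat by (unfold i0; nia).
    rewrite Nat.Div0.mod_add. reflexivity. }
  destruct (cluster_point (lo n k) (hi n k) (fun i => Nat.iter (i0 + i * 2 ^ n) f x) Hu) as [y [Hy Hc]].
  exists y; split; [|exact Hy]. intros eps He N.
  destruct (Hc eps He (S N)) as [i [Hi1 Hi2]]. exists (i0 + i * 2 ^ n)%nat.
  split; [nia|]. split; [nia|exact Hi2].
Qed.

(** The limit set meets [2 ^ n] disjoint intervals of level [n], so no list of length [n] exhausts
    it. *)
Lemma omega_infinite x : simple x -> infinite_set (omega_limit f x).
Proof.
  intros Hx l. apply NNPP; intros Hn.
  set (n := length l).
  destruct (choice (fun k y => omega_limit f x y /\ JJ n k y)) as [g Hg].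
  { intros k. apply omega_meets; exact Hx. }
  assert (Hinc : incl (map g (seq 0 (2 ^ n))) l).
  { intros y Hy. apply in_map_iff in Hy. destruct Hy as [k [<- _]].
    apply NNPP; intros H. apply Hn. exists (g k). split; [apply Hg|exact H]. }
  assert (Hnd : NoDup (map g (seq 0 (2 ^ n)))).
  { apply NoDup_map_NoDup_ForallPairs; [|apply seq_NoDup].
    intros a b Ha Hb E. apply in_seq in Ha, Hb.
    pose proof (JJ_disj n a b (g a) (proj2 (Hg a))) as H. rewrite E in H. specialize (H (proj2 (Hg b))).
    rewrite !Nat.mod_small in H by lia. exact H. }
  pose proof (NoDup_incl_length Hnd Hinc) as H. rewrite length_map, length_seq in H.
  fold n in H. pose proof (Nat.pow_gt_lin_r 2 n). lia.
Qed.

(** Minimality of the periodic intervals is stated relative to [W]; this lets it be tested on the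
    orbit of any point of the simple set. *)
Lemma simple_omega x : simple x -> set_eq (omega_limit f x) W.
Proof.
  intros Hx. apply Huniq; [|apply omega_infinite; exact Hx].
  exists x. split; [apply simple_in_I; exact Hx|]. intros y; reflexivity.
Qed.

(** * Fibres that are points *)

Definition point_fibre z := simple z /\ ~ nontrivial_fibre z.

Lemma smaller_half n t : exists s, (s mod 2 ^ n = t mod 2 ^ n)%nat /\
  hi (S n) s - lo (S n) s <= (hi n t - lo n t) / 2.
Proof.
  pose proof (JJ_nest1 n t _ (lo_in (S n) t)) as A1. pose proof (JJ_nest1 n t _ (hi_in (S n) t)) as A2.
  pose proof (JJ_other_half n t _ (lo_in (S n) (t + 2 ^ n))) as B1.
  pose proof (JJ_other_half n t _ (hi_in (S n) (t + 2 ^ n))) as B2.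
  unfold JJ in *.
  destruct (Rle_dec (hi (S n) t - lo (S n) t) ((hi n t - lo n t) / 2)) as [H|H].
  - exists t; auto.
  - exists (t + 2 ^ n)%nat. split; [apply half_mod|]. destruct (halves_disjoint n t); lra.
Qed.

Lemma small_JJ n : exists q, hi n q - lo n q <= (1 / 2) ^ n.
Proof.
  induction n as [|n [q IH]].
  - exists 0%nat. pose proof (JJ_bounds 0 0). simpl. lra.
  - destruct (smaller_half n q) as [s [_ Hs]]. exists s. rewrite <- tech_pow_Rmult. lra.
Qed.

(** Passing to the shorter half at every level from [JJ n t] on makes the nested intervals shrink to
    a point. *)
Lemma point_fibre_exists n t : exists z, point_fibre z /\ JJ n t z.
Proof.
  destruct (choice (fun (p : nat * nat) s => (s mod 2 ^ fst p = snd p mod 2 ^ fst p)%nat /\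
    hi (S (fst p)) s - lo (S (fst p)) s <= (hi (fst p) (snd p) - lo (fst p) (snd p)) / 2)) as [H HH].
  { intros [m s]. apply smaller_half. }
  set (q := fix q i := match i with O => t | S i => H ((i + n)%nat, q i) end).
  assert (Hq : forall i, (q (S i) mod 2 ^ (i + n) = q i mod 2 ^ (i + n))%nat /\
     hi (S (i + n)) (q (S i)) - lo (S (i + n)) (q (S i)) <= (hi (i + n) (q i) - lo (i + n) (q i)) / 2).
  { intros i. apply (HH ((i + n)%nat, q i)). }
  assert (Hlen : forall i, hi (i + n) (q i) - lo (i + n) (q i) <= (1 / 2) ^ i).
  { induction i as [|i IH].
    - pose proof (JJ_bounds n t). simpl. lra.
    - destruct (Hq i) as [_ H1]. rewrite <- tech_pow_Rmult. simpl plus. lra. }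
  assert (Hsub : forall i k y, JJ (k + i + n) (q (k + i)%nat) y -> JJ (i + n) (q i) y).
  { intros i. induction k as [|k IH]; intros y Hy; [exact Hy|].
    apply IH. simpl plus in Hy. apply JJ_nest1 in Hy.
    rewrite <- (JJ_mod _ _ _ (proj1 (Hq (k + i)%nat))). exact Hy. }
  destruct (nested_point (fun i => lo (i + n) (q i)) (fun i => hi (i + n) (q i))) as [z Hz].
  { intros i j.
    assert (A := Hsub i j _ (lo_in (j + i + n) (q (j + i)%nat))).
    assert (B := Hsub j i _ (lo_in (i + j + n) (q (i + j)%nat))).
    rewrite (Nat.add_comm i j) in B. unfold JJ in A, B. lra. }
  exists z. split; [|exact (Hz 0%nat)]. split.
  - intros m. exists (q m). apply JJ_nest with (m + n)%nat; [lia|]. exact (Hz m).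
  - intros [y [Hy Hne]]. apply Hne. apply Rminus_diag_uniq. apply NNPP; intros Hd.
    destruct (pow_lt_1_zero (1 / 2)) with (y := Rabs (y - z)) as [i Hi].
    { rewrite Rabs_right; lra. } { apply Rabs_pos_lt; exact Hd. }
    specialize (Hi i ltac:(lia)). rewrite Rabs_right in Hi by (apply Rle_ge, pow_le; lra).
    specialize (Hlen i). assert (Hzi := Hz i). assert (Hyi := same_fibre_JJ (i + n) (q i) z y Hy Hzi).
    unfold JJ in Hyi. simpl in Hzi.
    assert (Rabs (y - z) <= (1 / 2) ^ i) by (unfold Rabs; destruct Rcase_abs; lra). lra.
Qed.

(** * The gap core and its expansion *)

Lemma simple_max n t : exists g, simple g /\ JJ n t g /\ forall m, simple m -> JJ n t m -> m <= g.
Proof.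
  destruct (point_fibre_exists n t) as [z [[Hz _] Hzt]].
  destruct (completeness (fun m => simple m /\ JJ n t m)) as [g [Hub Hlub]].
  - exists (hi n t). intros m [_ Hm]. apply Hm.
  - exists z; auto.
  - exists g. split; [|split].
    + apply simple_closed. intros eps He. apply NNPP; intros H.
      assert (Hb : is_upper_bound (fun m => simple m /\ JJ n t m) (g - eps)).
      { intros m Hm. apply Rnot_lt_le; intros Hlt. apply H. exists m. split; [apply Hm|].
        specialize (Hub m Hm). apply Rabs_lt_iff; lra. }
      specialize (Hlub _ Hb). lra.
    + split; [|apply Hlub; intros m [_ Hm]; apply Hm].
      specialize (Hub z (conj Hz Hzt)). destruct Hzt; lra.
    + intros m H1 H2. apply Hub; auto.
Qed.

Lemma simple_min n t : exists g, simple g /\ JJ n t g /\ forall m, simple m -> JJ n t m -> g <= m.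
Proof.
  destruct (point_fibre_exists n t) as [z [[Hz _] Hzt]].
  (* The infimum is taken as minus the supremum of the reflected set. *)
  destruct (completeness (fun m => simple (- m) /\ JJ n t (- m))) as [g [Hub Hlub]].
  - exists (- lo n t). intros m [_ Hm]. unfold JJ in Hm. lra.
  - exists (- z). rewrite Ropp_involutive; auto.
  - exists (- g). split; [|split].
    + apply simple_closed. intros eps He. apply NNPP; intros H.
      assert (Hb : is_upper_bound (fun m => simple (- m) /\ JJ n t (- m)) (g - eps)).
      { intros m Hm. apply Rnot_lt_le; intros Hlt. apply H. exists (- m). split; [apply Hm|].
        specialize (Hub m Hm). apply Rabs_lt_iff; lra. }
      specialize (Hlub _ Hb). lra.
    + assert (Hz' : - z <= g) by (apply Hub; rewrite Ropp_involutive; auto).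
      assert (g <= - lo n t) by (apply Hlub; intros m [_ Hm]; unfold JJ in Hm; lra).
      unfold JJ in *; lra.
    + intros m H1 H2. assert (- m <= g) by (apply Hub; rewrite Ropp_involutive; auto). lra.
Qed.

Lemma phase_halves v s : (s mod 2 ^ v = 0)%nat ->
  (s mod 2 ^ S v = 0 mod 2 ^ S v \/ s mod 2 ^ S v = (0 + 2 ^ v) mod 2 ^ S v)%nat.
Proof.
  intros E. pose proof (pow2_pos v). replace (2 ^ S v)%nat with (2 ^ v * 2)%nat by (simpl; lia).
  rewrite Nat.Div0.mod_0_l, Nat.Div0.mod_mul_r, E.
  assert (Hb : ((s / 2 ^ v) mod 2 < 2)%nat) by (apply Nat.mod_upper_bound; lia).
  rewrite (Nat.mod_small (0 + 2 ^ v)) by lia.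
  destruct ((s / 2 ^ v) mod 2)%nat as [|[|]]; lia.
Qed.

(** [[g1, g2]] is the gap between the two halves of [JJ v 0], extended on both sides to the nearest
    points of the simple set. Points of the simple set in different halves always straddle it, in
    one order or the other. *)
Definition gap_core v g1 g2 := simple g1 /\ simple g2 /\ g1 < g2 /\
  (exists s t, JJ (S v) s g1 /\ JJ (S v) t g2 /\ (s mod 2 ^ v = 0)%nat /\ (t mod 2 ^ v = 0)%nat /\
     (s mod 2 ^ S v <> t mod 2 ^ S v)%nat) /\
  forall s t m1 m2, simple m1 -> simple m2 -> JJ (S v) s m1 -> JJ (S v) t m2 ->
    (s mod 2 ^ v = 0)%nat -> (t mod 2 ^ v = 0)%nat -> (s mod 2 ^ S v <> t mod 2 ^ S v)%nat ->
    (m1 <= g1 /\ g2 <= m2) \/ (m2 <= g1 /\ g2 <= m1).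

Lemma gap_core_exists v : exists g1 g2, gap_core v g1 g2.
Proof.
  assert (E0 : (0 mod 2 ^ v = 0)%nat) by apply Nat.Div0.mod_0_l.
  assert (E1 : ((0 + 2 ^ v) mod 2 ^ v = 0)%nat) by (rewrite half_mod; exact E0).
  assert (N : (0 mod 2 ^ S v <> (0 + 2 ^ v) mod 2 ^ S v)%nat) by (intros E; exact (half_mod_S v 0 (eq_sym E))).
  assert (Hmain : exists s t, (s mod 2 ^ v = 0)%nat /\ (t mod 2 ^ v = 0)%nat /\
     (s mod 2 ^ S v <> t mod 2 ^ S v)%nat /\ hi (S v) s < lo (S v) t /\
     forall r, (r mod 2 ^ v = 0)%nat -> (r mod 2 ^ S v = s mod 2 ^ S v \/ r mod 2 ^ S v = t mod 2 ^ S v)%nat).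
  { destruct (halves_disjoint v 0) as [H|H].
    - exists 0%nat, (0 + 2 ^ v)%nat. repeat split; try assumption. intros r; apply phase_halves.
    - exists (0 + 2 ^ v)%nat, 0%nat. repeat split; try assumption; [congruence|].
      intros r Hr. apply or_comm. apply phase_halves; exact Hr. }
  destruct Hmain as [s [t [Es [Et [Hne [Hlt Hall]]]]]].
  destruct (simple_max (S v) s) as [g1 [G1 [G1' G1m]]].
  destruct (simple_min (S v) t) as [g2 [G2 [G2' G2m]]].
  exists g1, g2. split; [exact G1|]. split; [exact G2|]. split; [unfold JJ in *; lra|]. split.
  - exists s, t. auto.
  - intros s' t' m1 m2 S1 S2 H1 H2 Es' Et' Hne'.
    destruct (Hall s' Es') as [A|A]; destruct (Hall t' Et') as [B|B]; try congruence;
      rewrite (JJ_mod _ _ _ A) in H1; rewrite (JJ_mod _ _ _ B) in H2.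
    + left; split; [apply G1m|apply G2m]; assumption.
    + right; split; [apply G1m|apply G2m]; assumption.
Qed.

Lemma image_on_iter_add p q k l y z : image_on (Nat.iter k f) p q y -> Nat.iter l f y = z ->
  image_on (Nat.iter (l + k) f) p q z.
Proof. intros [x [Hx E]] Ez. exists x; split; [exact Hx|]. rewrite Nat.iter_add, E. exact Ez. Qed.

Section Core.

Variables (v : nat) (g1 g2 : R).
Hypothesis Hcore : gap_core v g1 g2.

Lemma core_JJ y : g1 <= y <= g2 -> JJ v 0 y.
Proof.
  destruct Hcore as [_ [_ [_ [[s [t [H1 [H2 [Es [Et _]]]]]] _]]]]. intros Hy.
  apply JJ_nest1 in H1, H2.
  rewrite (JJ_mod v s 0) in H1 by (rewrite Nat.Div0.mod_0_l; exact Es).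
  rewrite (JJ_mod v t 0) in H2 by (rewrite Nat.Div0.mod_0_l; exact Et).
  unfold JJ in *; lra.
Qed.

Lemma core_cont k : cont_on g1 g2 (Nat.iter k f).
Proof.
  destruct Hcore as [_ [_ [Hlt _]]].
  apply cont_on_subset with 0 1; [apply iter_cont_I; assumption| |].
  - apply (JJ_in_I v 0), core_JJ. lra.
  - apply (JJ_in_I v 0), core_JJ. lra.
Qed.

Definition core_image i := image_on (Nat.iter (i * 2 ^ v) f) g1 g2.

(** A multiple of [2 ^ v] steps preserves phase 0 of level [v] and keeps different halves different.
    So [g1] and [g2] go to points of the simple set in different halves, which straddle the core. *)
Lemma core_self i y : g1 <= y <= g2 -> core_image i y.
Proof.
  destruct Hcore as [S1 [S2 [Hlt [[s [t [H1 [H2 [Es [Et Hne]]]]]] Hstr]]]]. intros Hy.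
  assert (A1 := JJ_fwd _ _ (i * 2 ^ v) _ H1). assert (A2 := JJ_fwd _ _ (i * 2 ^ v) _ H2).
  assert (M : forall r, (r mod 2 ^ v = 0 -> (i * 2 ^ v + r) mod 2 ^ v = 0)%nat).
  { intros r Hr. rewrite Nat.add_comm, Nat.Div0.mod_add. exact Hr. }
  assert (I1 : core_image i (Nat.iter (i * 2 ^ v) f g1)) by (exists g1; split; [lra|reflexivity]).
  assert (I2 : core_image i (Nat.iter (i * 2 ^ v) f g2)) by (exists g2; split; [lra|reflexivity]).
  destruct (Hstr _ _ _ _ (simple_iter _ _ S1) (simple_iter _ _ S2) A1 A2 (M _ Es) (M _ Et)) as [[B1 B2]|[B1 B2]].
  - intros E. apply Hne. eapply mod_add_cancel; exact E.
  - eapply image_on_connected; [apply core_cont|exact I1|exact I2|lra].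
  - eapply image_on_connected; [apply core_cont|exact I2|exact I1|lra].
Qed.

(** By [core_self] the core is contained in its image after [j - i] rounds; [i] more rounds are then
    applied to both. *)
Lemma core_incr i j y : (i <= j)%nat -> core_image i y -> core_image j y.
Proof.
  intros Hij. replace j with ((j - i) + i)%nat by lia. generalize (j - i)%nat as k. intros k [x [Hx E]].
  destruct (core_self k x Hx) as [x' [Hx' E']]. exists x'. split; [exact Hx'|].
  rewrite Nat.mul_add_distr_r, Nat.add_comm, Nat.iter_add, E'. exact E.
Qed.

Definition core_union y := exists i, core_image i y.

Lemma core_union_JJ y : core_union y -> JJ v 0 y.
Proof.
  intros [i [x [Hx <-]]]. apply JJ_period with (q := i). exists x. split; [|reflexivity]. apply core_JJ; exact Hx.
Qed.

Lemma core_union_step y : core_union y -> core_union (Nat.iter (2 ^ v) f y).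
Proof.
  intros [i [x [Hx E]]]. exists (S i), x. split; [exact Hx|].
  replace (S i * 2 ^ v)%nat with (2 ^ v + i * 2 ^ v)%nat by lia. rewrite Nat.iter_add, E. reflexivity.
Qed.

Lemma core_union_prev y : core_union y -> exists x, core_union x /\ Nat.iter (2 ^ v) f x = y.
Proof.
  intros [i Hi]. apply (core_incr i (S i)) in Hi; [|lia]. destruct Hi as [x [Hx E]].
  exists (Nat.iter (i * 2 ^ v) f x). split; [exists i, x; auto|].
  rewrite <- Nat.iter_add. exact E.
Qed.

Lemma core_union_convex y1 y2 y : core_union y1 -> core_union y2 -> y1 <= y <= y2 -> core_union y.
Proof.
  intros [i Hi] [j Hj] Hy. exists (Nat.max i j).
  eapply image_on_connected; [apply core_cont| | |exact Hy].
  - apply core_incr with i; [lia|exact Hi].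
  - apply core_incr with j; [lia|exact Hj].
Qed.

(* The closure of [core_union] is a periodic interval, so minimality makes it all of [J v 0]. *)
Lemma core_union_dense y : JJ v 0 y -> forall eps, 0 < eps -> exists u, core_union u /\ Rabs (u - y) < eps.
Proof.
  assert (Hlt : g1 < g2) by apply Hcore.
  assert (U1 : core_union g1) by (exists 0%nat; apply core_self; lra).
  destruct (completeness core_union) as [k2 [Hub Hlub]].
  { exists (hi v 0). intros u Hu. apply core_union_JJ in Hu. apply Hu. }
  { exists g1; exact U1. }
  destruct (completeness (fun u => core_union (- u))) as [k1' [Hub1 Hlub1]].
  { exists (- lo v 0). intros u Hu. apply core_union_JJ in Hu. unfold JJ in Hu. lra. }
  { exists (- g1). rewrite Ropp_involutive; exact U1. }
  set (k1 := - k1').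
  assert (Hlb : forall u, core_union u -> k1 <= u).
  { intros u Hu. assert (- u <= k1') by (apply Hub1; rewrite Ropp_involutive; exact Hu). unfold k1; lra. }
  assert (HinJ : lo v 0 <= k1 /\ k2 <= hi v 0).
  { split.
    - assert (k1' <= - lo v 0); [|unfold k1; lra]. apply Hlub1. intros u Hu.
      apply core_union_JJ in Hu. unfold JJ in Hu. lra.
    - apply Hlub. intros u Hu. apply core_union_JJ in Hu. apply Hu. }
  assert (Hdense : forall x, k1 <= x <= k2 -> forall eps, 0 < eps -> exists u, core_union u /\ Rabs (u - x) < eps).
  { intros x Hx eps He. apply NNPP; intros Hno.
    assert (Hfar : forall u, core_union u -> u <= x - eps \/ x + eps <= u).
    { intros u Hu. apply NNPP; intros H. apply Hno. exists u; split; [exact Hu|]. apply Rabs_lt_iff; lra. }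
    destruct (Hfar g1 U1) as [Hg|Hg].
    - assert (Hb : is_upper_bound core_union (x - eps)).
      { intros u Hu. destruct (Hfar u Hu) as [H|H]; [exact H|].
        destruct (Hfar x); [apply (core_union_convex g1 u x); auto; lra|lra|lra]. }
      specialize (Hlub _ Hb). lra.
    - assert (Hb : is_upper_bound (fun u => core_union (- u)) (- (x + eps))).
      { intros u Hu. destruct (Hfar _ Hu) as [H|H]; [|lra].
        destruct (Hfar x); [apply (core_union_convex (- u) g1 x); auto; lra|lra|lra]. }
      specialize (Hlub1 _ Hb). unfold k1 in Hx; lra. }
  assert (Hk : k1 <= k2) by (specialize (Hlb _ U1); specialize (Hub _ U1); lra).
  assert (Hbd := JJ_bounds v 0).
  assert (Hcg : forall k, cont_on k1 k2 (Nat.iter k f)).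
  { intros k. apply cont_on_subset with 0 1; [apply iter_cont_I; assumption|lra|lra]. }
  (* [f^(2^v)] maps [core_union] onto itself; continuity carries the invariance to the closure, and
     compactness of the image gives the other inclusion. *)
  assert (Hper : set_eq (image_iter f (2 ^ v) (interval (k1, k2))) (interval (k1, k2))).
  { intros z. unfold interval; simpl. split.
    - intros [x [Hx <-]].
      split; apply Rnot_lt_le; intros Hl.
      + destruct (Hcg (2 ^ v)%nat x Hx (k1 - Nat.iter (2 ^ v) f x) ltac:(lra)) as [dl [Hdl H]].
        destruct (Hdense x Hx dl Hdl) as [u [Hu Hux]].
        assert (Hu' : k1 <= u <= k2) by (split; [apply Hlb|apply Hub]; exact Hu).
        specialize (H u Hu' Hux). apply Rabs_lt_iff in H.
        specialize (Hlb _ (core_union_step _ Hu)). lra.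
      + destruct (Hcg (2 ^ v)%nat x Hx (Nat.iter (2 ^ v) f x - k2) ltac:(lra)) as [dl [Hdl H]].
        destruct (Hdense x Hx dl Hdl) as [u [Hu Hux]].
        assert (Hu' : k1 <= u <= k2) by (split; [apply Hlb|apply Hub]; exact Hu).
        specialize (H u Hu' Hux). apply Rabs_lt_iff in H.
        specialize (Hub _ (core_union_step _ Hu)). lra.
    - intros Hz. apply NNPP; intros Hno.
      destruct (image_pos_dist k1 k2 (Nat.iter (2 ^ v) f) z (Hcg _)) as [r [Hr Hd]].
      { intros [x [Hx E]]. apply Hno. exists x; split; [exact Hx|exact E]. }
      destruct (Hdense z Hz r Hr) as [u [Hu Huz]].
      destruct (core_union_prev u Hu) as [x [Hx Ex]].
      assert (Hx' : k1 <= x <= k2) by (split; [apply Hlb|apply Hub]; exact Hx).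
      specialize (Hd x Hx'). rewrite Ex in Hd. lra. }
  assert (Hsub : forall z, interval (k1, k2) z -> interval (J v 0%nat) z).
  { intros z Hz. rewrite <- JJ_0. unfold interval in Hz; simpl in Hz. unfold JJ; lra. }
  assert (Heq : set_eq (interval (k1, k2)) (interval (J v 0%nat))).
  { destruct (HJ v) as [[_ [_ [_ [Hdj _]]]] [_ [_ [Hmin _]]]]. apply Hmin; [|clear Hmin|exact Hsub].
    - split; [simpl; exact Hk|]. split; [unfold in_I; simpl; lra|]. split; [unfold in_I; simpl; lra|].
      split; [|exact Hper].
      intros i j Hij Hj z [Hi1 Hj1]. apply (Hdj i j Hij Hj z).
      split; eapply image_iter_sub; try eassumption.
    (* The orbit of [[k1, k2]] has to contain [W]: the orbit of [g1] stays in the finitely many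
       compact images of [[k1, k2]], and [W] is its limit set. *)
    - intros z Hz. apply NNPP; intros Hno.
      destruct (finite_min_pos (fun k r => forall x, k1 <= x <= k2 -> r <= Rabs (Nat.iter k f x - z)) (2 ^ v))
        as [r [Hr Hd]].
      + intros k r r' H Hrr x Hx. specialize (H x Hx). lra.
      + intros k Hkv. apply image_pos_dist; [apply Hcg|]. intros [x [Hx E]].
        apply Hno. exists k. split; [exact Hkv|]. exists x. split; [exact Hx|exact E].
      + assert (Hom : omega_limit f g1 z) by (apply (simple_omega g1); [apply Hcore|exact Hz]).
        destruct (Hom r Hr 0%nat) as [n [_ [_ Hn]]].
        assert (En : (n = n mod 2 ^ v + n / 2 ^ v * 2 ^ v)%nat) by (pose proof (Nat.div_mod_eq n (2 ^ v)); lia).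
        rewrite En, Nat.iter_add in Hn.
        assert (Hu : core_union (Nat.iter (n / 2 ^ v * 2 ^ v) f g1)).
        { exists (n / 2 ^ v)%nat, g1. split; [lra|reflexivity]. }
        specialize (Hd (n mod 2 ^ v)%nat
          ltac:(apply Nat.mod_upper_bound; pose proof (pow2_pos v); lia) _ (conj (Hlb _ Hu) (Hub _ Hu))).
        lra. }
  intros Hy. apply Hdense. apply Heq. rewrite <- JJ_0. exact Hy.
Qed.

Lemma core_covers t p q : lo v t < p -> q < hi v t ->
  exists i0, forall i, (i0 <= i)%nat -> forall y, p <= y <= q ->
    image_on (Nat.iter (t + i * 2 ^ v) f) g1 g2 y.
Proof.
  intros Hp Hq.
  assert (Happ : forall e, JJ v t e -> forall eps, 0 < eps -> exists u, core_union u /\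
            Rabs (Nat.iter t f u - e) < eps).
  { intros e He eps Heps. rewrite JJ_image in He. destruct He as [x [Hx <-]].
    destruct (iter_cont_JJ v 0 t x Hx eps Heps) as [dl [Hdl H]].
    destruct (core_union_dense x Hx dl Hdl) as [u [Hu Hux]].
    exists u. split; [exact Hu|]. apply H; [apply core_union_JJ; exact Hu|exact Hux]. }
  destruct (Happ _ (lo_in v t) (p - lo v t) ltac:(lra)) as [u1 [[i1 H1] E1]].
  destruct (Happ _ (hi_in v t) (hi v t - q) ltac:(lra)) as [u2 [[i2 H2] E2]].
  apply Rabs_lt_iff in E1, E2.
  exists (Nat.max i1 i2). intros i Hi y Hy.
  apply (core_incr i1 i) in H1; [|lia]. apply (core_incr i2 i) in H2; [|lia].
  eapply image_on_connected with (y1 := Nat.iter t f u1) (y2 := Nat.iter t f u2); [apply core_cont| | |lra].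
  - eapply image_on_iter_add; [exact H1|reflexivity].
  - eapply image_on_iter_add; [exact H2|reflexivity].
Qed.

End Core.

(** * Points that reach a one-point fibre *)

Hypothesis Hcomp : components_Z_indexed f (simple_set J).
Hypothesis Hnoly : ~ LY_chaotic (auto f).

Lemma nontrivial_fibre_iter k x : nontrivial_fibre x -> nontrivial_fibre (Nat.iter k f x).
Proof. intros H. induction k as [|k IH]; [exact H|]. apply nontrivial_fibre_step; assumption. Qed.

Definition reaches_point x := in_I x /\ exists l, point_fibre (Nat.iter l f x).

Lemma nontrivial_not_reaching x : nontrivial_fibre x -> ~ reaches_point x.
Proof. intros H [_ [l [_ Hl]]]. apply Hl, nontrivial_fibre_iter, H. Qed.

(** The fibre of [g] never becomes a point, so after [l] steps [x] and [g] are in different fibres.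
    Let these part at level [v]. Moved on to phase 0, the two images straddle the gap core; so the
    segment between [x] and [g] covers the core, and later any compact part of the interior of
    [JJ v t]. All large multiples of [2 ^ v] work, which allows a common time for two such
    segments. *)
Lemma expansion x g : reaches_point x -> simple g -> nontrivial_fibre g ->
  exists v, forall t p q, JJ v t g -> lo v t < p -> q < hi v t ->
    exists i1, forall i, (i1 <= i)%nat -> forall y, p <= y <= q ->
      image_on (Nat.iter (i * 2 ^ v) f) (Rmin x g) (Rmax x g) y.
Proof.
  intros [HxI [l [Hz1 Hz2]]] Hg Hng.
  set (z := Nat.iter l f x) in *.
  assert (Hsep : ~ same_fibre z (Nat.iter l f g)).
  { intros Hs. destruct (nontrivial_fibre_iter l g Hng) as [y [Hy Hne]].
    assert (Hzy : forall w, same_fibre (Nat.iter l f g) w -> w = z).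
    { intros w Hw. apply NNPP; intros Hwz. apply Hz2. exists w. split; [|exact Hwz].
      intros n. destruct (Hs n) as [r [R1 R2]]. exists r; split; [exact R1|].
      eapply same_fibre_JJ; [exact Hw|exact R2]. }
    apply Hne. rewrite (Hzy y Hy). symmetry. apply Hzy. intros n.
    destruct (Hs n) as [r [R1 R2]]. exists r; auto. }
  destruct (separation_level z (Nat.iter l f g) Hz1 (simple_iter l g Hg) Hsep) as [v [s [s' [Hs [Hs' [Hne Heq]]]]]].
  exists v. intros t p q Ht Hp Hq.
  destruct (gap_core_exists v) as [g1 [g2 Hcore]].
  assert (Hpos := pow2_pos v).
  assert (Hr : (s mod 2 ^ v < 2 ^ v)%nat) by (apply Nat.mod_upper_bound; lia).
  (* The wait from phase [s] to phase 0 of level [v]. *)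
  set (i0 := (2 ^ v - s mod 2 ^ v)%nat).
  assert (Hi0 : ((i0 + s) mod 2 ^ v = 0)%nat).
  { pose proof (Nat.div_mod_eq s (2 ^ v)).
    replace (i0 + s)%nat with ((1 + s / 2 ^ v) * 2 ^ v)%nat by (unfold i0; nia). apply Nat.Div0.mod_mul. }
  assert (Hi0' : ((i0 + s') mod 2 ^ v = 0)%nat).
  { rewrite Nat.Div0.add_mod, <- Heq, <- Nat.Div0.add_mod. exact Hi0. }
  assert (A1 := JJ_fwd _ _ i0 _ Hs). assert (A2 := JJ_fwd _ _ i0 _ Hs').
  assert (HgI := simple_in_I _ Hg).
  assert (Hc : forall k, cont_on (Rmin x g) (Rmax x g) (Nat.iter k f)).
  { intros k. apply cont_on_subset with 0 1; [apply iter_cont_I; assumption| |].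
    - apply Rmin_glb; [apply HxI|apply HgI].
    - apply Rmax_lub; [apply HxI|apply HgI]. }
  assert (B1 : image_on (Nat.iter (i0 + l) f) (Rmin x g) (Rmax x g) (Nat.iter i0 f z)).
  { exists x. split; [split; [apply Rmin_l|apply Rmax_l]|]. apply Nat.iter_add. }
  assert (B2 : image_on (Nat.iter (i0 + l) f) (Rmin x g) (Rmax x g) (Nat.iter i0 f (Nat.iter l f g))).
  { exists g. split; [split; [apply Rmin_r|apply Rmax_r]|]. apply Nat.iter_add. }
  assert (Hcov : forall y, g1 <= y <= g2 -> image_on (Nat.iter (i0 + l) f) (Rmin x g) (Rmax x g) y).
  { intros y Hy. destruct Hcore as [_ [_ [_ [_ Hstr]]]].
    destruct (Hstr _ _ _ _ (simple_iter i0 _ Hz1) (simple_iter i0 _ (simple_iter l g Hg)) A1 A2 Hi0 Hi0')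
      as [[C1 C2]|[C1 C2]].
    - intros E. apply Hne. eapply mod_add_cancel; exact E.
    - eapply image_on_connected; [apply Hc|exact B1|exact B2|lra].
    - eapply image_on_connected; [apply Hc|exact B2|exact B1|lra]. }
  destruct (core_covers v g1 g2 Hcore t p q Hp Hq) as [j0 Hj0].
  (* the total time is a multiple of [2^v] because [g] returns to its phase *)
  assert (Hmult : ((i0 + l + t) mod 2 ^ v = 0)%nat).
  { apply JJ_nest1 in A2. rewrite <- Nat.iter_add in A2.
    rewrite (JJ_disj v _ _ _ (JJ_fwd v t (i0 + l) g Ht) A2). exact Hi0'. }
  assert (Hdiv := Nat.div_mod_eq (i0 + l + t) (2 ^ v)). rewrite Hmult in Hdiv.
  set (a := ((i0 + l + t) / 2 ^ v)%nat) in *.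
  exists (j0 + a)%nat. intros i Hi y Hy.
  destruct (Hj0 (i - a)%nat ltac:(lia) y Hy) as [w [Hw Ew]].
  replace (i * 2 ^ v)%nat with (t + (i - a) * 2 ^ v + (i0 + l))%nat.
  - eapply image_on_iter_add; [apply Hcov; exact Hw|exact Ew].
  - assert ((i - a) * 2 ^ v + a * 2 ^ v = i * 2 ^ v)%nat by (rewrite <- Nat.mul_add_distr_r; f_equal; lia). lia.
Qed.

Section Konig.

Variables (k : nat -> nat) (eps : R).
Hypothesis Heps : 0 < eps.
Hypothesis Hk : forall n, (k (S n) mod 2 ^ n = k n mod 2 ^ n)%nat.
Hypothesis Hwide : forall n, exists x y, reaches_point x /\ reaches_point y /\
  JJ n (k n) x /\ JJ n (k n) y /\ eps <= y - x.

Lemma branch_nest i n y : (i <= n)%nat -> JJ n (k n) y -> JJ i (k i) y.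
Proof.
  intros Hin. induction Hin as [|n Hin IH]; [auto|].
  intros Hy. apply IH. apply JJ_nest1 in Hy. rewrite <- (JJ_mod _ _ _ (Hk n)). exact Hy.
Qed.

(** The intervals of the branch shrink to a segment [[a, b]] of length at least [eps], contained in
    one nontrivial fibre. No reaching point lies in it, so such points accumulate at [a] from the
    left and at [b] from the right, and [expansion] supplies the hypothesis of
    [two_sided_expansion_chaos]. *)
Lemma branch_chaotic : False.
Proof.
  assert (Hw : forall n, eps <= hi n (k n) - lo n (k n)).
  { intros n. destruct (Hwide n) as [x [y [_ [_ [Hx [Hy H]]]]]]. unfold JJ in *; lra. }
  assert (Hlohi : forall i j, lo i (k i) <= hi j (k j) - eps).
  { intros i j. assert (A := branch_nest i (Nat.max i j) _ ltac:(lia) (lo_in _ _)).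
    assert (B := branch_nest j (Nat.max i j) _ ltac:(lia) (hi_in _ _)).
    specialize (Hw (Nat.max i j)). unfold JJ in *. lra. }
  destruct (completeness (fun x => exists i, x = lo i (k i))) as [a [Haub Halub]].
  { exists (hi 0 (k 0%nat) - eps). intros x [i ->]. apply Hlohi. }
  { exists (lo 0 (k 0%nat)), 0%nat. reflexivity. }
  destruct (completeness (fun x => exists i, x = - hi i (k i))) as [b' [Hbub Hblub]].
  { exists (- lo 0 (k 0%nat)). intros x [i ->]. specialize (Hlohi 0%nat i). lra. }
  { exists (- hi 0 (k 0%nat)), 0%nat. reflexivity. }
  set (b := - b').
  assert (Ha : forall i, lo i (k i) <= a) by (intros i; apply Haub; exists i; reflexivity).
  assert (Hb : forall i, b <= hi i (k i)).
  { intros i. assert (- hi i (k i) <= b') by (apply Hbub; exists i; reflexivity). unfold b; lra. }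
  assert (Hab : eps <= b - a).
  { assert (H1 : forall j, a <= hi j (k j) - eps) by (intros j; apply Halub; intros x [i ->]; apply Hlohi).
    assert (b' <= - (a + eps)); [|unfold b; lra].
    apply Hblub. intros x [j ->]. specialize (H1 j). lra. }
  assert (Hclose : forall d, 0 < d -> exists n, a - d < lo n (k n) /\ hi n (k n) < b + d).
  { intros d Hd.
    assert (E1 : exists i, a - d < lo i (k i)).
    { apply NNPP; intros H. assert (a <= a - d); [|lra]. apply Halub. intros x [i ->].
      apply Rnot_lt_le; intros Hl. apply H; exists i; exact Hl. }
    assert (E2 : exists j, hi j (k j) < b + d).
    { apply NNPP; intros H. assert (b' <= b' - d); [|lra]. apply Hblub. intros x [i ->].
      apply Rnot_lt_le; intros Hl. apply H; exists i; unfold b; lra. }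
    destruct E1 as [i Hi]. destruct E2 as [j Hj]. exists (Nat.max i j).
    assert (A := branch_nest i (Nat.max i j) _ ltac:(lia) (lo_in _ _)).
    assert (B := branch_nest j (Nat.max i j) _ ltac:(lia) (hi_in _ _)).
    unfold JJ in *. lra. }
  assert (Hin : forall y, a <= y <= b -> forall n, JJ n (k n) y).
  { intros y Hy n. specialize (Ha n). specialize (Hb n). unfold JJ; lra. }
  assert (Hsimple : forall y, a <= y <= b -> simple y /\ nontrivial_fibre y).
  { intros y Hy. split; [intros n; exists (k n); apply Hin; exact Hy|].
    destruct (Req_dec y a) as [E|E].
    - exists b. split; [|lra]. intros n; exists (k n); split; apply Hin; lra.
    - exists a. split; [|lra]. intros n; exists (k n); split; apply Hin; lra. }
  assert (Hsides : forall d, 0 < d -> exists x y, reaches_point x /\ reaches_point y /\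
     a - d < x < a /\ b < y < b + d).
  (* Two points at distance at least [eps] do not fit into one collar of width at most [eps / 2], so
     they are on different sides of [[a, b]]. *)
  { intros d Hd. destruct (Hclose (Rmin d (eps / 2))) as [n [H1 H2]]; [apply Rmin_glb_lt; lra|].
    pose proof (Rmin_l d (eps / 2)). pose proof (Rmin_r d (eps / 2)).
    destruct (Hwide n) as [x [y [Rx [Ry [Hx [Hy Hxy]]]]]].
    assert (Nx : ~ (a <= x <= b)).
    { intros H'. apply (nontrivial_not_reaching x); [apply Hsimple; exact H'|exact Rx]. }
    assert (Ny : ~ (a <= y <= b)).
    { intros H'. apply (nontrivial_not_reaching y); [apply Hsimple; exact H'|exact Ry]. }
    exists x, y. unfold JJ in Hx, Hy. split; [exact Rx|]. split; [exact Ry|].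
    split; [split; [lra|]|split; [|lra]]; apply Rnot_le_lt; intros H'.
    - apply Nx. lra.
    - apply Ny. lra. }
  (* If an end point were shared with [[a, b]], no reaching point could lie on that side at later
     levels. *)
  assert (Hint : forall n, lo n (k n) < a /\ b < hi n (k n)).
  { intros n. apply NNPP; intros H.
    assert (Hc : lo n (k n) = a \/ hi n (k n) = b) by (specialize (Ha n); specialize (Hb n);
      destruct (Rlt_dec (lo n (k n)) a); [right; lra|left; lra]).
    destruct (Hclose (eps / 2) ltac:(lra)) as [m [Hm1 Hm2]].
    destruct (Hwide (Nat.max n m)) as [x [y [Rx [Ry [Hx [Hy Hxy]]]]]].
    assert (Hxn := branch_nest n (Nat.max n m) _ ltac:(lia) Hx). assert (Hyn := branch_nest n (Nat.max n m) _ ltac:(lia) Hy).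
    assert (Hxm := branch_nest m (Nat.max n m) _ ltac:(lia) Hx). assert (Hym := branch_nest m (Nat.max n m) _ ltac:(lia) Hy).
    unfold JJ in *. destruct Hc as [E|E].
    - apply (nontrivial_not_reaching x); [apply Hsimple; lra|exact Rx].
    - apply (nontrivial_not_reaching y); [apply Hsimple; lra|exact Ry]. }
  apply Hnoly.
  assert (I0 := Hint 0%nat). assert (Bd := JJ_bounds 0 (k 0%nat)).
  apply (two_sided_expansion_chaos f a b (Rmin a (1 - b))); try assumption; try lra.
  - apply Rmin_glb_lt; lra.
  - pose proof (Rmin_l a (1 - b)); lra.
  - pose proof (Rmin_r a (1 - b)); lra.
  - intros d [Hd _].
    destruct (Hsides d Hd) as [x [y [Rx [Ry [Hx Hy]]]]].
    destruct (Hsimple a ltac:(lra)) as [Sa Na]. destruct (Hsimple b ltac:(lra)) as [Sb Nb].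
    destruct (expansion x a Rx Sa Na) as [v1 H1]. destruct (expansion y b Ry Sb Nb) as [v2 H2].
    destruct (Hint v1) as [I1 I1']. destruct (Hint v2) as [I2 I2'].
    set (d' := Rmin (d / 2) (Rmin (Rmin ((a - lo v1 (k v1)) / 2) ((hi v1 (k v1) - b) / 2))
       (Rmin ((a - lo v2 (k v2)) / 2) ((hi v2 (k v2) - b) / 2)))).
    assert (Hd' : 0 < d' /\ d' <= d / 2 /\ d' <= (a - lo v1 (k v1)) / 2 /\ d' <= (hi v1 (k v1) - b) / 2 /\
      d' <= (a - lo v2 (k v2)) / 2 /\ d' <= (hi v2 (k v2) - b) / 2).
    { unfold d'. split; [repeat apply Rmin_glb_lt; lra|].
      repeat (apply conj || (unfold Rmin; repeat destruct Rle_dec; lra)). }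
    destruct (H1 (k v1) (a - d') (b + d')) as [i1 J1]; [apply Hin; lra|lra|lra|].
    destruct (H2 (k v2) (a - d') (b + d')) as [i2 J2]; [apply Hin; lra|lra|lra|].
    (* A common multiple of both periods beyond both thresholds; the [+ 1] makes it positive. *)
    exists d', ((i1 + i2 + 1) * 2 ^ v2 * 2 ^ v1)%nat.
    assert (P1 := pow2_pos v1). assert (P2 := pow2_pos v2).
    split; [lra|]. split; [nia|].
    intros z Hz. split.
    + destruct (J1 ((i1 + i2 + 1) * 2 ^ v2)%nat ltac:(nia) z Hz) as [w [Hwz E]].
      rewrite Rmin_left, Rmax_right in Hwz by lra. exists w; split; [lra|exact E].
    + destruct (J2 ((i1 + i2 + 1) * 2 ^ v1)%nat ltac:(nia) z Hz) as [w [Hwz E]].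
      rewrite Rmin_right, Rmax_left in Hwz by lra.
      replace ((i1 + i2 + 1) * 2 ^ v2 * 2 ^ v1)%nat with ((i1 + i2 + 1) * 2 ^ v1 * 2 ^ v2)%nat by lia.
      exists w; split; [lra|exact E].
Qed.

End Konig.

(** König's lemma on the binary tree of phases: if wide intervals occur at every level, some
    infinite branch is wide throughout, which [branch_chaotic] excludes. *)
Lemma reaching_points_cluster eps : 0 < eps -> exists n, forall t x y,
  reaches_point x -> reaches_point y -> JJ n t x -> JJ n t y -> Rabs (x - y) < eps.
Proof.
  intros Heps. apply NNPP; intros Hno.
  set (bad := fun n t => exists x y, reaches_point x /\ reaches_point y /\
     JJ n t x /\ JJ n t y /\ eps <= y - x).
  assert (Hbad : forall n, exists t, bad n t).
  { intros n. apply NNPP; intros H. apply Hno. exists n. intros t x y Rx Ry Hx Hy.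
    apply Rnot_le_lt; intros Hxy. apply H. exists t. unfold Rabs in Hxy. destruct Rcase_abs in Hxy.
    - exists x, y. repeat split; try apply Rx; try apply Ry; try apply Hx; try apply Hy; lra.
    - exists y, x. repeat split; try apply Rx; try apply Ry; try apply Hx; try apply Hy; lra. }
  assert (Hmono : forall m n t, (m <= n)%nat -> bad n t -> bad m t).
  { intros m n t Hmn [x [y [Rx [Ry [Hx [Hy H]]]]]]. exists x, y.
    apply (JJ_nest m n) in Hx; [|exact Hmn]. apply (JJ_nest m n) in Hy; [|exact Hmn]. auto. }
  assert (Hmod : forall n s t, (s mod 2 ^ n = t mod 2 ^ n)%nat -> bad n s -> bad n t).
  { intros n s t E. unfold bad. rewrite (JJ_mod n s t E). auto. }
  (* Phases with wide descendants at all levels; one of the two children of such a phase has the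
     same property. *)
  set (deep := fun n t => forall m, (n <= m)%nat -> exists s, (s mod 2 ^ n = t mod 2 ^ n)%nat /\ bad m s).
  assert (Hstep : forall n t, deep n t -> exists t', (t' mod 2 ^ n = t mod 2 ^ n)%nat /\ deep (S n) t').
  { intros n t Hd. apply NNPP; intros H.
    assert (H1 : ~ deep (S n) t) by (intros H'; apply H; exists t; auto).
    assert (H2 : ~ deep (S n) (t + 2 ^ n)%nat).
    { intros H'; apply H; exists (t + 2 ^ n)%nat; split; [apply half_mod|exact H']. }
    apply not_all_ex_not in H1. destruct H1 as [m1 H1]. apply imply_to_and in H1. destruct H1 as [M1 H1].
    apply not_all_ex_not in H2. destruct H2 as [m2 H2]. apply imply_to_and in H2. destruct H2 as [M2 H2].
    destruct (Hd (Nat.max m1 m2) ltac:(lia)) as [s [Es Hs]].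
    assert (Hcase : (s mod 2 ^ S n = t mod 2 ^ S n \/ s mod 2 ^ S n = (t + 2 ^ n) mod 2 ^ S n)%nat).
    (* Adding [r] brings phase [t] to 0, where [phase_halves] lists the two phases of the next
       level. *)
    { set (r := (2 ^ n - t mod 2 ^ n)%nat).
      assert (Hr : (t mod 2 ^ n < 2 ^ n)%nat) by (apply Nat.mod_upper_bound; pose proof (pow2_pos n); lia).
      assert (Ht0 : ((r + t) mod 2 ^ n = 0)%nat).
      { pose proof (Nat.div_mod_eq t (2 ^ n)).
        replace (r + t)%nat with ((1 + t / 2 ^ n) * 2 ^ n)%nat by (unfold r; nia). apply Nat.Div0.mod_mul. }
      assert (Hs0 : ((r + s) mod 2 ^ n = 0)%nat).
      { rewrite Nat.Div0.add_mod, Es, <- Nat.Div0.add_mod. exact Ht0. }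
      assert (Ht1 : ((r + (t + 2 ^ n)) mod 2 ^ n = 0)%nat).
      { rewrite Nat.add_assoc, half_mod. exact Ht0. }
      pose proof (half_mod_S n (r + t)) as Hne. rewrite <- Nat.add_assoc in Hne.
      pose proof (phase_halves n _ Ht0). pose proof (phase_halves n _ Hs0). pose proof (phase_halves n _ Ht1).
      destruct (Nat.eq_dec ((r + s) mod 2 ^ S n) ((r + t) mod 2 ^ S n)) as [E|E].
      - left. eapply mod_add_cancel; exact E.
      - right. apply mod_add_cancel with r. lia. }
    destruct Hcase as [E|E].
    - apply H1. exists s. split; [exact E|]. apply Hmono with (Nat.max m1 m2); [lia|exact Hs].
    - apply H2. exists s. split; [exact E|]. apply Hmono with (Nat.max m1 m2); [lia|exact Hs]. }
  destruct (choice (fun (p : nat * nat) t' => deep (fst p) (snd p) ->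
      (t' mod 2 ^ fst p = snd p mod 2 ^ fst p)%nat /\ deep (S (fst p)) t')) as [F HF].
  { intros [n t]. destruct (classic (deep n t)) as [H|H].
    - destruct (Hstep n t H) as [t' Ht']. exists t'. intros _; exact Ht'.
    - exists 0%nat. intros H'; contradiction. }
  set (k := fix k n := match n with O => O | S n => F (n, k n) end).
  assert (Hdeep : forall n, deep n (k n)).
  { induction n as [|n IH].
    - intros m _. destruct (Hbad m) as [s Hs]. exists s; split; [|exact Hs]. simpl. reflexivity.
    - apply (HF (n, k n) IH). }
  apply (branch_chaotic k eps Heps).
  - intros n. apply (HF (n, k n) (Hdeep n)).
  - intros n. destruct (Hdeep n n (le_n n)) as [s [E Hs]]. exact (Hmod n s (k n) E Hs).
Qed.
(** * Maps of one level of the system *)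

(** Agreement with [f] at the end points makes splicing into [f] continuous; the exact target keeps
    the phases in step. *)
Definition level_onto n t g := onto_map (lo n t) (hi n t) (lo n (S t)) (hi n (S t)) g /\
  g (lo n t) = f (lo n t) /\ g (hi n t) = f (hi n t).

Lemma level_onto_f n t : level_onto n t f.
Proof.
  split; [|auto]. split; [exact (iter_cont_JJ n t 1)|]. split.
  - intros x Hx. apply (JJ_step n t). exists x; auto.
  - intros y Hy. apply (JJ_step n t) in Hy. exact Hy.
Qed.

Lemma level_onto_mod n s t g : (s mod 2 ^ n = t mod 2 ^ n)%nat -> level_onto n s g -> level_onto n t g.
Proof.
  intros E. assert (E' : (S s mod 2 ^ n = S t mod 2 ^ n)%nat).
  { rewrite <- !Nat.add_1_l, (Nat.Div0.add_mod 1 s), (Nat.Div0.add_mod 1 t), E. reflexivity. }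
  unfold level_onto. rewrite (lo_mod _ _ _ E), (hi_mod _ _ _ E), (lo_mod _ _ _ E'), (hi_mod _ _ _ E'). auto.
Qed.

Lemma level_onto_ext n t g h : (forall x, JJ n t x -> g x = h x) -> level_onto n t g -> level_onto n t h.
Proof.
  intros E [[H1 [H2 H3]] [H4 H5]]. split; [split; [|split]|split].
  - eapply cont_on_ext; [exact E|exact H1].
  - intros x Hx. rewrite <- (E x Hx). apply H2; exact Hx.
  - intros y Hy. destruct (H3 y Hy) as [x [Hx Ex]]. exists x; split; [exact Hx|]. rewrite <- (E x Hx). exact Ex.
  - rewrite <- E by apply lo_in. exact H4.
  - rewrite <- E by apply hi_in. exact H5.
Qed.

(** The intervals of a level are disjoint, so a single map can serve all phases, and a loop is then
    an iterate of one map. *)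
Definition admissible n g := forall t, level_onto n t g.

Lemma admissible_splice n g t h : admissible n g -> level_onto n t h ->
  admissible n (splice g (lo n t) (hi n t) h).
Proof.
  intros Hg Hh s. destruct (Nat.eq_dec (s mod 2 ^ n) (t mod 2 ^ n)) as [E|E].
  - apply (level_onto_mod n t s); [auto|].
    apply level_onto_ext with h; [|exact Hh]. intros x Hx. symmetry. apply splice_in. exact Hx.
  - apply level_onto_ext with g; [|apply Hg]. intros x Hx. symmetry. apply splice_out.
    intros Hx'. apply E. eapply JJ_disj; [exact Hx|exact Hx'].
Qed.

Lemma admissible_fwd n g t k x : admissible n g -> JJ n t x -> JJ n (k + t) (Nat.iter k g x).
Proof.
  intros Hg Hx. induction k as [|k IH]; [exact Hx|]. apply (Hg (k + t)%nat). exact IH.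
Qed.

Lemma admissible_back n g t k y : admissible n g -> JJ n (k + t) y ->
  exists x, JJ n t x /\ Nat.iter k g x = y.
Proof.
  intros Hg. revert y. induction k as [|k IH]; intros y Hy; [exists y; auto|].
  destruct (Hg (k + t)%nat) as [[_ [_ H]] _]. destruct (H y Hy) as [z [Hz E]].
  destruct (IH z Hz) as [x [Hx Ex]]. exists x; split; [exact Hx|]. simpl. rewrite Ex. exact E.
Qed.

Lemma admissible_cont n g t k : admissible n g -> cont_on (lo n t) (hi n t) (Nat.iter k g).
Proof.
  intros Hg. induction k as [|k IH].
  - intros x Hx eps He. exists eps; split; [exact He|]. simpl; auto.
  - apply (cont_on_comp _ _ (lo n (k + t)) (hi n (k + t)) (Nat.iter k g) g); [exact IH|apply Hg|].
    intros x Hx. apply (admissible_fwd n g t k x Hg Hx).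
Qed.

Section Pack.

(** [kk] is the phase in which the intervals of [l] lie, [k0] the phase just before a short
    interval. *)
Variables (n kk k0 : nat) (eps : R) (l : list (R * R)).
Hypothesis Heps : 0 < eps.
Hypothesis Hsmall : hi n (S k0) - lo n (S k0) < eps.
Hypothesis Hl : subintervals (lo n kk) (hi n kk) l.

(* Small bumps keep the intervals of [l] from being crushed to points on their way. *)
Lemma unflatten r : (r < 2 ^ n)%nat -> exists g, admissible n g /\
  (forall t x, JJ n t x -> Rabs (g x - f x) < eps) /\
  (forall i x, (r <= i < 2 ^ n)%nat -> JJ n (i + kk) x -> g x = f x) /\
  forall F, In F l -> exists p q, p < q /\ forall y, p <= y <= q -> image_on (Nat.iter r g) (fst F) (snd F) y.
Proof.
  induction r as [|r IH]; intros Hr.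
  - exists f. split; [intros t; apply level_onto_f|]. split; [|split].
    + intros t x _. rewrite Rminus_diag, Rabs_R0. exact Heps.
    + auto.
    + intros F HF. destruct (Hl F HF) as [_ [H _]]. exists (fst F), (snd F). split; [exact H|].
      intros y Hy. exists y; auto.
  - destruct (IH ltac:(lia)) as [g [Hg [Hd [Hsame HF]]]].
    destruct (choice (fun F (pq : R * R) => In F l -> fst pq < snd pq /\
      forall y, fst pq <= y <= snd pq -> image_on (Nat.iter r g) (fst F) (snd F) y)) as [C HC].
    { intros F. destruct (classic (In F l)) as [H|H].
      - destruct (HF F H) as [p [q Hpq]]. exists (p, q). auto.
      - exists (0, 0). intros H'; contradiction. }
    assert (Hsub : subintervals (lo n (r + kk)) (hi n (r + kk)) (map C l)).
    { intros E HE. apply in_map_iff in HE. destruct HE as [F [<- HFl]].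
      destruct (HC F HFl) as [H1 H2]. destruct (Hl F HFl) as [L1 [L2 L3]].
      assert (HJ' : forall y, fst (C F) <= y <= snd (C F) -> JJ n (r + kk) y).
      { intros y Hy. destruct (H2 y Hy) as [x [Hx <-]]. apply admissible_fwd; [exact Hg|]. unfold JJ; lra. }
      pose proof (HJ' (fst (C F)) ltac:(lra)). pose proof (HJ' (snd (C F)) ltac:(lra)). unfold JJ in *; lra. }
    destruct (Hg (r + kk)%nat) as [Gon [Ga Gb]].
    destruct (nonconstant_map _ _ _ _ g (map C l) (eps / 2) Gon (JJ_nondeg n (S (r + kk))) Hsub ltac:(lra))
      as [h [Hh [Ha [Hb [Hhd HhF]]]]].
    set (g' := splice g (lo n (r + kk)) (hi n (r + kk)) h).
    assert (Hg' : admissible n g').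
    { apply admissible_splice; [exact Hg|]. split; [exact Hh|]. split; congruence. }
    exists g'. split; [exact Hg'|]. split; [|split].
    + intros t x Hx. unfold g'. destruct (classic (JJ n (r + kk) x)) as [H|H].
      (* At phase [r + kk] the map was still [f], so bumps at different phases do not add up. *)
      * rewrite splice_in by exact H. rewrite <- (Hsame r x ltac:(lia) H). specialize (Hhd x H). lra.
      * rewrite splice_out by exact H. eapply Hd; exact Hx.
    + intros i x Hi Hx. unfold g'. rewrite splice_out; [apply (Hsame i); [lia|exact Hx]|].
      intros H. pose proof (JJ_disj n _ _ _ Hx H) as E.
      rewrite !(Nat.add_comm _ kk) in E. apply mod_add_cancel in E.
      rewrite !Nat.mod_small in E by lia. lia.
    + intros F HFl. destruct (HhF (C F)) as [x [y [Hx [Hy Hxy]]]]; [apply in_map; exact HFl|].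
      destruct (Hl F HFl) as [L1 [L2 L3]].
      (* Since [r < 2 ^ n], the first [r] steps run through phases other than [r + kk], where
         nothing was changed. *)
      assert (Hit : forall i z, (i <= r)%nat -> fst F <= z <= snd F -> Nat.iter i g' z = Nat.iter i g z).
      { induction i as [|i IHi]; intros z Hi Hz; [reflexivity|]. simpl. rewrite IHi by (lia || exact Hz).
        unfold g'. apply splice_out. intros H.
        assert (H' : JJ n (i + kk) (Nat.iter i g z)) by (apply admissible_fwd; [exact Hg|unfold JJ; lra]).
        pose proof (JJ_disj n _ _ _ H' H) as E.
        rewrite !(Nat.add_comm _ kk) in E. apply mod_add_cancel in E.
        rewrite !Nat.mod_small in E by lia. lia. }
      assert (Him : forall z, fst (C F) <= z <= snd (C F) -> image_on (Nat.iter (S r) g') (fst F) (snd F) (h z)).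
      { intros z Hz. destruct (HC F HFl) as [_ H2]. destruct (H2 z Hz) as [w [Hw Ew]].
        exists w. split; [exact Hw|]. simpl. rewrite Hit by (lia || exact Hw). rewrite Ew.
        unfold g'. apply splice_in. rewrite <- Ew. apply admissible_fwd; [exact Hg|unfold JJ; lra]. }
      exists (h x), (h y). split; [exact Hxy|]. intros z Hz.
      eapply image_on_connected; [|apply (Him x Hx)|apply (Him y Hy)|exact Hz].
      eapply cont_on_subset; [apply (admissible_cont n g' kk (S r) Hg')|exact L1|exact L3].
Qed.

(** The intervals of [l] arrive at phase [k0] with nondegenerate images. There [wild_map] stretches
    each over the short [JJ n (S k0)], at a cost below [eps], and the rest of the period, being onto
    at each step, enlarges this to all of [JJ n kk]. *)
Lemma pack_map : exists g, admissible n g /\ (forall t x, JJ n t x -> Rabs (g x - f x) < eps) /\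
  forall F, In F l -> forall y, JJ n kk y -> image_on (Nat.iter (2 ^ n) g) (fst F) (snd F) y.
Proof.
  assert (Hpos := pow2_pos n).
  (* The number of steps from phase [kk] to phase [k0]. *)
  set (r := ((k0 + (2 ^ n - kk mod 2 ^ n)) mod 2 ^ n)%nat).
  assert (Hr : (r < 2 ^ n)%nat) by (apply Nat.mod_upper_bound; lia).
  assert (Hrk : ((r + kk) mod 2 ^ n = k0 mod 2 ^ n)%nat).
  { unfold r. rewrite Nat.Div0.add_mod_idemp_l.
    assert (Hk : (kk mod 2 ^ n < 2 ^ n)%nat) by (apply Nat.mod_upper_bound; lia).
    pose proof (Nat.div_mod_eq kk (2 ^ n)).
    replace (k0 + (2 ^ n - kk mod 2 ^ n) + kk)%nat with (k0 + (1 + kk / 2 ^ n) * 2 ^ n)%nat by nia.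
    apply Nat.Div0.mod_add. }
  assert (HrkS : (S (r + kk) mod 2 ^ n = S k0 mod 2 ^ n)%nat).
  { rewrite <- !Nat.add_1_l, (Nat.Div0.add_mod 1 (r + kk)), (Nat.Div0.add_mod 1 k0), Hrk. reflexivity. }
  destruct (unflatten r Hr) as [g [Hg [Hd [Hsame HF]]]].
  destruct (choice (fun F (pq : R * R) => In F l -> fst pq < snd pq /\
    forall y, fst pq <= y <= snd pq -> image_on (Nat.iter r g) (fst F) (snd F) y)) as [C HC].
  { intros F. destruct (classic (In F l)) as [H|H].
    - destruct (HF F H) as [p [q Hpq]]. exists (p, q). auto.
    - exists (0, 0). intros H'; contradiction. }
  assert (Hsub : subintervals (lo n (r + kk)) (hi n (r + kk)) (map C l)).
  { intros E HE. apply in_map_iff in HE. destruct HE as [F [<- HFl]].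
    destruct (HC F HFl) as [H1 H2]. destruct (Hl F HFl) as [L1 [L2 L3]].
    assert (HJ' : forall y, fst (C F) <= y <= snd (C F) -> JJ n (r + kk) y).
    { intros y Hy. destruct (H2 y Hy) as [x [Hx <-]]. apply admissible_fwd; [exact Hg|]. unfold JJ; lra. }
    pose proof (HJ' (fst (C F)) ltac:(lra)). pose proof (HJ' (snd (C F)) ltac:(lra)). unfold JJ in *; lra. }
  destruct (Hg (r + kk)%nat) as [Gon [Ga Gb]].
  destruct (wild_map _ _ _ _ g (map C l) Gon Hsub) as [h [Hh [Ha [Hb HhF]]]].
  set (g' := splice g (lo n (r + kk)) (hi n (r + kk)) h).
  assert (Hg' : admissible n g').
  { apply admissible_splice; [exact Hg|]. split; [exact Hh|]. split; congruence. }
  exists g'. split; [exact Hg'|]. split.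
  - intros t x Hx. unfold g'. destruct (classic (JJ n (r + kk) x)) as [H|H].
    + rewrite splice_in by exact H. destruct Hh as [_ [Hh _]]. specialize (Hh x H).
      assert (Hfx : JJ n (S (r + kk)) (f x)) by (apply JJ_step; exists x; auto).
      unfold JJ in Hfx. rewrite (lo_mod _ _ _ HrkS), (hi_mod _ _ _ HrkS) in *.
      apply Rabs_lt_iff. lra.
    + rewrite splice_out by exact H. eapply Hd; exact Hx.
  - intros F HFl y Hy. destruct (Hl F HFl) as [L1 [L2 L3]].
    assert (Hy' : JJ n ((2 ^ n - S r) + S (r + kk)) y).
    { rewrite (JJ_mod n _ kk); [exact Hy|].
      replace (2 ^ n - S r + S (r + kk))%nat with (kk + 2 ^ n)%nat by lia. apply half_mod. }
    destruct (admissible_back n g' _ _ y Hg' Hy') as [w [Hw Ew]].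
    destruct (HhF (C F)) with (y := w) as [z [Hz Ez]]; [apply in_map; exact HFl|exact Hw|].
    destruct (HC F HFl) as [_ H2]. destruct (H2 z Hz) as [x [Hx Ex]].
    assert (Hit : forall i, (i <= r)%nat -> Nat.iter i g' x = Nat.iter i g x).
    { induction i as [|i IHi]; intros Hi; [reflexivity|]. simpl. rewrite IHi by lia.
      unfold g'. apply splice_out. intros H.
      assert (H' : JJ n (i + kk) (Nat.iter i g x)) by (apply admissible_fwd; [exact Hg|unfold JJ; lra]).
      pose proof (JJ_disj n _ _ _ H' H) as E.
      rewrite !(Nat.add_comm _ kk) in E. apply mod_add_cancel in E.
      rewrite !Nat.mod_small in E by lia. lia. }
    exists x. split; [exact Hx|].
    replace (2 ^ n)%nat with (2 ^ n - S r + S r)%nat by lia. rewrite Nat.iter_add. simpl Nat.iter at 2.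
    rewrite Hit by lia. rewrite Ex.
    replace (g' z) with w; [exact Ew|].
    unfold g'. rewrite splice_in; [congruence|].
    rewrite <- Ex. apply (admissible_fwd n g kk r x Hg). unfold JJ; lra.
Qed.

End Pack.
(** * The nonautonomous system *)

(** For [i = 0, 1, 2]: the first, third and fifth of five equal parts, separated by the two
    others. *)
Definition fifth a b (i : nat) : R * R := (a + INR (2 * i) * ((b - a) / 5), a + INR (2 * i + 1) * ((b - a) / 5)).

Lemma fifth_separated a b i j x y : a < b -> (i < j)%nat ->
  fst (fifth a b i) <= x <= snd (fifth a b i) -> fst (fifth a b j) <= y <= snd (fifth a b j) ->
  (b - a) / 5 <= y - x.
Proof.
  intros Hab Hij Hx Hy. unfold fifth in *. cbn [fst snd] in Hx, Hy.
  assert (H : (2 * i + 1 + 1 <= 2 * j)%nat) by lia. apply le_INR in H. rewrite (plus_INR (2 * i + 1)) in H.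
  change (INR 1) with 1 in H.
  assert (Hm := Rmult_le_compat_r ((b - a) / 5) _ _ ltac:(lra) H). lra.
Qed.

(** Pulling a set back through the three parts triples it. Points in different parts are apart at
    once; points in the same part are apart one loop after their images were. *)
Lemma separated_points n kk g a b : a < b -> admissible n g -> JJ n kk a -> JJ n kk b ->
  (forall i, (i < 3)%nat -> forall y, JJ n kk y ->
     image_on (Nat.iter (2 ^ n) g) (fst (fifth a b i)) (snd (fifth a b i)) y) ->
  forall K, exists Y, NoDup Y /\ length Y = Nat.pow 3 K /\ (forall y, In y Y -> JJ n kk y) /\
    forall y y', In y Y -> In y' Y -> y <> y' -> exists u, (u < K)%nat /\
      (b - a) / 5 <= Rabs (Nat.iter (u * 2 ^ n) g y - Nat.iter (u * 2 ^ n) g y').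
Proof.
  intros Hab Hg Ha Hb Hcov. induction K as [|K [Y [Hnd [Hlen [HY Hsep]]]]].
  - exists (a :: nil). split; [repeat constructor; auto|]. split; [reflexivity|]. split.
    + intros y [<-|[]]. exact Ha.
    + intros y y' [<-|[]] [<-|[]] H. congruence.
  - destruct (choice (fun (p : nat * R) x => (fst p < 3)%nat -> JJ n kk (snd p) ->
      fst (fifth a b (fst p)) <= x <= snd (fifth a b (fst p)) /\ Nat.iter (2 ^ n) g x = snd p)) as [C HC].
    { intros [i y]. destruct (classic ((i < 3)%nat /\ JJ n kk y)) as [[Hi Hy]|Hno].
      - destruct (Hcov i Hi y Hy) as [x Hx]. exists x. auto.
      - exists 0. simpl. intros H1 H2. exfalso; apply Hno; auto. }
    set (part := fun i => map (fun y => C (i, y)) Y).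
    assert (Hpart : forall i x, (i < 3)%nat -> In x (part i) -> exists y, In y Y /\ x = C (i, y) /\
       fst (fifth a b i) <= x <= snd (fifth a b i) /\ Nat.iter (2 ^ n) g x = y).
    { intros i x Hi Hx. apply in_map_iff in Hx. destruct Hx as [y [<- Hy]].
      destruct (HC (i, y) Hi (HY y Hy)) as [H1 H2]. exists y. auto. }
    assert (Hdis : forall i j x y, (i < 3)%nat -> (j < 3)%nat -> i <> j -> In x (part i) -> In y (part j) ->
       (b - a) / 5 <= Rabs (x - y)).
    { intros i j x y Hi Hj Hij Hx Hy. destruct (Hpart i x Hi Hx) as [_ [_ [_ [X _]]]].
      destruct (Hpart j y Hj Hy) as [_ [_ [_ [X' _]]]].
      destruct (Nat.lt_total i j) as [H|[H|H]]; [|contradiction|].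
      - pose proof (fifth_separated a b i j x y Hab H X X'). unfold Rabs; destruct Rcase_abs; lra.
      - pose proof (fifth_separated a b j i y x Hab H X' X). unfold Rabs; destruct Rcase_abs; lra. }
    assert (Hndp : forall i, (i < 3)%nat -> NoDup (part i)).
    { intros i Hi. apply NoDup_map_NoDup_ForallPairs; [|exact Hnd]. intros y y' Hy Hy' E.
      destruct (HC (i, y) Hi (HY y Hy)) as [_ H1]. destruct (HC (i, y') Hi (HY y' Hy')) as [_ H2].
      simpl in *. congruence. }
    assert (Hne : forall i j x, (i < 3)%nat -> (j < 3)%nat -> i <> j -> In x (part i) -> ~ In x (part j)).
    { intros i j x Hi Hj Hij H1 H2. pose proof (Hdis i j x x Hi Hj Hij H1 H2) as H.
      rewrite Rminus_diag, Rabs_R0 in H. lra. }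
    assert (Hmem : forall x, In x (part 0%nat ++ part 1%nat ++ part 2%nat) -> exists i, (i < 3)%nat /\ In x (part i)).
    { intros x Hx. apply in_app_or in Hx. destruct Hx as [Hx|Hx]; [exists 0%nat; auto|].
      apply in_app_or in Hx. destruct Hx as [Hx|Hx]; [exists 1%nat; auto|exists 2%nat; auto]. }
    exists (part 0%nat ++ part 1%nat ++ part 2%nat). split; [|split; [|split]].
    + apply NoDup_app; [apply Hndp; lia|apply NoDup_app; [apply Hndp; lia|apply Hndp; lia|]|].
      * intros x Hx. apply (Hne 1%nat 2%nat); auto.
      * intros x Hx Hx'. apply in_app_or in Hx'. destruct Hx' as [Hx'|Hx']; revert Hx'; apply (Hne 0%nat); auto.
    + rewrite !length_app. unfold part. rewrite !length_map, Hlen. simpl. lia.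
    + intros x Hx. destruct (Hmem x Hx) as [i [Hi Hxi]]. destruct (Hpart i x Hi Hxi) as [_ [_ [_ [X _]]]].
      unfold fifth in X. cbn [fst snd] in X.
      assert (0 <= INR (2 * i)) by apply pos_INR.
      assert (Hle : (2 * i + 1 <= 5)%nat) by lia. apply le_INR in Hle.
      replace (INR 5) with 5 in Hle by (simpl; lra).
      assert (H0 := Rmult_le_pos _ ((b - a) / 5) H ltac:(lra)).
      assert (H1 := Rmult_le_compat_r ((b - a) / 5) _ _ ltac:(lra) Hle).
      unfold JJ in *. lra.
    + intros x x' Hx Hx' Hxx.
      destruct (Hmem x Hx) as [i [Hi Hxi]]. destruct (Hmem x' Hx') as [j [Hj Hxj]].
      destruct (Nat.eq_dec i j) as [<-|Hij].
      * destruct (Hpart i x Hi Hxi) as [y [Hy [Ex [_ Ey]]]].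
        destruct (Hpart i x' Hi Hxj) as [y' [Hy' [Ex' [_ Ey']]]].
        destruct (Hsep y y' Hy Hy') as [u [Hu Hd]]; [congruence|].
        exists (S u). split; [lia|]. replace (S u * 2 ^ n)%nat with (u * 2 ^ n + 2 ^ n)%nat by lia.
        rewrite !Nat.iter_add, Ey, Ey'. exact Hd.
      * exists 0%nat. split; [lia|]. simpl. apply (Hdis i j); assumption.
Qed.

(** The values of [f] lost on [JJ n t] lie in [JJ n (S t)], which [g] covers. *)
Lemma splice_level n t g : surj_I f -> level_onto n t g ->
  maps_I (splice f (lo n t) (hi n t) g) /\ cont_I (splice f (lo n t) (hi n t) g) /\
  surj_I (splice f (lo n t) (hi n t) g).
Proof.
  intros Hsurj [[H1 [H2 H3]] [H4 H5]]. split; [|split].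
  - intros x Hx. destruct (classic (JJ n t x)) as [H|H].
    + rewrite splice_in by exact H. apply (JJ_in_I n (S t)). apply H2; exact H.
    + rewrite splice_out by exact H. apply Hmap; exact Hx.
  - apply (cont_on_splice 0 1); [apply JJ_lohi|exact Hcont|exact H1|auto|auto].
  - intros y Hy. destruct (Hsurj y Hy) as [x [Hx E]]. destruct (classic (JJ n t x)) as [H|H].
    + destruct (H3 y) as [x' [Hx' E']].
      { rewrite <- E. apply (JJ_step n t). exists x; auto. }
      exists x'. split; [apply (JJ_in_I n t); exact Hx'|]. rewrite splice_in by exact Hx'. exact E'.
    + exists x. split; [exact Hx|]. rewrite splice_out by exact H. exact E.
Qed.

Section Schedule.

(** [ph j] is the phase of the segment [[ga, gb]] at level [j + 1], and [kp j] the phase of level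
    [j] at which block [j] ends. [gp j] is the loop map, [cl j] the crushing map with window
    [[cc j, dd j]], and [step t] the map applied at time [t]. *)
Variables (ph kp : nat -> nat) (gp cl : nat -> R -> R) (cc dd : nat -> R) (step : nat -> R -> R) (ga gb : R).
Hypothesis Hsurj : surj_I f.
Hypothesis Hgab : ga < gb.
Hypothesis Hph : forall j, (ph j < 2 ^ S j)%nat.
Hypothesis Hpa : forall j, JJ (S j) (ph j) ga.
Hypothesis Hpb : forall j, JJ (S j) (ph j) gb.
Hypothesis Hkp : forall j, (kp j < 2 ^ j)%nat.
Hypothesis Hgp : forall j, admissible (S j) (gp j).
Hypothesis Hgpc : forall j t x, JJ (S j) t x -> Rabs (gp j x - f x) < 2 * (1 / 2) ^ j.
Hypothesis Hgpf : forall j i, (i < 3)%nat -> forall y, JJ (S j) (ph j) y ->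
  image_on (Nat.iter (2 ^ S j) (gp j)) (fst (fifth ga gb i)) (snd (fifth ga gb i)) y.
Hypothesis Hcl : forall j, level_onto j (stop kp j) (cl j).
Hypothesis Hcll : forall j x, x <= cc j -> cl j x = f (lo j (stop kp j)).
Hypothesis Hclr : forall j x, dd j <= x -> cl j x = f (hi j (stop kp j)).
Hypothesis Hsml : forall j, hi j (S (stop kp j)) - lo j (S (stop kp j)) <= (1 / 2) ^ j.
Hypothesis Hcd : forall j x, cc j <= x <= dd j -> ~ JJ (S j) (stop kp j) x.
Hypothesis Hnear : forall j l i t x, (l <= stop kp j)%nat -> (i <= j)%nat -> JJ i t x ->
  cc j <= Nat.iter l f x <= dd j ->
  exists x', JJ i t x' /\ reaches_point x' /\ Rabs (x - x') < (1 / 2) ^ j.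
Hypothesis Hstep1 : forall t j, (start j <= t < stop kp j)%nat ->
  step t = splice f (lo (S j) t) (hi (S j) t) (gp j).
Hypothesis Hstep2 : forall j, step (stop kp j) = splice f (lo j (stop kp j)) (hi j (stop kp j)) (cl j).
Hypothesis Hstep3 : forall t, (forall j, ~ (start j <= t <= stop kp j)%nat) -> step t = f.

(** [nds_iter] applies [fs (S t)] at time [t], so the shift makes [step t] lead from time [t] to
    [t + 1]. *)
Let fs (n : nat) : R -> R := step (pred n).

Lemma step_cases t : step t = f \/ exists n g, level_onto n t g /\ step t = splice f (lo n t) (hi n t) g.
Proof.
  destruct (classic (exists j, (start j <= t <= stop kp j)%nat)) as [[j Hj]|Hno].
  - right. destruct (Nat.eq_dec t (stop kp j)) as [->|Hne].
    + exists j, (cl j). split; [apply Hcl|apply Hstep2].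
    + exists (S j), (gp j). split; [apply Hgp|apply Hstep1; lia].
  - left. apply Hstep3. intros j Hj. apply Hno; exists j; exact Hj.
Qed.

Lemma step_good t : maps_I (step t) /\ cont_I (step t) /\ surj_I (step t).
Proof.
  destruct (step_cases t) as [->|[n [g [Hg ->]]]]; [auto|]. apply splice_level; assumption.
Qed.

Lemma fs_good n : maps_I (fs n) /\ cont_I (fs n) /\ surj_I (fs n).
Proof. apply step_good. Qed.

Lemma orbit_I n x : in_I x -> in_I (nds_iter fs n x).
Proof. intros Hx. induction n as [|n IH]; [exact Hx|]. simpl. apply (proj1 (fs_good (S n))); exact IH. Qed.

Lemma orbit_cont n : cont_on 0 1 (nds_iter fs n).
Proof.
  induction n as [|n IH].
  - intros x Hx eps He. exists eps; split; [exact He|]. simpl; auto.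
  - apply (cont_on_comp 0 1 0 1 (nds_iter fs n) (fs (S n))); [exact IH|apply (fs_good (S n))|].
    intros x Hx. apply (orbit_I n x Hx).
Qed.

Lemma orbit_surj n y : in_I y -> exists x, in_I x /\ nds_iter fs n x = y.
Proof.
  revert y. induction n as [|n IH]; intros y Hy; [exists y; auto|].
  destruct (proj2 (proj2 (fs_good (S n))) y Hy) as [z [Hz Ez]].
  destruct (IH z Hz) as [x [Hx Ex]]. exists x. split; [exact Hx|]. simpl. rewrite Ex. exact Ez.
Qed.

Lemma orbit_S n x : nds_iter fs (S n) x = step n (nds_iter fs n x).
Proof. reflexivity. Qed.

Lemma fs_converges : unif_conv fs f.
Proof.
  intros eps He.
  destruct (pow_lt_1_zero (1 / 2)) with (y := eps / 2) as [j0 Hj0]; [rewrite Rabs_right; lra|lra|].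
  exists (S (start j0)). intros n Hn _ x Hx. unfold fs.
  assert (Hpow : forall j, (j0 <= j)%nat -> 2 * (1 / 2) ^ j < eps).
  { intros j Hj. specialize (Hj0 j Hj). rewrite Rabs_right in Hj0; [lra|]. pose proof (half_pow_bound j); lra. }
  set (t := pred n). assert (Ht : (start j0 <= t)%nat) by (unfold t; lia).
  (* Each block ends before the next one starts, so a late time belongs to a late block, whose
     perturbation is small. *)
  assert (Hblock : forall j, (start j <= t <= stop kp j)%nat -> (j0 <= j)%nat).
  { intros j Hj. destruct (Nat.le_gt_cases j0 j) as [H|H]; [exact H|].
    pose proof (stop_lt_start kp j (Hkp j)). pose proof (start_mono (S j) j0 H). lia. }
  destruct (classic (exists j, (start j <= t <= stop kp j)%nat)) as [[j Hj]|Hno].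
  - specialize (Hpow j (Hblock j Hj)). destruct (Nat.eq_dec t (stop kp j)) as [E|Hne].
    + rewrite E, Hstep2. destruct (classic (JJ j (stop kp j) x)) as [H|H].
      * rewrite splice_in by exact H. destruct (Hcl j) as [[_ [Hr _]] _]. specialize (Hr x H).
        assert (Hfx : JJ j (S (stop kp j)) (f x)) by (apply JJ_step; exists x; auto).
        unfold JJ in Hfx. specialize (Hsml j). pose proof (half_pow_bound j). apply Rabs_lt_iff. lra.
      * rewrite splice_out by exact H. rewrite Rminus_diag, Rabs_R0. exact He.
    + rewrite (Hstep1 t j) by lia. destruct (classic (JJ (S j) t x)) as [H|H].
      * rewrite splice_in by exact H. specialize (Hgpc j t x H). lra.
      * rewrite splice_out by exact H. rewrite Rminus_diag, Rabs_R0. exact He.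
  - rewrite Hstep3 by (intros j Hj; apply Hno; exists j; exact Hj). rewrite Rminus_diag, Rabs_R0. exact He.
Qed.

(** * Entropy along the visits to the segment *)

Lemma orbit_in_block j t k x : (start j <= t)%nat -> (t + k <= stop kp j)%nat -> JJ (S j) t (nds_iter fs t x) ->
  nds_iter fs (t + k) x = Nat.iter k (gp j) (nds_iter fs t x) /\ JJ (S j) (t + k) (nds_iter fs (t + k) x).
Proof.
  intros Ht. induction k as [|k IH]; intros Hk Hx; [rewrite Nat.add_0_r; auto|].
  destruct (IH ltac:(lia) Hx) as [E HJk]. rewrite Nat.add_succ_r, orbit_S.
  rewrite (Hstep1 (t + k) j) by lia. rewrite splice_in by exact HJk.
  split; [rewrite E; reflexivity|]. destruct (Hgp j (t + k)%nat) as [[_ [Hr _]] _]. apply Hr; exact HJk.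
Qed.

(** [start] has phase 0, so this is a time at which the right phase is that of [[ga, gb]]. *)
Definition visit (p : nat * nat) : nat := (start (fst p) + ph (fst p) + snd p * 2 ^ S (fst p))%nat.

Definition visits (i : nat) : nat := visit (slot (pred i)).

Lemma visits_increasing : strictly_incr_pos visits.
Proof.
  split.
  - unfold visits, visit. simpl. pose proof (start_ge 0). lia.
  - intros i Hi. unfold visits. destruct i as [|i]; [lia|]. simpl pred.
    pose proof (slot_lt i) as Hs. simpl slot. destruct (slot i) as [j u]. simpl in Hs.
    destruct (Nat.ltb_spec (u + 1) (reps j)); unfold visit; simpl fst; simpl snd.
    + pose proof (pow2_pos (S j)). nia.
    + pose proof (stop_lt_start kp j (Hkp j)). specialize (Hph j). unfold stop in *. nia.
Qed.

(** The points of [separated_points] live at the first visit of block [j]; all maps are onto, so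
    they are pulled back to time 0. Their separations occur at the visits numbered
    [cnt j + u + 1]. *)
Lemma block_separated j eps : 0 < eps < (gb - ga) / 5 ->
  exists E, separated fs visits (cnt (S j)) eps E /\ length E = Nat.pow 3 (reps j).
Proof.
  intros He.
  destruct (separated_points (S j) (ph j) (gp j) ga gb Hgab (Hgp j) (Hpa j) (Hpb j) (Hgpf j) (reps j))
    as [Y [Hnd [Hlen [HY Hsep]]]].
  set (t0 := (start j + ph j)%nat).
  assert (Ht0 : JJ (S j) t0 = JJ (S j) (ph j)).
  { apply JJ_mod. unfold t0, start. rewrite Nat.add_comm. apply Nat.Div0.mod_add. }
  destruct (choice (fun y x => in_I y -> in_I x /\ nds_iter fs t0 x = y)) as [C HC].
  { intros y. destruct (classic (in_I y)) as [Hy|Hy].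
    - destruct (orbit_surj t0 y Hy) as [x Hx]. exists x; auto.
    - exists 0. intros H; contradiction. }
  assert (HYI : forall y, In y Y -> in_I y) by (intros y Hy; eapply JJ_in_I; apply HY; exact Hy).
  exists (map C Y). split; [|rewrite length_map; exact Hlen].
  split; [|split].
  - apply NoDup_map_NoDup_ForallPairs; [|exact Hnd]. intros y y' Hy Hy' E.
    destruct (HC y (HYI y Hy)) as [_ H1]. destruct (HC y' (HYI y' Hy')) as [_ H2]. congruence.
  - intros x Hx. apply in_map_iff in Hx. destruct Hx as [y [<- Hy]]. apply (HC y (HYI y Hy)).
  - intros x x' Hx Hx' Hne. apply in_map_iff in Hx, Hx'.
    destruct Hx as [y [<- Hy]]. destruct Hx' as [y' [<- Hy']].
    destruct (Hsep y y' Hy Hy') as [u [Hu Hd]]; [congruence|].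
    apply Rlt_gt. eapply Rlt_le_trans; [|apply (rho_ge fs visits _ (S (cnt j + u)))].
    + unfold visits. simpl pred. rewrite slot_cnt by exact Hu. unfold visit. simpl fst. simpl snd. fold t0.
      assert (Hin : (t0 + u * 2 ^ S j <= stop kp j)%nat).
      { unfold t0, stop. specialize (Hph j). nia. }
      assert (Horb : forall z, In z Y -> nds_iter fs (t0 + u * 2 ^ S j) (C z) = Nat.iter (u * 2 ^ S j) (gp j) z).
      { intros z Hz. destruct (HC z (HYI z Hz)) as [_ Ez]. rewrite <- Ez at 2.
        apply orbit_in_block; [unfold t0; lia|exact Hin|]. rewrite Ez, Ht0. apply HY; exact Hz. }
      rewrite !Horb by assumption. lra.
    + change (cnt (S j)) with (cnt j + reps j)%nat. lia.
Qed.

(** The first [cnt j + reps j] visits separate [3 ^ reps j] points. As [reps j] is at least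
    [j * cnt j], the rate is at least [ln 3 * j / (j + 1)]. *)
Lemma fs_entropy : exists h, seq_entropy fs visits h /\ ER_ge h (ln 3).
Proof.
  apply (seq_entropy_ge fs visits (ln 3) ((gb - ga) / 5)); [apply orbit_cont|lra|].
  intros eps He d Hd N.
  assert (H3 : 0 < ln 3) by (rewrite <- ln_1; apply ln_increasing; lra).
  destruct (inv_INR_small (d / ln 3)) as [J0 HJ0]; [apply Rdiv_lt_0_compat; assumption|].
  set (j := (N + J0)%nat). destruct (block_separated j eps He) as [E [HE Hlen]].
  assert (Hcnt : forall i, (i <= cnt i)%nat) by (induction i as [|i IH]; simpl; lia).
  exists (cnt (S j)), E. split; [specialize (Hcnt (S j)); unfold j in *; lia|].
  split; [simpl; lia|]. split; [exact HE|]. rewrite Hlen.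
  assert (Hpow : INR (3 ^ reps j) = 3 ^ reps j) by (rewrite pow_INR; f_equal; simpl; lra).
  rewrite Hpow, ln_pow by lra.
  specialize (HJ0 j ltac:(unfold j; lia)).
  assert (Hr : (j * cnt j <= reps j)%nat) by (unfold reps; lia).
  assert (Hc : cnt (S j) = (cnt j + reps j)%nat) by reflexivity. rewrite Hc, plus_INR.
  apply le_INR in Hr. rewrite mult_INR in Hr.
  assert (Hpos : 0 < INR (reps j)) by (apply lt_0_INR; unfold reps; lia).
  pose proof (pos_INR (cnt j)) as Hc0. pose proof (pos_INR j) as Hj0.
  set (c := INR (cnt j)) in *. set (r := INR (reps j)) in *. set (q := INR j) in *.
  apply Rmult_le_reg_r with (c + r); [lra|].
  replace (r * ln 3 / (c + r) * (c + r)) with (r * ln 3) by (field; lra).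
  (* (ln 3 - d)(c + r) <= r ln 3, since c (1 + q) <= c + r and ln 3 / (1 + q) < d *)
  assert (Hd2 : ln 3 < d * (q + 1)).
  { apply Rmult_lt_reg_r with (/ (q + 1)); [apply Rinv_0_lt_compat; lra|].
    rewrite Rmult_assoc, Rinv_r, Rmult_1_r by lra.
    apply Rmult_lt_compat_l with (r := ln 3) in HJ0; [|exact H3].
    replace (ln 3 * (d / ln 3)) with d in HJ0 by (field; lra). exact HJ0. }
  assert (c * ln 3 <= c * (d * (q + 1))) by (apply Rmult_le_compat_l; lra).
  assert (d * (c * (q + 1)) <= d * (c + r)) by (apply Rmult_le_compat_l; nra).
  nra.
Qed.

(** * Crushed, quiet and restless points *)

Definition crushed_left j x := JJ j (stop kp j) (nds_iter fs (stop kp j) x) /\ nds_iter fs (stop kp j) x < cc j.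
Definition crushed_right j x := JJ j (stop kp j) (nds_iter fs (stop kp j) x) /\ dd j < nds_iter fs (stop kp j) x.
Definition never_crushed x := forall j, ~ crushed_left j x /\ ~ crushed_right j x.
Definition moved x t := nds_iter fs (S t) x <> f (nds_iter fs t x).

(** A point moved by a loop map stays in the right phase of level [j + 1] until the block stops. The
    window misses that interval, so the point is crushed. Hence a point that is never crushed is
    moved only at a stop and inside the window. *)
Lemma moved_at_stop x t : never_crushed x -> moved x t -> exists j, t = stop kp j /\
  JJ j t (nds_iter fs t x) /\ cc j <= nds_iter fs t x <= dd j.
Proof.
  intros Hnc Hm. unfold moved in Hm. rewrite orbit_S in Hm.
  assert (Hstop : forall j, JJ j (stop kp j) (nds_iter fs (stop kp j) x) ->
     cc j <= nds_iter fs (stop kp j) x <= dd j).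
  { intros j Hj. destruct (Hnc j) as [H1 H2].
    split; apply Rnot_lt_le; intros Hlt; [apply H1|apply H2]; split; assumption. }
  destruct (classic (exists j, (start j <= t <= stop kp j)%nat)) as [[j Hj]|Hno].
  - destruct (Nat.eq_dec t (stop kp j)) as [E|Hne].
    + exists j. split; [exact E|]. rewrite E in *. rewrite Hstep2 in Hm.
      destruct (classic (JJ j (stop kp j) (nds_iter fs (stop kp j) x))) as [H|H].
      * split; [exact H|apply Hstop; exact H].
      * exfalso. apply Hm. apply splice_out; exact H.
    + exfalso. rewrite (Hstep1 t j) in Hm by lia.
      destruct (classic (JJ (S j) t (nds_iter fs t x))) as [H|H].
      * destruct (orbit_in_block j t (stop kp j - t) x) as [_ HJs]; [lia|lia|exact H|].
        replace (t + (stop kp j - t))%nat with (stop kp j) in HJs by lia.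
        apply (Hcd j _ (Hstop j (JJ_nest1 _ _ _ HJs)) HJs).
      * apply Hm. apply splice_out; exact H.
  - exfalso. apply Hm. rewrite Hstep3; [reflexivity|]. intros j Hj; apply Hno; exists j; exact Hj.
Qed.

Lemma next_move x d t : moved x (t + d) ->
  exists l, nds_iter fs (t + l) x = Nat.iter l f (nds_iter fs t x) /\ moved x (t + l).
Proof.
  revert t. induction d as [|d IH]; intros t Hm.
  - exists 0%nat. rewrite Nat.add_0_r in *. auto.
  - destruct (classic (moved x t)) as [H|H].
    + exists 0%nat. rewrite Nat.add_0_r. auto.
    + assert (E : nds_iter fs (S t) x = f (nds_iter fs t x)) by (apply NNPP; exact H).
      destruct (IH (S t)) as [l [E' Hl]]; [rewrite Nat.add_succ_comm; exact Hm|].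
      exists (S l). rewrite <- Nat.add_succ_comm. split; [|exact Hl].
      rewrite E', E, Nat.iter_succ_r. reflexivity.
Qed.

Definition restless x := never_crushed x /\ forall T, exists t, (T <= t)%nat /\ moved x t.

Lemma late_stop i j : (start i <= stop kp j)%nat -> (i <= j)%nat.
Proof.
  intros H. destruct (Nat.le_gt_cases i j) as [H'|H']; [exact H'|].
  pose proof (stop_lt_start kp j (Hkp j)). pose proof (start_mono (S j) i H'). lia.
Qed.

(** After its first late move the point stays in the right phase of level [i], since both [f] and
    the later window maps respect it. From any time on, the orbit follows [f] up to the next move,
    which is inside a window; so [Hnear] puts the present point near an exact preimage of a
    one-point fibre. *)
Lemma restless_near x i : restless x -> exists T, forall t, (T <= t)%nat ->
  exists x', JJ i t x' /\ reaches_point x' /\ Rabs (nds_iter fs t x - x') < (1 / 2) ^ i.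
Proof.
  intros [Hnc Hio]. destruct (Hio (start i)) as [t0 [Ht0 Hm0]].
  destruct (moved_at_stop x t0 Hnc Hm0) as [j [Ej [HJ0 _]]].
  assert (HJt : forall t, (t0 <= t)%nat -> JJ i t (nds_iter fs t x)).
  { intros t Ht. induction Ht as [|t Ht IH].
    - apply JJ_nest with j; [apply late_stop; lia|exact HJ0].
    - destruct (classic (moved x t)) as [Hm|Hm].
      + destruct (moved_at_stop x t Hnc Hm) as [j' [Ej' [HJ' _]]].
        apply JJ_nest with j'; [apply late_stop; lia|].
        rewrite orbit_S, Ej', Hstep2. rewrite Ej' in HJ'. rewrite splice_in by exact HJ'.
        apply (Hcl j'). exact HJ'.
      + assert (E : nds_iter fs (S t) x = f (nds_iter fs t x)) by (apply NNPP; exact Hm).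
        rewrite E. apply JJ_step. exists (nds_iter fs t x). auto. }
  exists t0. intros t Ht. destruct (Hio t) as [t1 [Ht1 Hm1]].
  replace t1 with (t + (t1 - t))%nat in Hm1 by lia.
  destruct (next_move x _ t Hm1) as [l [El Hml]].
  destruct (moved_at_stop x _ Hnc Hml) as [j1 [Ej1 [_ Hin]]].
  assert (Hij : (i <= j1)%nat) by (apply late_stop; lia).
  rewrite El in Hin.
  destruct (Hnear j1 l i t (nds_iter fs t x)) as [x' [X1 [X2 X3]]]; try assumption; [lia|apply HJt; exact Ht|].
  exists x'. split; [exact X1|]. split; [exact X2|].
  eapply Rlt_le_trans; [exact X3|]. replace j1 with (i + (j1 - i))%nat by lia. rewrite pow_add.
  pose proof (half_pow_bound i). pose proof (half_pow_bound (j1 - i)). nra.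
Qed.

Lemma restless_asymptotic x y : restless x -> restless y -> ~ LY_pair fs x y.
Proof.
  intros Hx Hy. apply asymptotic_not_LY. intros e He.
  destruct (reaching_points_cluster (e / 3) ltac:(lra)) as [n0 Hn0].
  destruct (pow_lt_1_zero (1 / 2)) with (y := e / 3) as [m Hm]; [rewrite Rabs_right; lra|lra|].
  set (i := (n0 + m)%nat). specialize (Hm i ltac:(unfold i; lia)).
  rewrite Rabs_right in Hm by (pose proof (half_pow_bound i); lra).
  destruct (restless_near x i Hx) as [T1 H1]. destruct (restless_near y i Hy) as [T2 H2].
  exists (T1 + T2)%nat. intros t Ht.
  destruct (H1 t ltac:(lia)) as [x' [X1 [X2 X3]]]. destruct (H2 t ltac:(lia)) as [y' [Y1 [Y2 Y3]]].
  assert (H3 := Hn0 t x' y' X2 Y2 (JJ_nest n0 i t x' ltac:(unfold i; lia) X1) (JJ_nest n0 i t y' ltac:(unfold i; lia) Y1)).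
  apply Rabs_lt_iff in X3, Y3, H3. apply Rabs_lt_iff. lra.
Qed.

(** A scrambled set has at most one restless point and at most one point crushed to a given side in
    a given block. Its points that are no longer moved after a given time are countably many, since
    [f] is not chaotic. *)
Lemma fs_not_chaotic : ~ LY_chaotic fs.
Proof.
  intros [A [HI [Hunc HLY]]]. apply Hunc.
  assert (Hone : forall B : R -> Prop, (forall x y, A x -> A y -> B x -> B y -> ~ LY_pair fs x y) ->
     countable_set (fun x => A x /\ B x)).
  { intros B HB. apply subsingleton_countable. intros x y [Ax Bx] [Ay By].
    apply NNPP; intros Hne. apply (HB x y); try assumption. apply HLY; assumption. }
  assert (Hcrush : forall j x, (crushed_left j x -> nds_iter fs (S (stop kp j)) x = f (lo j (stop kp j))) /\
     (crushed_right j x -> nds_iter fs (S (stop kp j)) x = f (hi j (stop kp j)))).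
  { intros j x. rewrite orbit_S, Hstep2.
    split; intros [H1 H2]; rewrite splice_in by exact H1; [apply Hcll|apply Hclr]; lra. }
  set (quiet := fun T x => forall t, (T <= t)%nat -> ~ moved x t).
  apply countable_sub with (fun x => (A x /\ restless x) \/ exists n,
    (A x /\ quiet n x) \/ ((A x /\ crushed_left n x) \/ (A x /\ crushed_right n x))).
  - intros x Ax. apply NNPP; intros H. apply H. left. split; [exact Ax|]. split.
    + intros j. split; intros Hc; apply H; right; exists j; right; [left|right]; auto.
    + intros T. apply NNPP; intros H'. apply H. right. exists T. left. split; [exact Ax|].
      intros t Ht Hm. apply H'. exists t; auto.
  - apply countable_or.
    + apply Hone. intros x y _ _. apply restless_asymptotic.
    + apply (countable_union (fun n x =>
        (A x /\ quiet n x) \/ ((A x /\ crushed_left n x) \/ (A x /\ crushed_right n x)))).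
      intros n. apply countable_or; [|apply countable_or].
      * apply (eventually_autonomous_countable f fs n); [exact Hnoly| | |].
        -- intros x [Ax _]. apply orbit_I, HI, Ax.
        -- intros x [_ Hq] t Ht. apply NNPP. exact (Hq t Ht).
        -- intros x y [Ax _] [Ay _] Hne. apply HLY; assumption.
      * apply Hone. intros x y _ _ Hx Hy. apply (merged_not_LY fs (S (stop kp n))).
        rewrite (proj1 (Hcrush n x) Hx), (proj1 (Hcrush n y) Hy). reflexivity.
      * apply Hone. intros x y _ _ Hx Hy. apply (merged_not_LY fs (S (stop kp n))).
        rewrite (proj2 (Hcrush n x) Hx), (proj2 (Hcrush n y) Hy). reflexivity.
Qed.

End Schedule.

(** The window is a small interval at a one-point fibre [z]. Only finitely many triples of a delay
    [l <= s], a level [i <= j] and a phase of it matter, so [near_fibre] gives one radius for all;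
    where [z] has no preimage, that radius leaves no point to consider. *)
Lemma window j s : exists c d, lo j s <= c /\ c < d /\ d <= hi j s /\
  (forall x, c <= x <= d -> ~ JJ (S j) s x) /\
  forall l i t x, (l <= s)%nat -> (i <= j)%nat -> JJ i t x -> c <= Nat.iter l f x <= d ->
    exists x', JJ i t x' /\ reaches_point x' /\ Rabs (x - x') < (1 / 2) ^ j.
Proof.
  (* Taken in the other half of [JJ j s], so that a small window misses [JJ (S j) s]. *)
  destruct (point_fibre_exists (S j) (s + 2 ^ j)) as [z [Hz HzJ]].
  assert (HzJ' := JJ_other_half j s z HzJ).
  assert (Hzn : ~ JJ (S j) s z).
  { intros H. apply (half_mod_S j s). eapply JJ_disj; [exact HzJ|exact H]. }
  destruct (pos_dist_JJ (S j) z) as [r0 [Hr0 Hd0]].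
  set (Q := fun l i t r => forall x, JJ i t x -> Rabs (Nat.iter l f x - z) < r ->
    exists x', JJ i t x' /\ reaches_point x' /\ Rabs (x - x') < (1 / 2) ^ j).
  assert (HQ : exists r, 0 < r /\ forall l, (l < S s)%nat -> forall i, (i < S j)%nat ->
     forall t, (t < 2 ^ i)%nat -> Q l i t r).
  { apply finite_min_pos.
    { intros l r r' H Hr i Hi t Ht x Hx Hxz. apply (H i Hi t Ht x Hx). lra. }
    intros l Hl. apply finite_min_pos.
    { intros i r r' H Hr t Ht x Hx Hxz. apply (H t Ht x Hx). lra. }
    intros i Hi. apply finite_min_pos.
    { intros t r r' H Hr x Hx Hxz. apply (H x Hx). lra. }
    intros t Ht.
    destruct (near_fibre (lo i t) (hi i t) (Nat.iter l f) z ((1 / 2) ^ j)) as [r [Hr H]];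
      [apply iter_cont_JJ|apply half_pow_bound|].
    exists r. split; [exact Hr|]. intros x Hx Hxz. destruct (H x Hx Hxz) as [x' [X1 [X2 X3]]].
    exists x'. split; [exact X1|]. split; [|exact X3].
    split; [apply (JJ_in_I i t); exact X1|]. exists l. rewrite X2. exact Hz. }
  destruct HQ as [r1 [Hr1 HQ]].
  set (r := Rmin r0 r1).
  assert (Hr : 0 < r /\ r <= r0 /\ r <= r1).
  { unfold r. split; [apply Rmin_glb_lt; assumption|]. split; [apply Rmin_l|apply Rmin_r]. }
  (* The window lies to the right of [z], or to the left when [z] is the right end of [JJ j s]. *)
  assert (Hcd : exists c d, lo j s <= c /\ c < d /\ d <= hi j s /\ z - r < c /\ d < z + r).
  { assert (Hnd := JJ_nondeg j s). unfold JJ in HzJ'. destruct (Rlt_dec z (hi j s)).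
    - exists z, (Rmin (hi j s) (z + r / 2)). pose proof (Rmin_l (hi j s) (z + r / 2)).
      pose proof (Rmin_r (hi j s) (z + r / 2)).
      assert (z < Rmin (hi j s) (z + r / 2)) by (apply Rmin_glb_lt; lra). repeat split; lra.
    - exists (Rmax (lo j s) (z - r / 2)), z. pose proof (Rmax_l (lo j s) (z - r / 2)).
      pose proof (Rmax_r (lo j s) (z - r / 2)).
      assert (Rmax (lo j s) (z - r / 2) < z) by (apply Rmax_lub_lt; lra). repeat split; lra. }
  destruct Hcd as [c [d [C1 [C2 [C3 [C4 C5]]]]]].
  exists c, d. split; [exact C1|]. split; [exact C2|]. split; [exact C3|]. split.
  - intros x Hx HxJ. specialize (Hd0 s Hzn x HxJ).
    assert (Rabs (x - z) < r) by (apply Rabs_lt_iff; lra). lra.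
  - intros l i t x Hl Hi Hx Hlx.
    assert (E : (t mod 2 ^ i mod 2 ^ i = t mod 2 ^ i)%nat) by apply Nat.Div0.mod_mod.
    rewrite <- (JJ_mod _ _ _ E) in *.
    apply (HQ l ltac:(lia) i ltac:(lia) (t mod 2 ^ i)%nat).
    + apply Nat.mod_upper_bound. pose proof (pow2_pos i); lia.
    + exact Hx.
    + apply Rabs_lt_iff; lra.
Qed.

Lemma small_phase j : exists k, (k < 2 ^ j)%nat /\ hi j (S k) - lo j (S k) <= (1 / 2) ^ j.
Proof.
  destruct (small_JJ j) as [q Hq]. assert (Hp := pow2_pos j).
  exists ((q + (2 ^ j - 1)) mod 2 ^ j)%nat. split; [apply Nat.mod_upper_bound; lia|].
  assert (E : (S ((q + (2 ^ j - 1)) mod 2 ^ j) mod 2 ^ j = q mod 2 ^ j)%nat).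
  { rewrite <- Nat.add_1_l, Nat.Div0.add_mod_idemp_r.
    replace (1 + (q + (2 ^ j - 1)))%nat with (q + 2 ^ j)%nat by lia. apply half_mod. }
  rewrite (lo_mod _ _ _ E), (hi_mod _ _ _ E). exact Hq.
Qed.

Lemma nondegenerate_fibre_exists : exists a b, a < b /\ same_fibre a b.
Proof.
  destruct Hcomp as [G [HG _]]. destruct (HG 0%Z) as [[_ [HM [Hco _]]] [u [v [Hu [Hv Huv]]]]].
  assert (HM' : forall z, G 0%Z z -> simple z) by (intros z Hz; apply simple_iff, HM, Hz).
  destruct (Rlt_dec u v).
  - exists u, v. split; [assumption|]. eapply connected_same_fibre; eassumption.
  - exists v, u. split; [lra|]. eapply connected_same_fibre; eassumption.
Qed.

Lemma perturbation_exists : surj_I f -> exists fs : nat -> R -> R,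
  (forall n, (1 <= n)%nat -> maps_I (fs n) /\ cont_I (fs n) /\ surj_I (fs n)) /\
  unif_conv fs f /\
  (exists S, strictly_incr_pos S /\ exists h, seq_entropy fs S h /\ ER_ge h (ln 3)) /\
  ~ LY_chaotic fs.
Proof.
  intros Hsurj. destruct nondegenerate_fibre_exists as [a [b [Hab Hfib]]].
  assert (Hph : forall j, exists p, (p < 2 ^ S j)%nat /\ JJ (S j) p a /\ JJ (S j) p b).
  { intros j. destruct (Hfib (S j)) as [t Ht]. exists (t mod 2 ^ S j)%nat.
    split; [apply Nat.mod_upper_bound; pose proof (pow2_pos (S j)); lia|].
    rewrite (JJ_mod (S j) _ t) by apply Nat.Div0.mod_mod. exact Ht. }
  apply choice in Hph. destruct Hph as [ph Hph].
  destruct (choice _ small_phase) as [kp Hkp].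
  assert (Hgp : forall j, exists g, admissible (S j) g /\
     (forall t x, JJ (S j) t x -> Rabs (g x - f x) < 2 * (1 / 2) ^ j) /\
     forall i, (i < 3)%nat -> forall y, JJ (S j) (ph j) y ->
       image_on (Nat.iter (2 ^ S j) g) (fst (fifth a b i)) (snd (fifth a b i)) y).
  { intros j. pose proof (half_pow_bound j) as Hhalf.
    (* The short interval of level [j] contains the one of level [j + 1] at the same phase. The
       factor 2 turns the bound [(1 / 2) ^ j] on its length into a strict one. *)
    destruct (pack_map (S j) (ph j) (kp j) (2 * (1 / 2) ^ j) (map (fifth a b) (seq 0 3))) as [g [G1 [G2 G3]]].
    - lra.
    - destruct (Hkp j) as [_ Hk].
      pose proof (JJ_nest1 _ _ _ (lo_in (S j) (S (kp j)))) as L1.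
      pose proof (JJ_nest1 _ _ _ (hi_in (S j) (S (kp j)))) as L2. unfold JJ in L1, L2. lra.
    - intros F HF. apply in_map_iff in HF. destruct HF as [i [<- Hi]]. apply in_seq in Hi.
      destruct (Hph j) as [_ [Ja Jb]]. unfold JJ in Ja, Jb. unfold fifth. cbn [fst snd].
      assert (H0 : 0 <= INR (2 * i)) by apply pos_INR.
      assert (H5 : (2 * i + 1 <= 5)%nat) by lia. apply le_INR in H5.
      replace (INR 5) with 5 in H5 by (simpl; lra).
      apply (Rmult_le_compat_r ((b - a) / 5)) in H0; [|lra].
      apply (Rmult_le_compat_r ((b - a) / 5)) in H5; [|lra].
      rewrite plus_INR in *. change (INR 1) with 1 in *. lra.
    - exists g. split; [exact G1|]. split; [exact G2|]. intros i Hi. apply G3.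
      apply in_map, in_seq. lia. }
  apply choice in Hgp. destruct Hgp as [gp Hgp].
  assert (Hwin : forall j, exists cd : R * R, lo j (stop kp j) <= fst cd /\ fst cd < snd cd /\
     snd cd <= hi j (stop kp j) /\ (forall x, fst cd <= x <= snd cd -> ~ JJ (S j) (stop kp j) x) /\
     forall l i t x, (l <= stop kp j)%nat -> (i <= j)%nat -> JJ i t x -> fst cd <= Nat.iter l f x <= snd cd ->
       exists x', JJ i t x' /\ reaches_point x' /\ Rabs (x - x') < (1 / 2) ^ j).
  { intros j. destruct (window j (stop kp j)) as [c [d H]]. exists (c, d). exact H. }
  apply choice in Hwin. destruct Hwin as [cd Hcd].
  assert (Hcl : forall j, exists g, level_onto j (stop kp j) g /\
     (forall x, x <= fst (cd j) -> g x = f (lo j (stop kp j))) /\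
     (forall x, snd (cd j) <= x -> g x = f (hi j (stop kp j)))).
  { intros j. destruct (Hcd j) as [C1 [C2 [C3 _]]].
    destruct (collapsing_map (lo j (stop kp j)) (hi j (stop kp j)) (lo j (S (stop kp j))) (hi j (S (stop kp j)))
      (fst (cd j)) (snd (cd j)) (f (lo j (stop kp j))) (f (hi j (stop kp j))) C1 C2 C3) as [g [G1 [G2 G3]]].
    - apply (JJ_step j). exists (lo j (stop kp j)). split; [apply lo_in|reflexivity].
    - apply (JJ_step j). exists (hi j (stop kp j)). split; [apply hi_in|reflexivity].
    - exists g. split; [|auto]. split; [exact G1|]. split; [apply G2; lra|apply G3; lra]. }
  apply choice in Hcl. destruct Hcl as [cl Hcl].
  assert (Hblock : forall t i j, (start i <= t <= stop kp i)%nat -> (start j <= t <= stop kp j)%nat -> i = j).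
  { assert (H : forall t i j, (start i <= t <= stop kp i)%nat -> (start j <= t <= stop kp j)%nat -> (i <= j)%nat).
    { intros t i j Hi Hj. destruct (Nat.le_gt_cases i j) as [H|H]; [exact H|].
      pose proof (stop_lt_start kp j (proj1 (Hkp j))). pose proof (start_mono (S j) i H). lia. }
    intros t i j Hi Hj. pose proof (H t i j Hi Hj). pose proof (H t j i Hj Hi). lia. }
  (* The three clauses never conflict, because by [Hblock] a time belongs to at most one block. *)
  assert (Hstep : forall t, exists g : R -> R,
    (forall j, (start j <= t < stop kp j)%nat -> g = splice f (lo (S j) t) (hi (S j) t) (gp j)) /\
    (forall j, t = stop kp j -> g = splice f (lo j t) (hi j t) (cl j)) /\
    ((forall j, ~ (start j <= t <= stop kp j)%nat) -> g = f)).
  { intros t. destruct (classic (exists j, (start j <= t <= stop kp j)%nat)) as [[j Hj]|Hno].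
    - destruct (Nat.eq_dec t (stop kp j)) as [E|Hne].
      + exists (splice f (lo j t) (hi j t) (cl j)). split; [|split].
        * intros i Hi. assert (i = j) by (apply (Hblock t); lia). subst i. lia.
        * intros i Ei. pose proof (start_le_stop kp i). assert (i = j) by (apply (Hblock t); lia).
          subst i. reflexivity.
        * intros H. exfalso; exact (H j Hj).
      + exists (splice f (lo (S j) t) (hi (S j) t) (gp j)). split; [|split].
        * intros i Hi. assert (i = j) by (apply (Hblock t); lia). subst i. reflexivity.
        * intros i Ei. pose proof (start_le_stop kp i). assert (i = j) by (apply (Hblock t); lia).
          subst i. contradiction.
        * intros H. exfalso; exact (H j Hj).
    - exists f. split; [|split]; [intros j Hj|intros j Ej|reflexivity]; exfalso; apply Hno; exists j;
        [lia|pose proof (start_le_stop kp j); lia]. }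
  apply choice in Hstep. destruct Hstep as [step Hstep].
  assert (S1 : forall t j, (start j <= t < stop kp j)%nat -> step t = splice f (lo (S j) t) (hi (S j) t) (gp j))
    by (intros t; apply (Hstep t)).
  assert (S2 : forall j, step (stop kp j) = splice f (lo j (stop kp j)) (hi j (stop kp j)) (cl j))
    by (intros j; apply (Hstep (stop kp j)); reflexivity).
  assert (S3 : forall t, (forall j, ~ (start j <= t <= stop kp j)%nat) -> step t = f)
    by (intros t; apply (Hstep t)).
  assert (Hsm : forall j, hi j (S (stop kp j)) - lo j (S (stop kp j)) <= (1 / 2) ^ j).
  { intros j. destruct (Hkp j) as [_ Hk].
    assert (E : (S (stop kp j) mod 2 ^ j = S (kp j) mod 2 ^ j)%nat).
    { rewrite <- !Nat.add_1_l, (Nat.Div0.add_mod 1 (stop kp j)), (Nat.Div0.add_mod 1 (kp j)), stop_mod. reflexivity. }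
    rewrite (lo_mod _ _ _ E), (hi_mod _ _ _ E). exact Hk. }
  assert (P1 : forall j, (ph j < 2 ^ S j)%nat) by (intros j; apply Hph).
  assert (P2 : forall j, JJ (S j) (ph j) a) by (intros j; apply Hph).
  assert (P3 : forall j, JJ (S j) (ph j) b) by (intros j; apply Hph).
  assert (K1 : forall j, (kp j < 2 ^ j)%nat) by (intros j; apply Hkp).
  assert (G1 : forall j, admissible (S j) (gp j)) by (intros j; apply Hgp).
  assert (G2 : forall j t x, JJ (S j) t x -> Rabs (gp j x - f x) < 2 * (1 / 2) ^ j) by (intros j; apply Hgp).
  assert (G3 : forall j i, (i < 3)%nat -> forall y, JJ (S j) (ph j) y ->
     image_on (Nat.iter (2 ^ S j) (gp j)) (fst (fifth a b i)) (snd (fifth a b i)) y) by (intros j; apply Hgp).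
  assert (C1 : forall j, level_onto j (stop kp j) (cl j)) by (intros j; apply Hcl).
  assert (C2 : forall j x, x <= fst (cd j) -> cl j x = f (lo j (stop kp j))) by (intros j; apply Hcl).
  assert (C3 : forall j x, snd (cd j) <= x -> cl j x = f (hi j (stop kp j))) by (intros j; apply Hcl).
  assert (D1 : forall j x, fst (cd j) <= x <= snd (cd j) -> ~ JJ (S j) (stop kp j) x) by (intros j; apply Hcd).
  assert (D2 : forall j l i t x, (l <= stop kp j)%nat -> (i <= j)%nat -> JJ i t x ->
     fst (cd j) <= Nat.iter l f x <= snd (cd j) ->
     exists x', JJ i t x' /\ reaches_point x' /\ Rabs (x - x') < (1 / 2) ^ j) by (intros j; apply Hcd).
  exists (fun n => step (pred n)). split; [|split; [|split]].
  - intros n _. apply (fs_good kp gp cl step); assumption.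
  - apply (fs_converges kp gp cl step); assumption.
  - exists (visits ph). split; [apply (visits_increasing ph kp); assumption|].
    apply (fs_entropy ph kp gp cl step a b); assumption.
  - apply (fs_not_chaotic kp gp cl (fun j => fst (cd j)) (fun j => snd (cd j)) step); assumption.
Qed.

End AssociatedSystem.

Theorem mainTheorem5 (f : R -> R)
  (Hf : maps_I f /\ cont_I f /\ surj_I f)
  (Hi : (exists W, is_omega_limit_set f W /\ infinite_set W /\
           forall W', is_omega_limit_set f W' -> infinite_set W' -> set_eq W' W) /\
        top_entropy f (Fin 0))
  (Hii : ~ LY_chaotic (auto f))
  (Hiii_iv : forall W, is_omega_limit_set f W -> infinite_set W ->
     exists J, assoc_system f W J /\
       nonempty_interior (simple_set J) /\
       components_Z_indexed f (simple_set J)) :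
  exists fs : nat -> R -> R,
    (forall n, (1 <= n)%nat -> maps_I (fs n) /\ cont_I (fs n) /\ surj_I (fs n)) /\
    unif_conv fs f /\
    (exists S, strictly_incr_pos S /\
       exists h, seq_entropy fs S h /\ ER_ge h (ln 3)) /\
    ~ LY_chaotic fs.
Proof.
  destruct Hf as [Hmap [Hcont Hsurj]]. destruct Hi as [[W [HW [Hinf Huniq]]] _].
  destruct (Hiii_iv W HW Hinf) as [J [HJ [_ Hcomp]]].
  apply (perturbation_exists f W J); assumption.
Qed.
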